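(* Let $c_A:=\max\{|m_A^-|,|m_A^+|\}$, $c_B:=\max\{|m_B^-|,|m_B^+|\}$, and assume $\bm z=[z_1,z_2]^{\mathsf T}\in\mathbb{R}^2$ satisfies $\|\bm z\|\le r$ for some $r>0$. With $\mathcal T$, $\overline\theta^A$, $\overline\theta^B$, $g_{12}$, $g_{22}$, $R_A$, $R_B$ as defined in the context, define the constants $$c_\theta=\max\Big\{\sup_{[0,\mathcal T(c_A,c_B)]}\|\overline\theta^A\|_F,\ \sup_{[0,\mathcal T(c_A,c_B)]}\|\overline\theta^B\|_F\Big\},\qquad c_g=\sup_{[0,\mathcal T(c_A,c_B)],\ \|\bm z\|\le r}\big\|[g_{12},g_{22}]^{\mathsf T}\big\|_F,$$ $$d_1:=\frac{1}{(q^{AF}+r^{AF})r_A},\quad d_2:=\frac{2q^{AF}c_\theta}{(q^{AF}+r^{AF})r_A^2}+\frac{2c_\theta}{r_B},\quad d_3:=\frac{q^{AF}r^{AF}c_\theta^2}{(q^{AF}+r^{AF})r_A^3}+\frac{\lambda^{AF}c_g^2}{\sigma_B^2}.$$ If $$T<\min\Big\{\mathcal T(c_A,c_B),\ \frac{\pi}{2\sqrt{(d_1+\frac12)\big(\frac{d_2^2}{2}+d_3\big)}}\Big\},$$ then the Riccati equation $$\begin{aligned} \dot\theta^{AF}={}&\tfrac{1}{q^{AF}+r^{AF}}\theta^{AF}R_A\theta^{AF}+\tfrac{q^{AF}}{(q^{AF}+r^{AF})r_A}\big(\theta^{AF}R_A\overline\theta^A+\overline\theta^AR_A\theta^{AF}\big)+\theta^{AF}R_B\overline\theta^B+\overline\theta^BR_B\theta^{AF}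 \\ &-\tfrac{q^{AF}r^{AF}}{(q^{AF}+r^{AF})r_A^2}\overline\theta^AR_A\overline\theta^A-\tfrac{\lambda^{AF}}{\sigma_B^2}\begin{bmatrix} g_{12}(t,\bm z) \\ g_{22}(t,\bm z) \end{bmatrix}\begin{bmatrix} g_{12}(t,\bm z) \\ g_{22}(t,\bm z) \end{bmatrix}^{\mathsf T},\end{aligned}$$ with terminal condition $\theta^{AF}(T)=0$, admits a unique solution on $[0,T]$.
   Context: Here $T>0$ is a fixed time horizon, $q_A,q_B,r_A,r_B,\sigma_B,q^{AF},r^{AF},\lambda^{AF}>0$ are constants, $m_A\in[m_A^-,m_A^+]$ is a fixed real parameter, and $\pi^B$ is the Gaussian $\mathcal N(\mu_B,\rho_B^2)$ truncated to $[m_B^-,m_B^+]$. The unknown $\theta^{AF}(t)=\theta^{AF}(t;\bm z)$ takes values in the real symmetric $2\times2$ matrices. $\|\cdot\|_F$ is the Frobenius norm and $\|\bm z\|$ the Euclidean norm. For $a,b\in\mathbb{R}$ let $c_1=5(r_A^{-2}+r_B^{-2})^{1/2}$, $c_2(a,b)=\sqrt{q_A^2+q_B^2}\,(1+a^2+b^2)$ and $$\mathcal T(a,b):=(c_1c_2(a,b))^{-1/2}\arctan\!\big((1+a^2+b^2)\,(c_2(a,b)/c_1)^{-1/2}\big).$$ For real $a,b$, $(\theta^A(t;a,b),\theta^B(t;a,b))$ denotes the solution, with values in pairs of real symmetric $2\times2$ matrices, of $$\dot\theta^A=\theta^AR_A\theta^A+\theta^AR_B\theta^B+\theta^BR_B\theta^A-Q_A,\qquad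 \dot\theta^B=\theta^BR_B\theta^B+\theta^AR_A\theta^B+\theta^BR_A\theta^A-Q_B,$$ with $\theta^A(T)=\theta^B(T)=0$, where $$Q_A=q_A\begin{bmatrix} 1 & -a \\ -a & a^2 \end{bmatrix},\quad R_A=\begin{bmatrix} 1/r_A & 0 \\ 0 & 0 \end{bmatrix},\quad Q_B=q_B\begin{bmatrix} b^2 & -b \\ -b & 1 \end{bmatrix},\quad R_B=\begin{bmatrix} 0 & 0 \\ 0 & 1/r_B \end{bmatrix}.$$ Subscripts $jk$ denote the $(j,k)$ entry, and $\partial_{m_A}\theta^B$, $\partial_{m_B}\theta^B$ are the partial derivatives of $\theta^B(t;a,b)$ with respect to $a$ and $b$, respectively. With $M_B\sim\pi^B$ and $Z\sim\mathcal N(0,1)$, define $$\overline\theta^A(t)=\mathbb E^{\pi^B}[\theta^A(t;m_A,M_B)],\qquad \overline\theta^B(t)=\mathbb E^{\pi^B}[\theta^B(t;m_A,M_B)],$$ $$S^{\mu}(t)=\mathbb E\big[\partial_{m_A}\theta^B(t;m_A,\mu_B+\rho_BZ)\big],\quad S^{\rho}(t)=\mathbb E\big[Z\,\partial_{m_A}\theta^B(t;m_A,\mu_B+\rho_BZ)\big],\quad S^{m}(t)=\mathbb E^{\pi^B}\big[\partial_{m_B}\theta^B(t;m_A,M_B)\big],$$ and, for $\bm z=[z_1,z_2]^{\mathsf T}\in\mathbb{R}^2$ and $jk\in\{12,22\}$, $$g_{jk}(t,\bm z)=\tfrac1{r_B}\big(z_1S^{\mu}_{jk}(t)+z_2S^{\rho}_{jk}(t)+S^{m}_{jk}(t)\big).$$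 *)

(* Defs.v *)
From HB Require Import structures.
From mathcomp Require Export all_boot all_order all_algebra.
From mathcomp Require Export all_classical all_reals all_analysis.
Export Order.TTheory GRing.Theory Num.Theory.
Export numFieldNormedType.Exports.

Set Implicit Arguments.
Unset Strict Implicit.
Unset Printing Implicit Defensive.

Local Open Scope classical_set_scope.
Local Open Scope ring_scope.

(* The library's norm on matrices is the sup norm (it induces the same
   topology).  On a column vector [frob] is the Euclidean norm. *)
Definition frob (R : realType) (m n : nat) (M : 'M[R]_(m, n)) : R :=
  Num.sqrt (\sum_i \sum_j M i j ^+ 2).

Definition mx22 (R : realType) (x11 x12 x21 x22 : R) : 'M[R]_2 :=
  \matrix_(i, j) (if i == 0 then (if j == 0 then x11 else x12)
                  else (if j == 0 then x21 else x22)).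

Definition symmetric_on (R : realType) (D : set R) (th : R -> 'M[R]_2) : Prop :=
  forall t, D t -> (th t)^T = th t.

(* Derivative at every point of [D], relative to [D]: for [D] a nondegenerate
   segment this is the two-sided derivative in the interior and the one-sided
   derivative at the end points. *)
Definition has_derivative_on (R : realType) (D : set R)
    (th dth : R -> 'M[R]_2) : Prop :=
  forall t, D t ->
    (u - t)^-1 *: (th u - th t) @[u --> within D t^'] --> dth t.

Definition QA (R : realType) (qA a : R) : 'M[R]_2 :=
  qA *: mx22 1 (- a) (- a) (a ^+ 2).
Definition QB (R : realType) (qB b : R) : 'M[R]_2 :=
  qB *: mx22 (b ^+ 2) (- b) (- b) 1.
Definition RA (R : realType) (rA : R) : 'M[R]_2 := mx22 rA^-1 0 0 0.
Definition RB (R : realType) (rB : R) : 'M[R]_2 := mx22 0 0 0 rB^-1.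

Definition game_riccati_solution (R : realType) (qA qB rA rB a b T : R)
    (D : set R) (thA thB : R -> 'M[R]_2) : Prop :=
  let KA := RA rA in
  let KB := RB rB in
  [/\ symmetric_on D thA /\ symmetric_on D thB,
      has_derivative_on D thA (fun t =>
        thA t *m KA *m thA t + thA t *m KB *m thB t + thB t *m KB *m thA t
        - QA qA a),
      has_derivative_on D thB (fun t =>
        thB t *m KB *m thB t + thA t *m KA *m thB t + thB t *m KA *m thA t
        - QB qB b) &
      thA T = 0 /\ thB T = 0].

Definition c1 (R : realType) (rA rB : R) : R :=
  5 * Num.sqrt (rA ^- 2 + rB ^- 2).
Definition c2 (R : realType) (qA qB a b : R) : R :=
  Num.sqrt (qA ^+ 2 + qB ^+ 2) * (1 + a ^+ 2 + b ^+ 2).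
Definition horizon (R : realType) (qA qB rA rB a b : R) : R :=
  (Num.sqrt (c1 rA rB * c2 qA qB a b))^-1 *
  atan ((1 + a ^+ 2 + b ^+ 2) * (Num.sqrt (c2 qA qB a b / c1 rA rB))^-1).

(* N(m, s^2) conditioned on [l, u]; the last argument of [mnormalize] is only
   a default value, used when [l, u] is a null set. *)
Definition truncated_normal (R : realType) (m s l u : R) :=
  mnormalize (mrestr (normal_prob m s) (@measurable_itv R `[l, u]))
             (normal_prob m s).

Definition mean_mx (R : realType) (d : measure_display) (Om : measurableType d)
    (P : probability Om R) (M : Om -> 'M[R]_2) : 'M[R]_2 :=
  \matrix_(i, j) fine ('E_P[fun w => M w i j])%E.

(* In what follows, [th t a b] is the value at time [t] of the family of
   solutions of the game Riccati system with parameters [a], [b]. *)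
Definition theta_bar (R : realType) (muB rhoB mBl mBu mA : R)
    (th : R -> R -> R -> 'M[R]_2) (t : R) : 'M[R]_2 :=
  mean_mx (truncated_normal muB rhoB mBl mBu) (fun b => th t mA b).

Definition S_mu (R : realType) (muB rhoB mA : R)
    (thB : R -> R -> R -> 'M[R]_2) (t : R) : 'M[R]_2 :=
  mean_mx (normal_prob (0 : R) 1)
    (fun x => derive1 (fun a => thB t a (muB + rhoB * x)) mA).

Definition S_rho (R : realType) (muB rhoB mA : R)
    (thB : R -> R -> R -> 'M[R]_2) (t : R) : 'M[R]_2 :=
  mean_mx (normal_prob (0 : R) 1)
    (fun x => x *: derive1 (fun a => thB t a (muB + rhoB * x)) mA).

Definition S_m (R : realType) (muB rhoB mBl mBu mA : R)
    (thB : R -> R -> R -> 'M[R]_2) (t : R) : 'M[R]_2 :=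
  mean_mx (truncated_normal muB rhoB mBl mBu)
    (fun b => derive1 (fun b' => thB t mA b') b).

(* The column vector (g_12, g_22): its j-th entry is g_j2. *)
Definition gvec (R : realType) (rB muB rhoB mBl mBu mA : R)
    (thB : R -> R -> R -> 'M[R]_2) (t : R) (z : 'cV[R]_2) : 'cV[R]_2 :=
  \col_(j < 2) (rB^-1 *
    (z 0 0 * S_mu muB rhoB mA thB t j 1
     + z 1 0 * S_rho muB rhoB mA thB t j 1
     + S_m muB rhoB mBl mBu mA thB t j 1)).

Definition AF_riccati_rhs (R : realType) (qAF rAF lAF rA rB sB : R)
    (tA tB : 'M[R]_2) (g : 'cV[R]_2) (th : 'M[R]_2) : 'M[R]_2 :=
  (qAF + rAF)^-1 *: (th *m RA rA *m th)
  + (qAF / ((qAF + rAF) * rA)) *: (th *m RA rA *m tA + tA *m RA rA *m th)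
  + th *m RB rB *m tB + tB *m RB rB *m th
  - (qAF * rAF / ((qAF + rAF) * rA ^+ 2)) *: (tA *m RA rA *m tA)
  - (lAF / sB ^+ 2) *: (g *m g^T).

Definition AF_riccati_solution (R : realType) (qAF rAF lAF rA rB sB T : R)
    (tA tB : R -> 'M[R]_2) (g : R -> 'cV[R]_2) (th : R -> 'M[R]_2) : Prop :=
  [/\ symmetric_on `[0, T] th,
      has_derivative_on `[0, T] th
        (fun t => AF_riccati_rhs qAF rAF lAF rA rB sB (tA t) (tB t) (g t) (th t)) &
      th T = 0].

(* Main.v *)
Require Import Defs.
From mathcomp Require Import measurable_realfun ring lra.

Set Implicit Arguments.
Unset Strict Implicit.
Unset Printing Implicit Defensive.

Local Open Scope classical_set_scope.
Local Open Scope ring_scope.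

(* Reverse time, [s = T - t].  In the scalar-state game both [theta^A] and
   [theta^B] solve Lyapunov equations along the closed loop, hence are positive
   semidefinite on [0, T] for every pair of parameters.  This bounds the entries
   22 of [theta^A] and 11 of [theta^B] by integration and the sum of the two
   remaining diagonal entries by a barrier argument, with polynomial growth in [b].
   After the rescaling of [game_quad] the system is quadratic with bounded
   solutions and coefficients of order [1 + |b|], so Gronwall's inequality shows
   that the solution is differentiable in [a] and [b], with derivatives
   [O(exp (k |b|))].  Those are integrable against a Gaussian, and dominated
   convergence makes the coefficients of the last Riccati equation continuous.
   That equation is solved after clipping the unknown at a level [K], which makes
   it globally Lipschitz (Picard iteration); clipping only decreases the
   right-hand side of
     |theta|' <= (d1 + 1/2) |theta|^2 + (d2^2/2 + d3),
   so comparison with a tangent bounds [|theta|] by some [K] on [0, T], and for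
   that [K] the clipping is never active. *)

(** * Clamped time, monotonicity, barriers and Gronwall's inequality *)

Section Calculus.
Context {R : realType}.
Implicit Types (f g df : R -> R) (s t T a b : R).

(** The game is solvable on [[0, tau]] for every pair of parameters, but no estimate uniform in [b]
    comes with it, whereas [S_mu] and [S_rho] integrate over the whole line. A direct Gronwall
    estimate is too weak: entry 11 of [theta^B] is driven by [qB * b ^+ 2] and bounded only to that
    order, so the linearised system would give [expR (k * b ^+ 2)], which for large [k] is not
    integrable against the Gaussian. The rescaling lowers the exponent to order [|b|]; for this the
    a priori bounds must carry matching powers of [|b|]. The last equation asks of its coefficients
    only symmetry, continuity and the bounds [c_theta] and [c_g], which are given; the parameter
    derivatives are studied to obtain continuity in [t]. The halves in [d1 + 1/2] and [d2^2/2] come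
    from [d2 x <= x^2/2 + d2^2/2], which trades the linear term for an equation solved by a tangent.
    Functions known on a segment are composed with [clamp] and become continuous on the whole line,
    so that two-sided derivatives in the open interval suffice for all comparison arguments. *)

Definition clamp a b t : R := Num.max a (Num.min t b).

Lemma clamp_itv a b t : a <= b -> a <= clamp a b t <= b.
Proof.
by move=> ab; rewrite /clamp le_max lexx/= ge_max ab/= ge_min lexx orbT.
Qed.

Lemma clampK a b t : a <= t <= b -> clamp a b t = t.
Proof. by case/andP=> at_ tb; rewrite /clamp (min_idPl tb) (max_idPr at_). Qed.

Lemma rev_clampK b t : 0 <= t <= b -> b - clamp 0 b (b - t) = t.
Proof.
move=> /andP[t0 tb]; rewrite clampK; first by rewrite opprB addrC subrK.
by apply/andP; split; lra.
Qed.

Lemma clamp_continuous a b : continuous (clamp a b).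
Proof.
move=> t; rewrite (_ : clamp a b = cst a \max (id \min cst b))//.
apply: continuous_max; first exact: cvg_cst.
by apply: continuous_min; [exact: cvg_id | exact: cvg_cst].
Qed.

Lemma clamp_lip a b s t : `|clamp a b s - clamp a b t| <= `|s - t|.
Proof.
have st := ler_norm (s - t); have ts := ler_norm (t - s); rewrite distrC in ts.
rewrite /clamp; have [? | ?] := leP s b; have [? | ?] := leP t b;
  rewrite /Num.max; do 2?[case: ifPn; rewrite -?leNgt => ?];
  rewrite ler_norml; apply/andP; split; lra.
Qed.

Lemma normr_clamp_le M t : 0 <= M -> `|clamp (- M) M t| <= `|t|.
Proof.
move=> M0; have := clamp_lip (- M) M t 0.
by rewrite (clampK (t := 0)) ?subr0//; apply/andP; split; lra.
Qed.

Lemma continuous_ext (h1 h2 : R -> R) : h1 =1 h2 -> continuous h1 -> continuous h2.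
Proof. by move/funext => ->. Qed.

Lemma is_derive_ext (f1 f2 : R -> R) t a :
  is_derive t 1 f1 a -> f1 =1 f2 -> is_derive t 1 f2 a.
Proof. by move=> fd /funext <-. Qed.

Lemma dvD f g t a b : is_derive t 1 f a -> is_derive t 1 g b ->
  is_derive t 1 (fun x => f x + g x) (a + b).
Proof. exact: is_deriveD. Qed.

Lemma dvB f g t a b : is_derive t 1 f a -> is_derive t 1 g b ->
  is_derive t 1 (fun x => f x - g x) (a - b).
Proof. exact: is_deriveB. Qed.

Lemma dvM f g t a b : is_derive t 1 f a -> is_derive t 1 g b ->
  is_derive t 1 (fun x => f x * g x) (f t * b + a * g t).
Proof. by move=> ? ?; rewrite [a * _]mulrC; exact: is_deriveM. Qed.

Lemma dvZ f t a c : is_derive t 1 f a -> is_derive t 1 (fun x => c * f x) (c * a).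
Proof. exact: is_deriveZ. Qed.

Lemma dv_expMl k t : is_derive t 1 (fun x => expR (k * x)) (k * expR (k * t)).
Proof.
have dk : is_derive t 1 (fun x => k * x) k.
  by apply: is_derive_eq (dvZ k (is_derive_id t 1)) _; rewrite mulr1.
by rewrite mulrC; exact: (@is_derive1_comp _ expR (fun x => k * x)).
Qed.

Lemma dv_sum n (h : 'I_n -> R -> R) (d : 'I_n -> R) t :
  (forall i, is_derive t 1 (h i) (d i)) ->
  is_derive t 1 (fun x => \sum_i h i x) (\sum_i d i).
Proof.
move=> hd; have := is_derive_sum hd.
by congr (is_derive _ _ _ _); apply/funext => x; rewrite fct_sumE.
Qed.

Lemma dv_continuous f t a : is_derive t 1 f a -> {for t, continuous f}.
Proof.
move=> [fd _]; apply: differentiable_continuous; exact/derivable1_diffP.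
Qed.

Lemma continuous_clamp f a b : a <= b ->
  (forall t, a <= t <= b -> {for t, continuous f}) ->
  continuous (fun t => f (clamp a b t)).
Proof.
move=> ab cf t; apply: (@continuous_comp _ _ _ (clamp a b) f).
  exact: clamp_continuous.
exact/cf/clamp_itv.
Qed.

(** Near an interior point the clamp is the identity. At [0] and [T] the clamped function may have a
    kink, which is why derivatives of clamped functions are claimed for [0 < t < T] only. *)
Lemma dv_clamp f T t a : 0 < t < T -> is_derive t 1 f a ->
  is_derive t 1 (fun x => f (clamp 0 T x)) a.
Proof.
move=> t0T; apply: near_eq_is_derive.
have /near_in_itvoo : t \in `]0, T[ by rewrite in_itv.
apply: filterS => x; rewrite in_itv/= => /andP[x0 xT].
by rewrite clampK// !ltW.
Qed.

Lemma dv_le0_le f df T : continuous f ->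
  (forall t, 0 < t < T -> is_derive t 1 f (df t)) ->
  (forall t, 0 < t < T -> df t <= 0) ->
  forall s t, 0 <= s -> s <= t -> t <= T -> f t <= f s.
Proof.
move=> cf dvf df0 s t s0; rewrite le_eqVlt => /predU1P[->//|st] tT.
have inT x : x \in `]s, t[ -> 0 < x < T.
  by rewrite in_itv/= => /andP[sx xt]; rewrite (le_lt_trans s0 sx) (lt_le_trans xt).
have cst_ : {within `[s, t], continuous f}.
  by apply: continuous_subspaceT => x; exact: cf.
have [c cst] := MVT st (fun x xst => dvf x (inT x xst)) cst_.
by have := df0 c (inT c cst); rewrite in_itv/= in cst; nra.
Qed.

(** If [f t > c], take the last time [s] before [t] with [f s <= c]: the mean value theorem on
    [[s, t]] then meets only points above the level, where [f] does not increase. The sign condition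
    above [c] alone is what a quadratic damping term can supply. *)
Lemma barrier f df T c : continuous f ->
  (forall t, 0 < t < T -> is_derive t 1 f (df t)) ->
  f 0 <= c -> (forall t, 0 < t < T -> c < f t -> df t <= 0) ->
  forall t, 0 <= t <= T -> f t <= c.
Proof.
move=> cf dvf f0 dfc t /andP[t0 tT]; rewrite leNgt; apply/negP => cft.
pose S : set R := [set x | 0 <= x <= t /\ f x <= c].
have S0 : S 0 by split; [rewrite lexx|].
have hS : has_sup S.
  by split; [exists 0 | exists t => x [/andP[]]].
pose s := sup S.
have s0 : 0 <= s by apply: ub_le_sup => //; case: hS.
have st : s <= t by apply: ge_sup; [exists 0|move=> x [/andP[]]].
have fsc : f s <= c.
  rewrite leNgt; apply/negP => cfs.
  have : \forall x \near s, c < f x by exact: (cvgr_gt (f s) (cf s)).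
  case/nbhs_ballP => e /= e0 He.
  have [x Sx sx] := sup_adherent e0 hS.
  have : c < f x.
    apply: He; rewrite /ball/= ger0_norm ?subr_ge0; last by apply: ub_le_sup => //; case: hS.
    rewrite -/s; move: sx; rewrite -/s; lra.
  by case: Sx => _ /le_lt_trans /[apply]; rewrite ltxx.
have lt_st : s < t.
  by rewrite lt_neqAle st andbT; apply: contraTneq cft => <-; rewrite -leNgt.
have inT x : x \in `]s, t[ -> 0 < x < T.
  by rewrite in_itv/= => /andP[sx xt]; rewrite (le_lt_trans s0 sx) (lt_le_trans xt).
have cst_ : {within `[s, t], continuous f}.
  by apply: continuous_subspaceT => x; exact: cf.
have [x xst] := MVT lt_st (fun x xst => dvf x (inT x xst)) cst_.
have fx : c < f x.
  rewrite ltNge; apply/negP => fxc; move: (xst); rewrite in_itv/= => /andP[sx xt].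
  have : x <= s.
    apply: ub_le_sup; first by case: hS.
    by split=> //; rewrite (ltW xt) (le_trans s0 (ltW sx)).
  by rewrite leNgt sx.
by have := dfc x (inT x xst) fx; nra.
Qed.

(** The maximum norm is not differentiable, so the estimate runs through the sum of squares [E],
    which satisfies [E' <= k E + N eps^2]. The resulting factor [N * t] is absorbed by
    [N * T <= expR (N * T)]; the exponent [N (2 L + 2) T] is then halved by the square root, which
    explains [L + 1]. *)
Lemma gronwall n T L eps (u du : 'I_n -> R -> R) : 0 <= L -> 0 <= eps ->
  (forall i, continuous (u i)) ->
  (forall t, 0 < t < T -> forall i, is_derive t 1 (u i) (du i t)) ->
  (forall i, u i 0 = 0) ->
  (forall t, 0 < t < T -> forall m, (forall j, `|u j t| <= m) ->
     forall i, `|du i t| <= L * m + eps) ->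
  forall t, 0 <= t <= T -> forall i, `|u i t| <= eps * expR (n%:R * (L + 1) * T).
Proof.
move=> L0 e0 cu dvu u0 ule t /andP[t0 tT] i.
pose N : R := n%:R; have N0 : 0 <= N by rewrite ler0n.
pose E x := \sum_j u j x ^+ 2.
pose k := N * (2 * L + 1).
have E0 x : 0 <= E x by apply: sumr_ge0 => j _; exact: sqr_ge0.
have uE x j : `|u j x| ^+ 2 <= E x.
  rewrite real_normK ?num_real// /E (bigD1 j)//= lerDl.
  by apply: sumr_ge0 => ? _; exact: sqr_ge0.
have dvE x : 0 < x < T -> is_derive x 1 E (\sum_j (u j x * du j x + du j x * u j x)).
  by move=> xT; apply: dv_sum => j; apply: dvM; exact: dvu.
have cE : continuous E.
  move=> x; rewrite /E; apply: cvg_big => [|j _]; first exact: add_continuous.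
  by apply: cvgM; exact: cu.
have dE x : 0 < x < T ->
    \sum_j (u j x * du j x + du j x * u j x) <= k * E x + N * eps ^+ 2.
  move=> xT; have uS j : `|u j x| <= Num.sqrt (E x).
    by rewrite -(ler_pXn2r (ltn0Sn 1)) ?nnegrE ?sqrtr_ge0// sqr_sqrtr.
  have := ule x xT _ uS; set m := Num.sqrt (E x) => dule.
  (* In each coordinate the surplus over [2 m (L m + eps)] is the square [(m - eps)^2]: Young's
     inequality for [2 m eps]. *)
  have -> : k * E x + N * eps ^+ 2 =
      \sum_(j < n) (m * (L * m + eps) * 2 + (m ^+ 2 - 2 * m * eps + eps ^+ 2)).
    rewrite sumr_const card_ord -(mulr_natl _ n) -/N /k -[E x]sqr_sqrtr// -/m; ring.
  apply: ler_sum => j _; rewrite [du j x * _]mulrC -mulr2n -mulr_natr.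
  have H : u j x * du j x <= m * (L * m + eps).
    by rewrite (le_trans (ler_norm _))// normrM ler_pM.
  have : 0 <= (m - eps) ^+ 2 by exact: sqr_ge0.
  rewrite sqrrB -mulr_natr; nra.
pose G x := E x * expR (- k * x) - N * eps ^+ 2 * x.
have k0 : 0 <= k by rewrite mulr_ge0// addr_ge0// mulr_ge0.
have Gle : G t <= G 0.
  apply: (@dv_le0_le G (fun x => E x * (- k * expR (- k * x)) +
     (\sum_j (u j x * du j x + du j x * u j x)) * expR (- k * x) - N * eps ^+ 2 * 1)
     T _ _ _ 0 t) => //.
  - move=> x; apply: cvgB; last by apply: cvgM; [exact: cvg_cst | exact: cvg_id].
    apply: cvgM; first exact: cE.
    exact: (dv_continuous (dv_expMl (- k) x)).
  - move=> x xT.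
    exact: dvB (dvM (dvE x xT) (dv_expMl _ _)) (dvZ _ (is_derive_id x 1)).
  move=> x xT; have := dE x xT.
  have e1 : expR (- k * x) <= 1.
    rewrite -expR0 ler_expR mulNr oppr_le0 mulr_ge0//.
    by case/andP: xT => /ltW.
  have p := expR_gt0 (- k * x).
  set q := expR _ in e1 p *; set S := (\sum_j _) => dEx.
  have H : S * q <= (k * E x + N * eps ^+ 2) * q by rewrite ler_pM2r.
  have H2 : N * eps ^+ 2 * q <= N * eps ^+ 2.
    by rewrite -[leRHS]mulr1 ler_wpM2l// mulr_ge0// sqr_ge0.
  lra.
have G0 : G 0 = 0.
  rewrite /G !mulr0 subr0 (_ : E 0 = 0) ?mul0r//.
  by rewrite /E big1// => j _; rewrite u0 expr0n.
have Et : E t <= N * eps ^+ 2 * t * expR (k * t).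
  have : E t * expR (- k * t) <= N * eps ^+ 2 * t by move: Gle; rewrite G0 /G; lra.
  by rewrite mulNr expRN ler_pdivrMr ?expR_gt0.
rewrite -(ler_pXn2r (ltn0Sn 1)) ?nnegrE//; last by rewrite mulr_ge0// expR_ge0.
apply: (le_trans (uE t i)); apply: (le_trans Et).
have -> : (eps * expR (n%:R * (L + 1) * T)) ^+ 2 =
    eps ^+ 2 * (expR (N * T) * expR (k * T)).
  by rewrite exprMn -expRM_natr -expRD; congr (_ * expR _); rewrite /k /N; ring.
rewrite [X in X * expR _](_ : _ = eps ^+ 2 * (N * t)); last by ring.
rewrite -mulrA ler_wpM2l ?sqr_ge0// ler_pM ?expR_ge0 ?mulr_ge0//.
  rewrite (@le_trans _ _ (N * T)) ?ler_wpM2l//.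
  by have := expR_ge1Dx (N * T); lra.
by rewrite ler_expR ler_wpM2l.
Qed.

End Calculus.

(** * Global existence for Lipschitz systems by Picard iteration *)

Section Picard.
Context {R : realType}.
Implicit Types (f g df : R -> R) (s t a b : R).

Lemma dv_bound f g df dg (T : R) : continuous f -> continuous g ->
  (forall t, 0 < t < T -> is_derive t 1 f (df t)) ->
  (forall t, 0 < t < T -> is_derive t 1 g (dg t)) ->
  `|f 0| <= g 0 -> (forall t, 0 < t < T -> `|df t| <= dg t) ->
  forall t, 0 <= t <= T -> `|f t| <= g t.
Proof.
move=> cf cg dvf dvg; rewrite ler_norml => /andP[f0 f0'] dfg t /andP[t0 tT].
have H1 : f t - g t <= f 0 - g 0.
  apply: (@dv_le0_le _ (fun x => f x - g x) (fun x => df x - dg x) T) => //.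
  - by move=> x; apply: cvgB; [exact: cf | exact: cg].
  - by move=> x xT; exact: dvB (dvf x xT) (dvg x xT).
  - by move=> x /dfg; rewrite ler_norml; lra.
have H2 : - f t - g t <= - f 0 - g 0.
  apply: (@dv_le0_le _ (fun x => - f x - g x) (fun x => - df x - dg x) T) => //.
  - by move=> x; apply: cvgB; [apply: cvgN; exact: cf | exact: cg].
  - by move=> x xT; apply: dvB (dvg x xT); apply: is_deriveN; exact: dvf.
  - by move=> x /dfg; rewrite ler_norml; lra.
rewrite ler_norml; lra.
Qed.

Lemma geometric_small (C e : R) : 0 < e -> exists k, C * 2^-1 ^+ k <= e.
Proof.
move=> e0; exists (Num.bound (`|C| / e)).
have := archi_boundP (divr_ge0 (normr_ge0 C) (ltW e0)).
set k := Num.bound _ => Ck.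
have k2 : k%:R <= 2 ^+ k :> R by rewrite -natrX ler_nat ltnW// ltn_expl.
have p2 : 0 < 2 ^+ k :> R by rewrite exprn_gt0.
rewrite exprVn ler_pdivrMr// (le_trans (ler_norm _))//.
move: Ck; rewrite ltr_pdivrMr// => Ck; nra.
Qed.

(** The intervals of radius [2 * C * 2^-1 ^+ k] around [u k] are nested, so the supremum of their
    left ends lies in all of them. This yields an explicit limit together with its rate. *)
Lemma geometric_cauchy (u : nat -> R) (C : R) :
  (forall k, `|u k.+1 - u k| <= C * 2^-1 ^+ k) ->
  forall k, `|sup (range (fun k => u k - 2 * C * 2^-1 ^+ k)) - u k|
            <= 2 * C * 2^-1 ^+ k.
Proof.
move=> uC; set a := fun k => _; pose b k := u k + 2 * C * 2^-1 ^+ k.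
have uC' k : - (C * 2^-1 ^+ k) <= u k.+1 - u k <= C * 2^-1 ^+ k.
  by rewrite -ler_norml.
have q0 k : 0 <= C * 2^-1 ^+ k by rewrite (le_trans _ (uC k)).
have aS k : a k <= a k.+1.
  by rewrite /a exprS; have /andP[] := uC' k; have := q0 k; set x := _ ^+ k; lra.
have bS k : b k.+1 <= b k.
  by rewrite /b exprS; have /andP[] := uC' k; have := q0 k; set x := _ ^+ k; lra.
have aD j k : a k <= a (k + j)%N.
  elim: j => [|j IH]; first by rewrite addn0.
  by rewrite addnS (le_trans IH).
have bD j k : b (k + j)%N <= b k.
  elim: j => [|j IH]; first by rewrite addn0.
  by rewrite addnS (le_trans _ IH).
have ab j k : a j <= b k.
  apply: (le_trans (aD k j)); apply: le_trans (bD j k); rewrite addnC /a /b.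
  have := q0 (k + j)%N; lra.
move=> k; have ub : ubound (range a) (b k) by move=> _ [j _ <-].
have : a k <= sup (range a) by apply: ub_le_sup; [exists (b k)|exists k].
have : sup (range a) <= b k by apply: ge_sup => //; exists (a 0%N), 0%N.
by rewrite /a /b => h1 h2; rewrite ler_norml; apply/andP; split; lra.
Qed.

Lemma continuous_bounded n (f : 'I_n -> R -> R) (T : R) : 0 <= T ->
  (forall i, continuous (f i)) ->
  exists2 C, 0 <= C & forall i t, 0 <= t <= T -> `|f i t| <= C.
Proof.
move=> T0 cf.
have /choice[c cP] : forall i, exists c, forall t, 0 <= t <= T -> `|f i t| <= c.
  move=> i; have [] := @EVT_max R (fun t => `|f i t|) 0 T T0.
    apply: continuous_subspaceT => x; apply: cvg_norm; exact: cf.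
  move=> x _ xP; exists `|f i x| => t tT; apply: xP.
  by rewrite in_itv.
exists (\sum_i `|c i|); first by apply: sumr_ge0.
move=> i t tT; rewrite (le_trans (cP i t tT))// (le_trans (ler_norm _))//.
by rewrite (bigD1 i)//= lerDl sumr_ge0.
Qed.

Lemma primitive_exists : exists P : (R -> R) -> R -> R, (forall f, P f 0 = 0) /\
  forall f t, continuous f -> 0 <= t -> is_derive t 1 (P f) (f t).
Proof.
(* The base point [-1] makes [0] an interior point, so that the fundamental theorem gives a
   two-sided derivative there as well. *)
pose P f (x : R) := \int[lebesgue_measure]_(t in `[-1, x]) f t.
exists (fun f x => P f x - P f 0); split=> [f|f t cf t0]; first exact: subrr.
have [] := @continuous_FTC1_closed R f (-1) t (t + 1).
- lra.
- apply: continuous_compact_integrable; first exact: segment_compact.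
  by apply: continuous_subspaceT => x; exact: cf.
- lra.
- exact: cf.
move=> dF Fd; rewrite -[f t]subr0.
have dP : is_derive t 1 (P f) (f t).
  exact: (DeriveDef dF (etrans (esym (derive1E _ _)) Fd)).
exact: dvB dP (is_derive_cst _ _ _).
Qed.

(** Increments of the iterates are measured with the weight [expR (2 * L * t)] (Bielecki's norm).
    Integrating [L] times this weight returns half of it, so each step contracts by [1/2] on all of
    [[0, T]], whatever the size of [T]. *)
Lemma picard n (T L : R) (F : R -> ('I_n -> R) -> 'I_n -> R) (y0 : 'I_n -> R) :
  0 <= T -> 0 < L ->
  (forall y : 'I_n -> R -> R, (forall i, continuous (y i)) ->
     forall i, continuous (fun t => F t (y ^~ t) i)) ->
  (forall t u v d, (forall j, `|u j - v j| <= d) ->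
     forall i, `|F t u i - F t v i| <= L * d) ->
  exists y : 'I_n -> R -> R, (forall i, y i 0 = y0 i) /\
    forall t, 0 <= t <= T -> forall i, is_derive t 1 (y i) (F t (y ^~ t) i).
Proof.
move=> T0 L0 cF lF.
have [prim [prim0 dvprim]] := primitive_exists.
pose P (y : 'I_n -> R -> R) i := prim (fun t => F t (y ^~ t) i).
pose step y i t := y0 i + P y i (clamp 0 T t).
have P0 y i : P y i 0 = 0 by exact: prim0.
have dvP y i t : (forall i, continuous (y i)) -> 0 <= t ->
    is_derive t 1 (P y i) (F t (y ^~ t) i).
  by move=> cy t0; apply: (dvprim _ _ (cF y cy i)).
have cPc y i : (forall i, continuous (y i)) ->
    continuous (fun t => P y i (clamp 0 T t)).
  move=> cy; apply: continuous_clamp => // t /andP[t0 _].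
  exact: dv_continuous (dvP y i t cy t0).
have cstep y i : (forall i, continuous (y i)) -> continuous (step y i).
  by move=> cy t; apply: cvgD; [exact: cvg_cst | exact: cPc].
have step_clamp y i t : step y i (clamp 0 T t) = step y i t.
  by rewrite /step (clampK (clamp_itv t T0)).
have c00 : clamp 0 T 0 = 0 by rewrite clampK// lexx.
have step_bound y z i (g dg : R -> R) : (forall i, continuous (y i)) ->
    (forall i, continuous (z i)) -> continuous g ->
    (forall t, 0 < t < T -> is_derive t 1 g (dg t)) -> 0 <= g 0 ->
    (forall t, 0 < t < T -> `|F t (y ^~ t) i - F t (z ^~ t) i| <= dg t) ->
    forall t, 0 <= t <= T -> `|step y i t - step z i t| <= g t.
  move=> cy cz cg dvg g0 Fdg.
  have cyz : continuous (fun t => step y i t - step z i t).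
    by move=> t; apply: cvgB; exact: cstep.
  have dvS w t : (forall i, continuous (w i)) -> 0 < t < T ->
      is_derive t 1 (step w i) (F t (w ^~ t) i).
    move=> cw tT; have t0 : 0 <= t by case/andP: tT => /ltW.
    apply: (dv_clamp (f := fun t => y0 i + P w i t) tT).
    rewrite -[F _ _ _]add0r; exact: dvD (is_derive_cst _ _ _) (dvP w i t cw t0).
  have yz0 : `|step y i 0 - step z i 0| <= g 0.
    by rewrite /step c00 !P0 subrr normr0.
  exact: (dv_bound cyz cg (fun t tT => dvB (dvS y t cy tT) (dvS z t cz tT)) dvg
    yz0 Fdg).
pose Y k := iter k step (fun i _ => y0 i).
have cY k i : continuous (Y k i).
  elim: k i => [|k IH] i /=; last exact: cstep.
  by move=> t; exact: cvg_cst.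
have [C C0 YC] : exists2 C, 0 <= C &
    forall i t, 0 <= t <= T -> `|Y 1%N i t - Y 0%N i t| <= C.
  apply: continuous_bounded T0 _ => i t.
  by apply: cvgB; exact: cY.
have Yk k i t : 0 <= t <= T ->
    `|Y k.+1 i t - Y k i t| <= C * 2^-1 ^+ k * expR (2 * L * t).
  elim: k i t => [|k IH] i t tT.
    rewrite expr0 mulr1 (le_trans (YC i t tT))// ler_peMr// -expR0 ler_expR.
    by case/andP: tT => t0 _; rewrite !mulr_ge0// ltW.
  have cg : continuous (fun t => C * 2^-1 ^+ k.+1 * expR (2 * L * t)).
    move=> x; apply: cvgM; first exact: cvg_cst.
    exact: (dv_continuous (dv_expMl _ x)).
  have g0 : 0 <= C * 2^-1 ^+ k.+1 * expR (2 * L * 0).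
    by rewrite mulr_ge0 ?expR_ge0// mulr_ge0// exprn_ge0// invr_ge0.
  apply: (step_bound (Y k.+1) (Y k) i _ _ (cY _) (cY _) cg
    (fun x _ => dvZ _ (dv_expMl _ x)) g0 _ t tT).
  move=> x /andP[x0 xT]; have xT' : 0 <= x <= T by rewrite !ltW.
  apply: (le_trans (@lF x _ _ _ (fun j => IH j x xT') i)).
  by rewrite exprS le_eqVlt; apply/orP; left; apply/eqP; field.
pose C' := C * expR (2 * L * T).
have YkC k i t : `|Y k.+1 i t - Y k i t| <= C' * 2^-1 ^+ k.
  have -> : Y k.+1 i t = Y k.+1 i (clamp 0 T t) by rewrite /= step_clamp.
  have -> : Y k i t = Y k i (clamp 0 T t).
    by case: k => [//|k]; rewrite /= step_clamp.
  have tT := clamp_itv t T0.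
  apply: (le_trans (Yk k i _ tT)); rewrite /C' mulrAC.
  have p2 : 0 <= 2^-1 ^+ k :> R by rewrite exprn_ge0// invr_ge0.
  rewrite ler_wpM2r// ler_wpM2l// ler_expR ler_wpM2l//; first by rewrite mulr_ge0// ltW.
  by case/andP: tT.
pose y i t := sup (range (fun k => Y k i t - 2 * C' * 2^-1 ^+ k)).
have yY k i t : `|y i t - Y k i t| <= 2 * C' * 2^-1 ^+ k.
  exact: (@geometric_cauchy (fun k => Y k i t)).
have cy i : continuous (y i).
  move=> t; apply/cvgrPdist_le => e e0.
  have [k ke] : exists k, 2 * C' * 2^-1 ^+ k <= e / 3.
    by apply: geometric_small; rewrite divr_gt0.
  have e3 : 0 < e / 3 by rewrite divr_gt0.
  have /cvgrPdist_le/(_ _ e3) := cY k i t.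
  apply: filterS => x Yx.
  have := yY k i t; have := yY k i x; rewrite (distrC (y i x)) => h1 h2.
  have -> : y i t - y i x = (y i t - Y k i t) + (Y k i t - Y k i x) + (Y k i x - y i x).
    by ring.
  apply: (le_trans (ler_normD _ _)); apply: (le_trans (lerD (ler_normD _ _) (lexx _))).
  lra.
(* Both [y] and [step y] are within order [2^-k] of the iterate [Y k.+1], for every [k]. *)
have yE i t : 0 <= t <= T -> y i t = step y i t.
  move=> tT; apply/eqP; rewrite -subr_eq0 -normr_le0; apply/ler_addgt0Pl => e e0.
  rewrite addr0.
  have [k ke] := geometric_small (2 * C' * (L * T + 1)) e0.
  have q0 : 0 <= 2 * C' * 2^-1 ^+ k by rewrite (le_trans _ (yY k i t)).
  have H1 : `|step y i t - Y k.+1 i t| <= L * (2 * C' * 2^-1 ^+ k) * t.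
    have cg : continuous (fun t => L * (2 * C' * 2^-1 ^+ k) * t).
      by move=> x; apply: cvgM; [exact: cvg_cst|exact: cvg_id].
    have g0 : 0 <= L * (2 * C' * 2^-1 ^+ k) * 0 by rewrite mulr0.
    apply: (step_bound y (Y k) i _ _ cy (cY _) cg
      (fun x _ => dvZ _ (is_derive_id x 1)) g0 _ t tT).
    by move=> x _; rewrite mulr1; apply: lF => j; exact: yY.
  have H2 := yY k.+1 i t.
  have -> : y i t - step y i t = (y i t - Y k.+1 i t) - (step y i t - Y k.+1 i t).
    by ring.
  rewrite (le_trans (ler_normB _ _))//.
  case/andP: tT => t0 tT; move: H1 H2 ke q0; rewrite exprS; set q := _ ^+ k.
  have : L * (2 * C' * q) * t <= L * (2 * C' * q) * T.
    rewrite ler_wpM2l// mulr_ge0 ?(ltW L0)// mulr_ge0//.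
      by rewrite mulr_ge0// /C' mulr_ge0// expR_ge0.
    by rewrite exprn_ge0// invr_ge0.
  lra.
(* The limit [y] is frozen outside [[0, T]]. Its unclamped integral agrees with it on the segment
   and has two-sided derivatives at the end points too. *)
exists (fun i t => y0 i + P y i t); split=> [i|t tT i]; first by rewrite P0 addr0.
have -> : (fun i => y0 i + P y i t) = y ^~ t.
  by apply/funext => j; rewrite yE// /step clampK.
case/andP: tT => t0 _.
by rewrite -[F _ _ _]add0r; exact: dvD (is_derive_cst _ _ _) (dvP y i t cy t0).
Qed.

End Picard.

(** * Entrywise derivatives relative to a segment, and time reversal *)

Section MatrixDerivative.
Context {R : realType}.
Implicit Types (f df : R -> R) (t T : R).

Lemma cvg_mx_coord (X : Type) (F : set_system X) (FF : Filter F) m n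
    (f : X -> 'M[R]_(m, n)) (M : 'M[R]_(m, n)) :
  f x @[x --> F] --> M <-> forall i j, f x i j @[x --> F] --> M i j.
Proof.
split=> [fM i j|fM].
  apply: (@cvg_comp _ _ _ f (fun N : 'M[R]_(m, n) => N i j)); first exact: fM.
  exact: coord_continuous.
apply/cvg_mx_entourageP => A entA.
have {}fM : forall i j, \forall x \near F, (M i j, f x i j) \in A.
  move=> i j; have /cvg_app_entourageP/(_ A entA) := fM i j.
  by apply: filterS => x; rewrite /= inE.
apply: filter_forall => i; apply: filter_forall => j; exact: fM.
Qed.

Definition dv_within (D : set R) f df := forall t, D t ->
  (u - t)^-1 * (f u - f t) @[u --> within D t^'] --> df t.

Lemma dv_within_coord (D : set R) (th dth : R -> 'M[R]_2) :
  has_derivative_on D th dth <->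
  forall i j, dv_within D (fun t => th t i j) (fun t => dth t i j).
Proof.
split=> H => [i j t Dt|t Dt].
  have /cvg_mx_coord/(_ i j) := H t Dt.
  by apply: cvg_trans; apply: near_eq_cvg; near=> u; rewrite !mxE.
apply/cvg_mx_coord => i j; have := H i j t Dt.
by apply: cvg_trans; apply: near_eq_cvg; near=> u; rewrite !mxE.
Unshelve. all: by end_near. Qed.

Lemma dv_quotient f t a :
  is_derive t 1 f a <-> (u - t)^-1 * (f u - f t) @[u --> t^'] --> a.
Proof.
have E : (h^-1 *: ((f \o shift t) (h *: 1) - f t) @[h --> 0^'] --> a) <->
         (u - t)^-1 * (f u - f t) @[u --> t^'] --> a.
  split=> /cvgrPdist_le H; apply/cvgrPdist_le => e e0;
    have := H e e0; rewrite !near_withinE; move/nbhs_ballP => [d /= d0 dP];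
    apply/nbhs_ballP; exists d => //= u; rewrite /ball/= => tu ut.
    have := dP (u - t); rewrite /ball/= sub0r normrN distrC => /(_ tu).
    by rewrite subr_eq0 => /(_ ut); rewrite /= /shift/= [_%:A]mulr1 subrK.
  have := dP (u + t); rewrite /ball/= (_ : t - (u + t) = 0 - u); last by ring.
  move=> /(_ tu); rewrite -subr_eq0 addrK => /(_ ut).
  by rewrite /= /shift/= [_%:A]mulr1.
rewrite -E; split=> [[df <-]|fa]; first exact: df.
by apply: DeriveDef; [apply/cvg_ex; exists a | exact: cvg_lim].
Qed.

Lemma dv_within_interior f df T t : dv_within `[0, T] f df -> 0 < t < T ->
  is_derive t 1 f (df t).
Proof.
move=> fd tT; apply/dv_quotient; have D : `[0, T]%classic t.
  by case/andP: tT => t0 tT; rewrite /= in_itv/= !ltW.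
apply/cvgrPdist_le => e e0; have /cvgrPdist_le/(_ e e0) := fd t D.
rewrite !near_withinE => H.
have /near_in_itvoo H2 : t \in `]0, T[ by rewrite in_itv.
near=> u => ut.
have uT : u \in `]0, T[ by near: u; exact: H2.
have : `[0, T]%classic u by move: uT; rewrite /= !in_itv/= => /andP[? ?]; rewrite !ltW.
by move: ut; near: u.
Unshelve. all: by end_near. Qed.

Lemma dv_dv_within (D : set R) f df :
  (forall t, D t -> is_derive t 1 f (df t)) -> dv_within D f df.
Proof.
move=> fd t /fd/dv_quotient; apply: cvg_trans.
apply: cvg_app; exact: cvg_within.
Qed.

(** A difference quotient that converges along the segment is bounded near [p] by [k], that is
    [|df p| + 1], so [f] is Lipschitz at [p] along the segment. The clamp is [1]-Lipschitz into the
    segment, which turns this into ordinary continuity, end points included. *)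
Lemma dv_within_continuous f df tau T : 0 <= T <= tau ->
  dv_within `[0, tau] f df -> continuous (fun t => f (clamp 0 T t)).
Proof.
move=> /andP[T0 Ttau] fd t; apply/cvgrPdist_le => e e0.
set p := clamp 0 T t; have /andP[p0 pT] := clamp_itv t T0.
have D : `[0, tau]%classic p by rewrite /= in_itv/= p0 (le_trans pT).
have /cvgrPdist_le/(_ 1 ltr01) := fd p D.
rewrite !near_withinE => /nbhs_ballP[d /= d0 dP].
pose k := `|df p| + 1; have k0 : 0 < k by rewrite ltr_pwDr.
apply/nbhs_ballP; exists (Num.min d (e / k)) => /=.
  by rewrite lt_min d0 divr_gt0.
move=> x; rewrite /ball/= lt_min => /andP[xd xe].
set u := clamp 0 T x; have /andP[u0 uT] := clamp_itv x T0.
have up : `|p - u| <= `|t - x| by exact: clamp_lip.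
have [->|nup] := eqVneq u p; first by rewrite subrr normr0 ltW.
have := dP u; rewrite /ball/= => /(_ (le_lt_trans up xd) nup).
rewrite in_itv/= u0 (le_trans uT)// => /(_ isT) H.
have upn : u - p != 0 by rewrite subr_eq0.
have -> : f p - f u = - ((u - p)^-1 * (f u - f p)) * (u - p) by field.
rewrite normrM normrN (distrC u).
have : `|(u - p)^-1 * (f u - f p)| <= k.
  have -> : (u - p)^-1 * (f u - f p) = df p - (df p - (u - p)^-1 * (f u - f p)) by ring.
  by rewrite (le_trans (ler_normB _ _))// lerD.
move=> H2; rewrite (le_trans (ler_pM (normr_ge0 _) (normr_ge0 _) H2 up))//.
by rewrite mulrC -ler_pdivlMr// ltW.
Qed.

Lemma dv_rev f t T a : is_derive (T - t) 1 f a ->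
  is_derive t 1 (fun s => f (T - s)) (- a).
Proof.
move=> fd; rewrite -mulrN1.
have h : is_derive t 1 (fun s => T - s) (-1).
  by rewrite -[-1]sub0r; exact: dvB (is_derive_cst _ _ _) (is_derive_id _ _).
exact: (@is_derive1_comp _ f (fun s => T - s)).
Qed.

Lemma dv_within_rev_continuous f df tau T : 0 <= T <= tau ->
  dv_within `[0, tau] f df -> continuous (fun t => f (T - clamp 0 T t)).
Proof.
move=> Ttau fd t; have /andP[T0 _] := Ttau.
have -> : (fun t => f (T - clamp 0 T t)) = (fun t => f (clamp 0 T (T - clamp 0 T t))).
  apply/funext => s; rewrite [clamp 0 T (T - _)]clampK//.
  by have /andP[? ?] := clamp_itv s T0; apply/andP; split; lra.
apply: (@continuous_comp _ _ _ (fun t => T - clamp 0 T t) (fun s => f (clamp 0 T s))).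
  by apply: cvgB; [exact: cvg_cst | exact: clamp_continuous].
exact: (dv_within_continuous Ttau fd).
Qed.

(** The right end [tau] of the domain is kept apart from the terminal time [T]: it is the horizon
    for the game matrices, and [T] itself for the unknown of the last equation. *)
Lemma dv_within_rev f df tau T t : T <= tau -> dv_within `[0, tau] f df -> 0 < t < T ->
  is_derive t 1 (fun t => f (T - clamp 0 T t)) (- df (T - clamp 0 T t)).
Proof.
move=> Ttau fd tT; apply: (dv_clamp (f := fun t => f (T - t)) tT).
rewrite clampK; last by case/andP: tT => ? ?; rewrite !ltW.
have tT' : 0 < T - t < tau.
  by move: Ttau; case/andP: tT => ? ? ?; apply/andP; split; lra.
exact: dv_rev (dv_within_interior fd tT').
Qed.

End MatrixDerivative.

(** * Quadratic systems: dependence on the force and differentiability in a parameter *)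

Section QuadraticODE.
Context {R : realType} (n : nat).
Local Notation state := ('I_n -> R).
Implicit Types (u v : state) (T M Lam : R).

(** Two levels [d] and [e] replace the maximum norms of the arguments. Continuity is stated along
    paths, the form in which [picard] asks for it. *)
Record bounded_bilinear (b : state -> state -> state) (Lam : R) : Prop :=
  BoundedBilinear {
    bb_Dl : forall u u' v i, b (fun j => u j + u' j) v i = b u v i + b u' v i;
    bb_Dr : forall u v v' i, b u (fun j => v j + v' j) i = b u v i + b u v' i;
    bb_Zl : forall c u v i, b (fun j => c * u j) v i = c * b u v i;
    bb_Zr : forall c u v i, b u (fun j => c * v j) i = c * b u v i;
    bb_continuous : forall y z : 'I_n -> R -> R,
      (forall i, continuous (y i)) -> (forall i, continuous (z i)) ->
      forall i, continuous (fun t => b (y ^~ t) (z ^~ t) i);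
    bb_ge0 : 0 <= Lam;
    bb_bound : forall u v d e, (forall j, `|u j| <= d) -> (forall j, `|v j| <= e) ->
      forall i, `|b u v i| <= Lam * (d * e) }.

Definition quad_solution b T (c : state) (z : 'I_n -> R -> R) : Prop :=
  [/\ forall i, continuous (z i), forall i, z i 0 = 0 &
      forall t, 0 < t < T -> forall i,
        is_derive t 1 (z i) (c i + b (z ^~ t) (z ^~ t) i)].

Variables (b : state -> state -> state) (Lam : R) (bb : bounded_bilinear b Lam).

(** The Gronwall factor: on vectors bounded by [M] the quadratic part has Lipschitz constant
    [2 * Lam * M]. *)
Definition growth M T : R := expR (n%:R * (2 * Lam * M + 1) * T).

Lemma bb_Bl u u' v i : b (fun j => u j - u' j) v i = b u v i - b u' v i.
Proof.
have -> : (fun j => u j - u' j) = (fun j => u j + (-1) * u' j).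
  by apply/funext => j; rewrite mulN1r.
by rewrite (bb_Dl bb) (bb_Zl bb) mulN1r.
Qed.

Lemma bb_Br u v v' i : b u (fun j => v j - v' j) i = b u v i - b u v' i.
Proof.
have -> : (fun j => v j - v' j) = (fun j => v j + (-1) * v' j).
  by apply/funext => j; rewrite mulN1r.
by rewrite (bb_Dr bb) (bb_Zr bb) mulN1r.
Qed.

(** The difference of the quadratic terms is [b (z - z') z + b z' (z - z')], linear in [z - z'] with
    bounded coefficients. *)
Lemma quad_lip T M eps c c' z z' : 0 <= M -> 0 <= eps ->
  quad_solution b T c z -> quad_solution b T c' z' ->
  (forall i, `|c i - c' i| <= eps) ->
  (forall i t, 0 <= t <= T -> `|z i t| <= M) ->
  (forall i t, 0 <= t <= T -> `|z' i t| <= M) ->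
  forall t, 0 <= t <= T -> forall i, `|z i t - z' i t| <= eps * growth M T.
Proof.
move=> M0 e0 [cz z0 dz] [cz' z'0 dz'] cc' zM z'M.
have L0 := bb_ge0 bb.
apply: (@gronwall R n T (2 * Lam * M) eps (fun i t => z i t - z' i t)
  (fun i t => c i + b (z ^~ t) (z ^~ t) i - (c' i + b (z' ^~ t) (z' ^~ t) i))).
- by rewrite !mulr_ge0.
- exact: e0.
- by move=> i t; apply: cvgB; [exact: cz | exact: cz'].
- by move=> t tT i; exact: dvB (dz t tT i) (dz' t tT i).
- by move=> i; rewrite z0 z'0 subrr.
move=> t tT m zm i; have tT' : 0 <= t <= T by case/andP: tT => ? ?; rewrite !ltW.
have -> : c i + b (z ^~ t) (z ^~ t) i - (c' i + b (z' ^~ t) (z' ^~ t) i) =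
    b (fun j => z j t - z' j t) (z ^~ t) i + b (z' ^~ t) (fun j => z j t - z' j t) i
    + (c i - c' i).
  by rewrite bb_Bl bb_Br; ring.
have h1 := bb_bound bb zm (fun j => zM j t tT') i.
have h2 := bb_bound bb (fun j => z'M j t tT') zm i.
apply: (le_trans (ler_normD _ _)); apply: (le_trans (lerD (ler_normD _ _) (cc' i))).
move: h1 h2; lra.
Qed.

(** The variational equation along [z]. Being linear, it is globally Lipschitz as soon as [z] is
    frozen outside [[0, T]], where only the bound [M] is known. *)
Lemma linearized_solution T M c1 C1 (z : 'I_n -> R -> R) : 0 <= T -> 0 <= M -> 0 <= C1 ->
  (forall i, continuous (z i)) -> (forall i t, 0 <= t <= T -> `|z i t| <= M) ->
  (forall i, `|c1 i| <= C1) ->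
  exists d : 'I_n -> R -> R,
  [/\ forall i, continuous (d i), forall i, d i 0 = 0,
      forall t, 0 < t < T -> forall i,
        is_derive t 1 (d i) (c1 i + (b (d ^~ t) (z ^~ t) i + b (z ^~ t) (d ^~ t) i)) &
      forall t, 0 <= t <= T -> forall i, `|d i t| <= C1 * growth M T].
Proof.
move=> T0 M0 C10 cz zM c1C; have L0 := bb_ge0 bb.
pose zc i t := z i (clamp 0 T t).
have czc i : continuous (zc i).
  by apply: continuous_clamp => // t _; exact: cz.
have zcM i t : `|zc i t| <= M by apply: zM; exact: clamp_itv.
pose F t (u : state) i := c1 i + (b u (zc ^~ t) i + b (zc ^~ t) u i).
have [] := @picard R n T (2 * Lam * M + 1) F (fun=> 0) T0.
- by rewrite ltr_wpDl// !mulr_ge0.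
- move=> y cy i t; apply: cvgD; first exact: cvg_cst.
  by apply: cvgD; apply: (bb_continuous bb).
- move=> t u v d uvd i; rewrite /F.
  rewrite (_ : _ - _ = b (fun j => u j - v j) (zc ^~ t) i
     + b (zc ^~ t) (fun j => u j - v j) i); last by rewrite bb_Bl bb_Br; ring.
  have h1 := bb_bound bb uvd (zcM ^~ t) i.
  have h2 := bb_bound bb (zcM ^~ t) uvd i.
  have d0 : 0 <= d by exact: le_trans (uvd i).
  by apply: (le_trans (ler_normD _ _)); move: h1 h2; lra.
move=> y [y0 dvy].
have c00 : clamp 0 T 0 = 0 by rewrite clampK// lexx.
have cd i : continuous (fun t => y i (clamp 0 T t)).
  by apply: continuous_clamp => // t tT; exact: dv_continuous (dvy t tT i).
have dvd t : 0 < t < T -> forall i, is_derive t 1 (fun t => y i (clamp 0 T t))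
    (c1 i + (b (fun j => y j (clamp 0 T t)) (z ^~ t) i +
             b (z ^~ t) (fun j => y j (clamp 0 T t)) i)).
  move=> tT i; have tT' : 0 <= t <= T by case/andP: tT => ? ?; rewrite !ltW.
  apply: (dv_clamp (f := y i) tT); rewrite (clampK tT').
  by have := dvy t tT' i; rewrite /F /zc (clampK tT').
exists (fun i t => y i (clamp 0 T t)); split=> //.
- by move=> i; rewrite c00 y0.
apply: (@gronwall R n T (2 * Lam * M) C1 _ _ _ C10 cd dvd).
- by rewrite !mulr_ge0.
- by move=> i; rewrite c00 y0.
move=> t tT m ym i; have tT' : 0 <= t <= T by case/andP: tT => ? ?; rewrite !ltW.
have h1 := bb_bound bb ym (fun j => zM j t tT') i.
have h2 := bb_bound bb (fun j => zM j t tT') ym i.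
apply: (le_trans (ler_normD _ _)).
apply: (le_trans (lerD (c1C i) (ler_normD _ _))).
move: h1 h2; lra.
Qed.

(* The remainder in the bilinear expansion is quadratic in the increment, so
   the difference quotients converge at rate [O(h)]. *)
Lemma quad_param_derivative T M C C1 c1 (c : R -> state) (z : R -> 'I_n -> R -> R) :
  0 <= T -> 0 <= M -> 0 <= C -> 0 <= C1 ->
  (forall h, `|h| <= 1 -> quad_solution b T (c h) (z h)) ->
  (forall h i t, `|h| <= 1 -> 0 <= t <= T -> `|z h i t| <= M) ->
  (forall i, `|c1 i| <= C1) ->
  (forall h i, `|h| <= 1 -> `|c h i - c 0 i - h * c1 i| <= C * h ^+ 2) ->
  exists d : 'I_n -> R -> R,
  [/\ forall i, continuous (d i),
      forall t, 0 <= t <= T -> forall i, `|d i t| <= C1 * growth M T &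
      exists K, forall h t i, `|h| <= 1 -> h != 0 -> 0 <= t <= T ->
        `|(z h i t - z 0 i t) / h - d i t| <= K * `|h|].
Proof.
move=> T0 M0 C0 C10 sz zM c1C cC; have L0 := bb_ge0 bb.
have h00 : `|0 : R| <= 1 by rewrite normr0.
have [cz z00 dz] := sz 0 h00.
have [d [cd d0 dvd dC]] := linearized_solution T0 M0 C10 cz (fun i t => zM 0 i t h00) c1C.
exists d; split=> //.
pose G := (C1 + C) * growth M T.
exists ((C + Lam * (G * G)) * expR (n%:R * (2 * Lam * M + 1) * T)).
move=> h t0 i0 h1 hn0; move: t0 i0; have [ch zh0 dh] := sz h h1.
have h0 : 0 < `|h| by rewrite normr_gt0.
have zG t i : 0 <= t <= T -> `|z h i t - z 0 i t| <= G * `|h|.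
  move=> tT; have -> : G * `|h| = ((C1 + C) * `|h|) * growth M T by rewrite /G mulrAC.
  apply: (quad_lip M0 _ (sz h h1) (sz 0 h00) _ (fun i t => zM h i t h1)
    (fun i t => zM 0 i t h00) tT) => [|j]; first by rewrite mulr_ge0// addr_ge0.
  rewrite -[c h j - _](subrK (h * c1 j)) (le_trans (ler_normD _ _))//.
  rewrite mulrDl addrC lerD//; first by rewrite normrM mulrC ler_wpM2r.
  apply: (le_trans (cC h j h1)); rewrite -real_normK ?num_real// ler_wpM2l//.
  by rewrite expr2 ler_piMl.
suff H : forall t, 0 <= t <= T -> forall i, `|(z h i t - z 0 i t) / h - d i t| <=
    (C + Lam * (G * G)) * `|h| * expR (n%:R * (2 * Lam * M + 1) * T).
  by move=> t i tT; rewrite mulrAC; exact: H.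
apply: (@gronwall R n T (2 * Lam * M) _ _ (fun i t =>
  ((c h i + b (z h ^~ t) (z h ^~ t) i) - (c 0 i + b (z 0 ^~ t) (z 0 ^~ t) i)) / h
  - (c1 i + (b (d ^~ t) (z 0 ^~ t) i + b (z 0 ^~ t) (d ^~ t) i)))).
- by rewrite !mulr_ge0.
- by rewrite mulr_ge0// addr_ge0// mulr_ge0// -expr2 sqr_ge0.
- move=> i t; apply: cvgB; last exact: cd.
  by apply: cvgM; [apply: cvgB; [exact: ch | exact: cz] | exact: cvg_cst].
- move=> t tT i; have dq := dvB (dh t tT i) (dz t tT i).
  have dq' := dvZ h^-1 dq.
  have := dvB dq' (dvd t tT i).
  rewrite [h^-1 * (_ - _)]mulrC; congr (is_derive _ _ _ _).
  by apply/funext => s; rewrite mulrC.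
- by move=> i; rewrite z00 zh0 d0 subrr mul0r subrr.
move=> t tT m ym i; have tT' : 0 <= t <= T by case/andP: tT => ? ?; rewrite !ltW.
have [dz' dzE] : exists dz' : state, forall j, z h j t - z 0 j t = dz' j.
  by exists (fun j => z h j t - z 0 j t).
pose w j := h^-1 * dz' j - d j t.
have wm j : `|w j| <= m by rewrite /w mulrC -dzE; exact: ym.
have zE : z h ^~ t = (fun j => z 0 j t + dz' j).
  by apply/funext => j; rewrite -dzE addrC subrK.
(* With [z h = z 0 + dz'], the error [w] of the difference quotient solves the linearised equation
   up to two defects: the second-order error of the force divided by [h], and [b dz' dz' / h]. Both
   are of order [h], the latter because [dz'] is at most [G * |h|]. *)
have -> : (c h i + b (z h ^~ t) (z h ^~ t) i - (c 0 i + b (z 0 ^~ t) (z 0 ^~ t) i)) / h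
  - (c1 i + (b (d ^~ t) (z 0 ^~ t) i + b (z 0 ^~ t) (d ^~ t) i)) =
  (b w (z 0 ^~ t) i + b (z 0 ^~ t) w i) +
  ((c h i - c 0 i - h * c1 i) / h + b dz' dz' i / h).
  rewrite /w bb_Bl bb_Br (bb_Zl bb) (bb_Zr bb) zE !(bb_Dl bb) !(bb_Dr bb).
  by field.
have h2 := bb_bound bb wm (fun j => zM 0 j t h00 tT') i.
have h3 := bb_bound bb (fun j => zM 0 j t h00 tT') wm i.
have zG' j : `|dz' j| <= G * `|h| by rewrite -dzE; exact: zG.
have h4 := bb_bound bb zG' zG' i.
apply: (le_trans (ler_normD _ _)); apply: lerD.
  by apply: (le_trans (ler_normD _ _)); move: h2 h3; lra.
rewrite [leRHS]mulrDl (le_trans (ler_normD _ _))// !normrM normfV.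
apply: lerD; rewrite ler_pdivrMr//.
  by rewrite -mulrA -expr2 real_normK ?num_real//; exact: cC.
by apply: (le_trans h4); rewrite le_eqVlt; apply/orP; left; apply/eqP; ring.
Qed.

End QuadraticODE.

(** * Positive semidefiniteness from a Lyapunov equation *)

Section Lyapunov.
Context {R : realType}.

(* Along the closed-loop flow [xi' = a xi] the form [xi^T th xi] has derivative
   [xi^T m xi]; integrate from [0], where it vanishes, to [t0]. *)
Lemma lyapunov_psd (T : R) (x y w a11 a12 a21 a22 m11 m12 m22 : R -> R) :
  [/\ continuous x, continuous y & continuous w] ->
  [/\ x 0 = 0, y 0 = 0 & w 0 = 0] ->
  [/\ continuous a11, continuous a12, continuous a21 & continuous a22] ->
  (forall t, 0 < t < T -> [/\
    is_derive t 1 x (m11 t - 2 * (x t * a11 t + y t * a21 t)),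
    is_derive t 1 y (m12 t - (x t * a12 t + y t * a22 t)
                           - (a11 t * y t + a21 t * w t)) &
    is_derive t 1 w (m22 t - 2 * (y t * a12 t + w t * a22 t))]) ->
  (forall t e1 e2, 0 < t < T ->
    0 <= m11 t * e1 ^+ 2 + 2 * m12 t * e1 * e2 + m22 t * e2 ^+ 2) ->
  forall t e1 e2, 0 <= t <= T ->
    0 <= x t * e1 ^+ 2 + 2 * y t * e1 * e2 + w t * e2 ^+ 2.
Proof.
move=> [cx cy cw] [x0 y0 w0] [ca11 ca12 ca21 ca22] dv mpos t0 e1 e2 /andP[t00 t0T].
have crev (f : R -> R) : continuous f -> continuous (fun s => f (t0 - s)).
  move=> cf s; apply: (@continuous_comp _ _ _ (fun s => t0 - s) f); last exact: cf.
  by apply: cvgB; [exact: cvg_cst | exact: cvg_id].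
pose al (f : R -> R) s := f (t0 - clamp 0 t0 s).
have cal f : continuous f -> continuous (al f).
  move=> cf.
  exact: (continuous_clamp (f := fun s => f (t0 - s)) t00 (fun s _ => crev f cf s)).
pose aa (i : 'I_4) : R -> R := nth a22 [:: a11; a12; a21] i.
have caa i : continuous (aa i).
  by case: i => [[|[|[|[|//]]]] ?].
have [C C0 aC] : exists2 C, 0 <= C & forall i t, 0 <= t <= t0 -> `|aa i t| <= C.
  exact: continuous_bounded.
have alC i s : `|al (aa i) s| <= C.
  by apply: aC; have /andP[? ?] := clamp_itv s t00; apply/andP; split; lra.
pose o0 : 'I_2 := ord0; pose o1 : 'I_2 := ord_max.
(* The flow is run backwards from [t0], hence the minus signs: it can then start at the prescribed
   vector [(e1, e2)], and the form along it decreases to its value [0] at the original time [0]. *)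
pose F s (u : 'I_2 -> R) (i : 'I_2) :=
  if i == o0 then - (al a11 s * u o0 + al a12 s * u o1)
  else - (al a21 s * u o0 + al a22 s * u o1).
have [] := @picard R 2 t0 (2 * C + 1) F (fun i => if i == o0 then e1 else e2) t00.
- by rewrite ltr_wpDl// mulr_ge0.
- move=> xi cxi i; rewrite /F; case: (i == o0) => s;
  by apply: cvgN; apply: cvgD; apply: cvgM; try exact: cxi; exact: cal.
- move=> s u v d uvd i.
  have d0 : 0 <= d by exact: le_trans (uvd o0).
  have H (k l : 'I_4) : `|- (al (aa k) s * u o0 + al (aa l) s * u o1) -
      - (al (aa k) s * v o0 + al (aa l) s * v o1)| <= (2 * C + 1) * d.
    rewrite (_ : _ - _ = - (al (aa k) s * (u o0 - v o0)
        + al (aa l) s * (u o1 - v o1))); last by ring.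
    rewrite normrN (le_trans (ler_normD _ _))// !normrM.
    have := ler_pM (normr_ge0 _) (normr_ge0 _) (alC k s) (uvd o0).
    have := ler_pM (normr_ge0 _) (normr_ge0 _) (alC l s) (uvd o1).
    lra.
  rewrite /F; case: (i == o0).
    exact: (H (@Ordinal 4 0 isT) (@Ordinal 4 1 isT)).
  exact: (H (@Ordinal 4 2 isT) (@Ordinal 4 3 isT)).
move=> xi [xi0 dxi].
pose p s := xi o0 (clamp 0 t0 s); pose q s := xi o1 (clamp 0 t0 s).
have cp : continuous p.
  by apply: continuous_clamp => // s sT; exact: dv_continuous (dxi s sT o0).
have cq : continuous q.
  by apply: continuous_clamp => // s sT; exact: dv_continuous (dxi s sT o1).
have dp s : 0 < s < t0 -> is_derive s 1 p (- (a11 (t0 - s) * p s + a12 (t0 - s) * q s)).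
  move=> sT; have sT' : 0 <= s <= t0 by case/andP: sT => ? ?; rewrite !ltW.
  apply: (dv_clamp (f := xi o0) sT); rewrite /p /q (clampK sT').
  by have := dxi s sT' o0; rewrite /F eqxx /al (clampK sT').
have dq s : 0 < s < t0 -> is_derive s 1 q (- (a21 (t0 - s) * p s + a22 (t0 - s) * q s)).
  move=> sT; have sT' : 0 <= s <= t0 by case/andP: sT => ? ?; rewrite !ltW.
  apply: (dv_clamp (f := xi o1) sT); rewrite /p /q (clampK sT').
  by have := dxi s sT' o1; rewrite /F /al (clampK sT').
pose f s := x (t0 - s) * (p s * p s) + 2 * (y (t0 - s) * (p s * q s))
  + w (t0 - s) * (q s * q s).
have cf : continuous f.
  move=> s; rewrite /f; apply: cvgD; [apply: cvgD|].
  - apply: cvgM; [exact: crev | apply: cvgM; exact: cp].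
  - apply: cvgM; [exact: cvg_cst | apply: cvgM; first exact: crev].
    by apply: cvgM; [exact: cp | exact: cq].
  - apply: cvgM; [exact: crev | apply: cvgM; exact: cq].
have df s : 0 < s < t0 -> is_derive s 1 f (- (m11 (t0 - s) * p s ^+ 2
    + 2 * m12 (t0 - s) * p s * q s + m22 (t0 - s) * q s ^+ 2)).
  move=> sT; have sT' : 0 < t0 - s < T by case/andP: sT => ? ?; apply/andP; split; lra.
  have [/dv_rev dx /dv_rev dy /dv_rev dw] := dv _ sT'.
  have dps := dp s sT; have dqs := dq s sT.
  have D1 := dvM dx (dvM dps dps).
  have D2 := dvZ 2 (dvM dy (dvM dps dqs)).
  have D3 := dvM dw (dvM dqs dqs).
  apply: is_derive_eq (dvD (dvD D1 D2) D3) _; ring.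
have : f t0 <= f 0.
  apply: (dv_le0_le cf df _ (lexx 0) t00 (lexx t0)) => s sT.
  by rewrite oppr_le0; apply: mpos; case/andP: sT => ? ?; apply/andP; split; lra.
have p0 : p 0 = e1 by rewrite /p clampK ?lexx// xi0 eqxx.
have q0 : q 0 = e2 by rewrite /q clampK ?lexx// xi0.
rewrite /f subrr x0 y0 w0 subr0 p0 q0.
by rewrite !mul0r mulr0 !add0r !expr2 !mulrA.
Qed.

Lemma psd_entries (x y w : R) :
  (forall e1 e2, 0 <= x * e1 ^+ 2 + 2 * y * e1 * e2 + w * e2 ^+ 2) ->
  [/\ 0 <= x, 0 <= w & y ^+ 2 <= x * w].
Proof.
move=> H.
have x0 : 0 <= x by have := H 1 0; lra.
have w0 : 0 <= w by have := H 0 1; lra.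
split=> //; have [x1|x1] := ltP 0 x.
  have : 0 <= x * (x * w - y ^+ 2) by have := H y (- x); lra.
  by rewrite pmulr_rge0// subr_ge0.
have -> : x = 0 by apply: le_anti; rewrite x1 x0.
(* For [x = 0] this test vector gives [- (w + 2) * y ^+ 2 >= 0], which forces [y] to vanish. *)
have := H (- (w + 1)) y.
have -> : x = 0 by apply: le_anti; rewrite x1 x0.
have := sqr_ge0 y; have : 0 <= w * y ^+ 2 by rewrite mulr_ge0// sqr_ge0.
lra.
Qed.

End Lyapunov.

(** * Products through the rank-one matrices [RA] and [RB] *)

Section Rank1Products.
Context {R : realType}.

Lemma mulmx_RA (rA : R) m n (A : 'M[R]_(m, 2)) (B : 'M[R]_(2, n)) i j :
  (A *m RA rA *m B) i j = A i 0 * rA^-1 * B 0 j.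
Proof.
rewrite !mxE !big_ord_recl !big_ord0 !mxE !big_ord_recl !big_ord0 !mxE /=.
by rewrite !mulr0 !addr0 mul0r addr0.
Qed.

Lemma mulmx_RB (rB : R) m n (A : 'M[R]_(m, 2)) (B : 'M[R]_(2, n)) i j :
  (A *m RB rB *m B) i j = A i 1 * rB^-1 * B 1 j.
Proof.
have -> : (1 : 'I_2) = lift ord0 ord0 by apply: val_inj.
rewrite !mxE !big_ord_recl !big_ord0 !mxE !big_ord_recl !big_ord0 !mxE /=.
by rewrite !mulr0 !addr0 mul0r !add0r.
Qed.

End Rank1Products.

(** * The game Riccati system as a rescaled quadratic system in six coordinates *)

Section GameSystem.
Context {R : realType}.
Local Notation state := ('I_6 -> R).

Definition i0 : 'I_6 := @Ordinal 6 0 isT.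
Definition i1 : 'I_6 := @Ordinal 6 1 isT.
Definition i2 : 'I_6 := @Ordinal 6 2 isT.
Definition i3 : 'I_6 := @Ordinal 6 3 isT.
Definition i4 : 'I_6 := @Ordinal 6 4 isT.
Definition i5 : 'I_6 := @Ordinal 6 5 isT.

Lemma ord6P (P : 'I_6 -> Prop) :
  P i0 -> P i1 -> P i2 -> P i3 -> P i4 -> P i5 -> forall i, P i.
Proof.
move=> P0 P1 P2 P3 P4 P5; case=> [[|[|[|[|[|[|//]]]]]] ?].
- by congr P: P0; apply: val_inj.
- by congr P: P1; apply: val_inj.
- by congr P: P2; apply: val_inj.
- by congr P: P3; apply: val_inj.
- by congr P: P4; apply: val_inj.
- by congr P: P5; apply: val_inj.
Qed.

Definition six (x0 x1 x2 x3 x4 x5 : R) : state :=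
  fun i => nth 0 [:: x0; x1; x2; x3; x4; x5] i.

(* The coordinates are the entries 11, 12, 22 of [theta^A], then those of
   [theta^B], in reversed time.  With [e] of order [sqrt (1 + |b|)], dividing them
   by [e^2, e, 1, e^4, e^3, e^2] makes the solution bounded uniformly in [b], while
   all coefficients of the quadratic part become of order [e^2]. *)
Definition game_quad (iA iB lam : R) (u v : state) : state := six
  (- lam * (iA * (u i0 * v i0) + 2 * iB * (u i1 * v i4)))
  (- lam * (iA * (u i0 * v i1) + iB * (u i1 * v i5) + iB * (u i2 * v i4)))
  (- lam * (iA * (u i1 * v i1) + 2 * iB * (u i2 * v i5)))
  (- lam * (iB * (u i4 * v i4) + 2 * iA * (u i0 * v i3)))
  (- lam * (iB * (u i4 * v i5) + iA * (u i0 * v i4) + iA * (u i3 * v i1)))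
  (- lam * (iB * (u i5 * v i5) + 2 * iA * (u i1 * v i4))).

Definition game_force (qA qB a b e : R) : state := six
  (qA / e ^+ 2) (- qA * a / e) (qA * a ^+ 2)
  (qB * b ^+ 2 / e ^+ 4) (- qB * b / e ^+ 3) (qB / e ^+ 2).

Definition game_state (e T : R) (tA tB : R -> 'M[R]_2) (i : 'I_6) (t : R) : R :=
  six (tA (T - clamp 0 T t) 0 0 / e ^+ 2) (tA (T - clamp 0 T t) 0 1 / e)
    (tA (T - clamp 0 T t) 1 1) (tB (T - clamp 0 T t) 0 0 / e ^+ 4)
    (tB (T - clamp 0 T t) 0 1 / e ^+ 3) (tB (T - clamp 0 T t) 1 1 / e ^+ 2) i.

(** In every coordinate the coefficients sum to [iA + 2 * iB] or [2 * iA + iB], at most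
    [2 * (iA + iB)]. *)
Lemma game_quad_bilinear iA iB lam : 0 <= iA -> 0 <= iB -> 0 <= lam ->
  bounded_bilinear (game_quad iA iB lam) (2 * (iA + iB) * lam).
Proof.
move=> A0 B0 l0; split.
- by move=> u u' v; apply: ord6P; rewrite /game_quad /six /=; ring.
- by move=> u u' v; apply: ord6P; rewrite /game_quad /six /=; ring.
- by move=> c u v; apply: ord6P; rewrite /game_quad /six /=; ring.
- by move=> c u v; apply: ord6P; rewrite /game_quad /six /=; ring.
- move=> y z cy cz.
  have Q c i j : continuous (fun t => c * (y i t * z j t)).
    by move=> t; apply: cvgM; [exact: cvg_cst | apply: cvgM; [exact: cy | exact: cz]].
  have Z c (f : R -> R) : continuous f -> continuous (fun t => c * f t).
    by move=> cf t; apply: cvgM; [exact: cvg_cst | exact: cf].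
  have D (f g : R -> R) : continuous f -> continuous g -> continuous (fun t => f t + g t).
    by move=> cf cg t; apply: cvgD; [exact: cf | exact: cg].
  apply: ord6P; rewrite /game_quad /six /=; apply: Z.
  + by apply: D; exact: Q.
  + by apply: (D); [apply: D|]; exact: Q.
  + by apply: D; exact: Q.
  + by apply: D; exact: Q.
  + by apply: (D); [apply: D|]; exact: Q.
  + by apply: D; exact: Q.
- by rewrite !mulr_ge0// addr_ge0.
move=> u v d e ud ve.
have P i j : `|u i * v j| <= d * e by rewrite normrM ler_pM.
have p0 : 0 <= d * e by rewrite (le_trans _ (P i0 i0)).
have S (c1 c2 c3 : R) i j k l p q : 0 <= c1 -> 0 <= c2 -> 0 <= c3 ->
    c1 + c2 + c3 <= 2 * (iA + iB) ->
    `|- lam * (c1 * (u i * v j) + c2 * (u k * v l) + c3 * (u p * v q))|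
      <= 2 * (iA + iB) * lam * (d * e).
  move=> h1 h2 h3 hs; rewrite normrM normrN (ger0_norm l0).
  rewrite (mulrC _ lam) -mulrA ler_wpM2l//.
  apply: (le_trans (ler_normD _ _)); apply: (le_trans (lerD (ler_normD _ _) (lexx _))).
  rewrite !(normrM c1) !(normrM c2) !(normrM c3) (ger0_norm h1) (ger0_norm h2) (ger0_norm h3).
  have := ler_wpM2l h1 (P i j); have := ler_wpM2l h2 (P k l); have := ler_wpM2l h3 (P p q).
  have := ler_wpM2r p0 hs; lra.
have S2 (c1 c2 : R) i j k l : 0 <= c1 -> 0 <= c2 -> c1 + c2 <= 2 * (iA + iB) ->
    `|- lam * (c1 * (u i * v j) + c2 * (u k * v l))| <= 2 * (iA + iB) * lam * (d * e).
  move=> h1 h2 hs; have := S c1 c2 0 i j k l i0 i0 h1 h2 (lexx 0).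
  by rewrite mul0r !addr0; apply.
by apply: ord6P; rewrite /game_quad /six /=; (apply: S || apply: S2); lra.
Qed.

Variables (qA qB rA rB tau T : R).
Hypotheses (hqA : 0 < qA) (hqB : 0 < qB) (hrA : 0 < rA) (hrB : 0 < rB).
Hypotheses (T0 : 0 < T) (Ttau : T < tau).

Lemma game_symmetric a b tA tB t :
  game_riccati_solution qA qB rA rB a b T `[0, tau] tA tB -> 0 <= t <= tau ->
  tA t 1 0 = tA t 0 1 /\ tB t 1 0 = tB t 0 1.
Proof.
move=> [[sA sB] _ _ _] tT; have D : `[0, tau]%classic t by rewrite /= in_itv.
have /matrixP/(_ 0 1) := sA t D; have /matrixP/(_ 0 1) := sB t D.
by rewrite !mxE => -> ->.
Qed.

(** The weights [2, 1, 0, 4, 3, 2] make the system homogeneous: each product in an equation weighs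
    exactly [2] more than the entry being differentiated. Hence one common factor [e ^+ 2] stands in
    front of the quadratic part. *)
Lemma game_state_solution a b e tA tB : 0 < e ->
  game_riccati_solution qA qB rA rB a b T `[0, tau] tA tB ->
  quad_solution (game_quad rA^-1 rB^-1 (e ^+ 2)) T (game_force qA qB a b e)
    (game_state e T tA tB).
Proof.
move=> e0 H; have sym := game_symmetric H.
case: H => _ /dv_within_coord dA /dv_within_coord dB [A0 B0].
have en0 : e != 0 by rewrite gt_eqF.
have Ttau' : 0 <= T <= tau by rewrite !ltW.
have cR f df := @dv_within_rev_continuous R f df tau T Ttau'.
have dR f df t := @dv_within_rev R f df tau T t (ltW Ttau).
split.
- have dvc (f : R -> R) c : continuous f -> continuous (fun t => f t / c).
    by move=> cf t; apply: cvgM; [exact: cf | exact: cvg_cst].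
  apply: ord6P; rewrite /game_state /six /=; try apply: dvc;
    by [exact: cR (dA _ _) | exact: cR (dB _ _)].
- have c00 : clamp 0 T 0 = 0 by rewrite clampK// lexx/= ltW.
  by apply: ord6P; rewrite /game_state /six /= c00 subr0 ?A0 ?B0 mxE// mul0r.
move=> t tT.
have sT : 0 <= T - clamp 0 T t <= tau.
  have := Ttau; have /andP[? ?] := clamp_itv t (ltW T0).
  by move=> ?; apply/andP; split; lra.
have [sA sB] := sym _ sT.
have dvc (f : R -> R) c k : is_derive t 1 f k -> is_derive t 1 (fun t => f t / c) (k / c).
  move=> fk; rewrite mulrC.
  by have := dvZ c^-1 fk; congr (is_derive _ _ _ _); apply/funext => s; rewrite mulrC.
have E (A B : 'M[R]_2) i j : (A *m RA rA *m B) i j = A i 0 * rA^-1 * B 0 j.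
  exact: mulmx_RA.
have E' (A B : 'M[R]_2) i j : (A *m RB rB *m B) i j = A i 1 * rB^-1 * B 1 j.
  exact: mulmx_RB.
have rA0 : rA != 0 by rewrite gt_eqF.
have rB0 : rB != 0 by rewrite gt_eqF.
have mxD (A B : 'M[R]_2) i j : (A + B) i j = A i j + B i j by rewrite mxE.
have mxN (A : 'M[R]_2) i j : (- A) i j = - A i j by rewrite mxE.
have QAE i j : QA qA a i j = qA * mx22 1 (- a) (- a) (a ^+ 2) i j by rewrite mxE.
have QBE i j : QB qB b i j = qB * mx22 (b ^+ 2) (- b) (- b) 1 i j by rewrite mxE.
apply: ord6P; rewrite /game_state /six /=.
- apply: is_derive_eq (dvc _ _ _ (dR _ _ t (dA 0 0) tT)) _.
  rewrite /game_force /game_quad /six /= !mxD !mxN !E !E' QAE mxE /= ?sA ?sB.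
  by field; rewrite ?en0 ?rA0 ?rB0.
- apply: is_derive_eq (dvc _ _ _ (dR _ _ t (dA 0 1) tT)) _.
  rewrite /game_force /game_quad /six /= !mxD !mxN !E !E' QAE mxE /= ?sA ?sB.
  by field; rewrite ?en0 ?rA0 ?rB0.
- apply: is_derive_eq (dR _ _ t (dA 1 1) tT) _.
  rewrite /game_force /game_quad /six /= !mxD !mxN !E !E' QAE mxE /= ?sA ?sB.
  by field; rewrite ?en0 ?rA0 ?rB0.
- apply: is_derive_eq (dvc _ _ _ (dR _ _ t (dB 0 0) tT)) _.
  rewrite /game_force /game_quad /six /= !mxD !mxN !E !E' QBE mxE /= ?sA ?sB.
  by field; rewrite ?en0 ?rA0 ?rB0.
- apply: is_derive_eq (dvc _ _ _ (dR _ _ t (dB 0 1) tT)) _.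
  rewrite /game_force /game_quad /six /= !mxD !mxN !E !E' QBE mxE /= ?sA ?sB.
  by field; rewrite ?en0 ?rA0 ?rB0.
- apply: is_derive_eq (dvc _ _ _ (dR _ _ t (dB 1 1) tT)) _.
  rewrite /game_force /game_quad /six /= !mxD !mxN !E !E' QBE mxE /= ?sA ?sB.
  by field; rewrite ?en0 ?rA0 ?rB0.
Qed.

End GameSystem.

(** * A priori bounds on the game matrices, with explicit growth in [b] *)

Section GameBound.
Context {R : realType}.

(** The level at which damping wins. If [m] is the inverse of [iA^-1 + iB^-1], then
    [m * K = m + (iA + iB) * C1 + qA + qB] with [C1 = (qA + qB) * a0 * T]: the last three terms pay
    for the coupling and the force, and the first is to spare. *)
Definition trace_const (qA qB iA iB a0 T : R) : R :=
  1 + ((iA + iB) * ((qA + qB) * a0 * T) + qA + qB) * (iA^-1 + iB^-1).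

Lemma trace_const_ge1 qA qB iA iB a0 T : 0 < qA -> 0 < qB -> 0 < iA -> 0 < iB ->
  0 <= a0 -> 0 <= T -> 1 <= trace_const qA qB iA iB a0 T.
Proof.
move=> A0 B0 iA0 iB0 a00 T0; rewrite lerDl mulr_ge0//.
  by rewrite !addr_ge0 ?mulr_ge0 ?addr_ge0// ltW.
by rewrite addr_ge0// invr_ge0 ltW.
Qed.

(** The coupling term [y * v] has no sign and occurs in the equations of both [x] and [u].
    Semidefiniteness bounds [(y * v) ^+ 2] by [(x * u) * (w * s)], where [w] and [s] are already
    under control; so the coupling is at most linear in [x + u], and the quadratic damping of the
    sum dominates it. *)
Lemma game_entries_bound (qA qB iA iB a b a0 B T : R) (x y w s v u : R -> R) :
  0 < qA -> 0 < qB -> 0 < iA -> 0 < iB -> 0 <= T ->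
  `|a| <= a0 -> `|b| <= B -> 1 <= B ->
  [/\ continuous x, continuous y & continuous w] ->
  [/\ continuous s, continuous v & continuous u] ->
  [/\ x 0 = 0, y 0 = 0 & w 0 = 0] -> [/\ s 0 = 0, v 0 = 0 & u 0 = 0] ->
  (forall t, 0 < t < T -> [/\
    is_derive t 1 x (qA - iA * x t ^+ 2 - 2 * iB * y t * v t),
    is_derive t 1 y (- qA * a - iA * x t * y t - iB * (y t * u t + w t * v t)) &
    is_derive t 1 w (qA * a ^+ 2 - iA * y t ^+ 2 - 2 * iB * w t * u t)]) ->
  (forall t, 0 < t < T -> [/\
    is_derive t 1 s (qB * b ^+ 2 - iB * v t ^+ 2 - 2 * iA * x t * s t),
    is_derive t 1 v (- qB * b - iB * v t * u t - iA * (x t * v t + s t * y t)) &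
    is_derive t 1 u (qB - iB * u t ^+ 2 - 2 * iA * y t * v t)]) ->
  let K := trace_const qA qB iA iB a0 T in
  forall t, 0 <= t <= T ->
  [/\ 0 <= x t <= K * B, y t ^+ 2 <= x t * w t & 0 <= w t <= qA * a0 ^+ 2 * T] /\
  [/\ 0 <= s t <= qB * B ^+ 2 * T, v t ^+ 2 <= s t * u t & 0 <= u t <= K * B].
Proof.
move=> A0 B0 iA0 iB0 T0 aa0 bB B1 [cx cy cw] [cs cv cu] x0 s0 dA dB K.
have cZ c (f : R -> R) : continuous f -> continuous (fun t => c * f t).
  by move=> cf t; apply: cvgM; [exact: cvg_cst | exact: cf].
have pA t : 0 <= t <= T -> [/\ 0 <= x t, 0 <= w t & y t ^+ 2 <= x t * w t].
  move=> tT; apply: psd_entries => e1 e2.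
  (* The closed-loop matrix is [RA theta^A + RB theta^B], for both players. Moving half of the own
     quadratic term to the force gives [QA + theta^A RA theta^A], a sum of two squares. *)
  apply: (@lyapunov_psd R T x y w (fun t => iA * x t) (fun t => iA * y t)
    (fun t => iB * v t) (fun t => iB * u t) (fun t => qA + iA * x t ^+ 2)
    (fun t => - qA * a + iA * (x t * y t)) (fun t => qA * a ^+ 2 + iA * y t ^+ 2)
    _ x0 _ _ _ t e1 e2 tT) => // [|r /dA[dx dy dw]|r f1 f2 _].
  - by split; exact: cZ.
  - split; [apply: is_derive_eq dx _ | apply: is_derive_eq dy _
      | apply: is_derive_eq dw _]; ring.
  rewrite (_ : _ + _ = qA * (f1 - a * f2) ^+ 2 + iA * (x r * f1 + y r * f2) ^+ 2);
    last by ring.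
  by rewrite addr_ge0// mulr_ge0 ?sqr_ge0// ltW.
have pB t : 0 <= t <= T -> [/\ 0 <= s t, 0 <= u t & v t ^+ 2 <= s t * u t].
  move=> tT; apply: psd_entries => e1 e2.
  apply: (@lyapunov_psd R T s v u (fun t => iA * x t) (fun t => iA * y t)
    (fun t => iB * v t) (fun t => iB * u t) (fun t => qB * b ^+ 2 + iB * v t ^+ 2)
    (fun t => - qB * b + iB * (v t * u t)) (fun t => qB + iB * u t ^+ 2)
    _ s0 _ _ _ t e1 e2 tT) => // [|r /dB[ds dv du]|r f1 f2 _].
  - by split; exact: cZ.
  - split; [apply: is_derive_eq ds _ | apply: is_derive_eq dv _
      | apply: is_derive_eq du _]; ring.
  rewrite (_ : _ + _ = qB * (b * f1 - f2) ^+ 2 + iB * (v r * f1 + u r * f2) ^+ 2);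
    last by ring.
  by rewrite addr_ge0// mulr_ge0 ?sqr_ge0// ltW.
have a00 : 0 <= a0 by exact: le_trans aa0.
have a2 : a ^+ 2 <= a0 ^+ 2.
  by rewrite -(real_normK (num_real a)) ler_pXn2r// nnegrE.
have b2 : b ^+ 2 <= B ^+ 2.
  by rewrite -(real_normK (num_real b)) ler_pXn2r// nnegrE// (le_trans _ bB).
have dx t (tT : 0 < t < T) : is_derive t 1 x (qA - iA * x t ^+ 2 - 2 * iB * y t * v t).
  by case: (dA t tT).
have dw t (tT : 0 < t < T) :
    is_derive t 1 w (qA * a ^+ 2 - iA * y t ^+ 2 - 2 * iB * w t * u t).
  by case: (dA t tT).
have ds t (tT : 0 < t < T) :
    is_derive t 1 s (qB * b ^+ 2 - iB * v t ^+ 2 - 2 * iA * x t * s t).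
  by case: (dB t tT).
have du t (tT : 0 < t < T) : is_derive t 1 u (qB - iB * u t ^+ 2 - 2 * iA * y t * v t).
  by case: (dB t tT).
have oo t : 0 < t < T -> 0 <= t <= T by case/andP => ? ?; rewrite !ltW.
have linear_bound (f df : R -> R) c : continuous f -> f 0 = 0 -> 0 <= c ->
    (forall t, 0 < t < T -> is_derive t 1 f (df t)) ->
    (forall t, 0 < t < T -> df t <= c) -> forall t, 0 <= t <= T -> f t <= c * T.
  move=> cf f0 c0 fd dfc t /andP[t0 tT].
  have H : f t - c * t <= f 0 - c * 0.
    have cg : continuous (fun t => f t - c * t).
      by move=> r; apply: cvgB; [exact: cf | apply: cvgM; [exact: cvg_cst | exact: cvg_id]].
    apply: (dv_le0_le cg (fun r rT => dvB (fd r rT) (dvZ c (is_derive_id r 1))) _ (lexx 0) t0 tT).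
    by move=> r rT; rewrite mulr1 subr_le0; exact: dfc.
  have := ler_wpM2l c0 tT; move: H; rewrite f0; lra.
have wB t : 0 <= t <= T -> w t <= qA * a0 ^+ 2 * T.
  case: x0 => _ _ w0.
  apply: (linear_bound _ _ _ cw w0 _ dw).
    by rewrite mulr_ge0 ?sqr_ge0// ltW.
  move=> r rT'; have rT := oo r rT'; have [_ w1 _] := pA r rT; have [_ u1 _] := pB r rT.
  have h1 : 0 <= iA * y r ^+ 2 by rewrite mulr_ge0 ?sqr_ge0// ltW.
  have h2 : 0 <= iB * (w r * u r) by rewrite mulr_ge0 ?mulr_ge0// ltW.
  have := ler_wpM2l (ltW A0) a2; lra.
have sB t : 0 <= t <= T -> s t <= qB * B ^+ 2 * T.
  case: s0 => s0 _ _.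
  apply: (linear_bound _ _ _ cs s0 _ ds).
    by rewrite mulr_ge0 ?sqr_ge0// ltW.
  move=> r rT'; have rT := oo r rT'; have [x1 _ _] := pA r rT; have [s1 _ _] := pB r rT.
  have h1 : 0 <= iB * v r ^+ 2 by rewrite mulr_ge0 ?sqr_ge0// ltW.
  have h2 : 0 <= iA * (x r * s r) by rewrite mulr_ge0 ?mulr_ge0// ltW.
  have := ler_wpM2l (ltW B0) b2; lra.
pose C1 := (qA + qB) * a0 * T.
have C10 : 0 <= C1 by rewrite !mulr_ge0// addr_ge0 ?ltW.
have yv t : 0 <= t <= T -> `|y t * v t| <= C1 * B * (x t + u t) / 2.
  move=> tT; have [x1 w1 y2] := pA t tT; have [s1 u1 v2] := pB t tT.
  have B00 : 0 <= B by lra.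
  rewrite -(ler_pXn2r (ltn0Sn 1)) ?nnegrE//; last first.
    by apply: divr_ge0 => //; apply: mulr_ge0; [exact: mulr_ge0 | exact: addr_ge0].
  rewrite real_normK ?num_real// exprMn.
  apply: (le_trans (ler_pM (sqr_ge0 _) (sqr_ge0 _) y2 v2)).
  have h1 := ler_pM w1 s1 (wB t tT) (sB t tT).
  have h2 : qA * a0 ^+ 2 * T * (qB * B ^+ 2 * T) <= (C1 * B) ^+ 2.
    rewrite (_ : (C1 * B) ^+ 2 = (qA + qB) ^+ 2 * (a0 * T * B) ^+ 2); last by rewrite /C1; ring.
    rewrite (_ : _ * _ = (qA * qB) * (a0 * T * B) ^+ 2); last by ring.
    rewrite ler_wpM2r ?sqr_ge0//.
    have := sqr_ge0 qA; have := sqr_ge0 qB; have := mulr_gt0 A0 B0; lra.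
  have h3 := ler_wpM2l (mulr_ge0 x1 u1) (le_trans h1 h2).
  have h4 : x t * u t <= ((x t + u t) / 2) ^+ 2.
    have := sqr_ge0 (x t - u t); lra.
  have := ler_wpM2r (sqr_ge0 (C1 * B)) h4; lra.
have tr t : 0 <= t <= T -> x t + u t <= K * B.
  have K1 : 1 <= K by exact: trace_const_ge1.
  have cxu : continuous (fun t => x t + u t).
    by move=> r; apply: cvgD; [exact: cx | exact: cu].
  apply: (barrier cxu (fun r rT => dvD (dx r rT) (du r rT))).
    by case: x0 => -> _ _; case: s0 => _ _ ->; rewrite addr0 mulr_ge0//; lra.
  move=> r rT' Ks; have rT := oo r rT'; have [x1 _ _] := pA r rT; have [_ u1 _] := pB r rT.
  have := yv r rT; set S := x r + u r in Ks *; rewrite ler_norml => /andP[yv1 _].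
  have S1 : 1 <= S by have := ler_pM ler01 ler01 K1 B1; lra.
  (* [m] is the minimum of [iA * x ^+ 2 + iB * u ^+ 2] on the line [x + u = 1]. *)
  pose m := (iA^-1 + iB^-1)^-1.
  have ii0 : 0 < iA^-1 + iB^-1 by rewrite addr_gt0// invr_gt0.
  have mS : m * S ^+ 2 <= iA * x r ^+ 2 + iB * u r ^+ 2.
    rewrite /m mulrC ler_pdivrMr//.
    rewrite [leRHS](_ : _ = S ^+ 2 + (iA * x r - iB * u r) ^+ 2 / (iA * iB)).
      by rewrite lerDl divr_ge0 ?sqr_ge0// mulr_ge0 ?ltW.
    by rewrite /S; field; rewrite !gt_eqF.
  have mK : m * K = m + ((iA + iB) * C1 + qA + qB).
    by rewrite /m /K /trace_const -/C1; field; rewrite !gt_eqF ?addr_gt0.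
  have m0 : 0 < m by rewrite invr_gt0.
  have h1 : m * (K * B) * S <= m * S ^+ 2.
    by rewrite expr2 -!mulrA ler_pM2l// mulrA ler_wpM2r ?ltW//; lra.
  have h2 : (qA + qB) <= (qA + qB) * (B * S).
    apply: ler_peMr; first by rewrite addr_ge0// ltW.
    by have := ler_pM ler01 ler01 B1 S1; rewrite mulr1.
  have h3 := ler_wpM2l (ltW (addr_gt0 iA0 iB0)) yv1.
  have h4 : 0 <= m * (B * S).
    apply: mulr_ge0; first exact: ltW.
    by apply: mulr_ge0; [exact: le_trans ler01 B1 | exact: le_trans ler01 S1].
  have h5 : m * (K * B) * S = m * (B * S) + ((iA + iB) * C1 + qA + qB) * (B * S).
    by rewrite -mulrDl -mK; ring.
  move: h1 h2 h3 mS; rewrite h5; lra.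
move=> t tT; have [x1 w1 y2] := pA t tT; have [s1 u1 v2] := pB t tT.
have trt := tr t tT; rewrite x1 y2 w1 s1 v2 u1 (wB t tT) (sB t tT)/=.
by split; split=> //; lra.
Qed.

(** With [K] the trace constant, [P = qA * a0 ^+ 2 * T] and [Q = qB * T], this product dominates
    [K], [P], [Q], and also [K * P + 1] and [K * Q + 1], which bound the off-diagonal entries
    through their squares. *)
Definition game_bound (qA qB iA iB a0 T : R) : R :=
  (trace_const qA qB iA iB a0 T + 1) * (1 + qA * a0 ^+ 2 * T + qB * T).

Variables (qA qB rA rB tau T : R).
Hypotheses (hqA : 0 < qA) (hqB : 0 < qB) (hrA : 0 < rA) (hrB : 0 < rB).
Hypotheses (T0 : 0 < T) (Ttau : T < tau).

Lemma game_state_bound a b a0 e tA tB :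
  game_riccati_solution qA qB rA rB a b T `[0, tau] tA tB ->
  `|a| <= a0 -> 1 <= e -> `|b| <= e ^+ 2 ->
  forall i t, 0 <= t <= T ->
    `|game_state e T tA tB i t| <= game_bound qA qB rA^-1 rB^-1 a0 T.
Proof.
move=> H aa0 e1 be i t tT; move: i.
(* The estimates are made for the unscaled state, of weight [1], with [B = e ^+ 2]; the powers of
   [e] are divided out afterwards. *)
have [cz z0 dz] := game_state_solution hrA hrB T0 Ttau ltr01 H.
have e0 : 0 < e by lra.
have B1 : 1 <= e ^+ 2 by rewrite exprn_ege1.
set z := game_state 1 T tA tB in cz z0 dz.
have iA0 : 0 < rA^-1 by rewrite invr_gt0.
have iB0 : 0 < rB^-1 by rewrite invr_gt0.
have a00 : 0 <= a0 by exact: le_trans aa0.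
pose K := trace_const qA qB rA^-1 rB^-1 a0 T.
have K1 : 1 <= K by apply: trace_const_ge1 => //; exact: ltW.
have [] := @game_entries_bound qA qB rA^-1 rB^-1 a b a0 (e ^+ 2) T
  (z i0) (z i1) (z i2) (z i3) (z i4) (z i5) hqA hqB iA0 iB0 (ltW T0) aa0 be B1
  (And3 (cz _) (cz _) (cz _)) (And3 (cz _) (cz _) (cz _))
  (And3 (z0 _) (z0 _) (z0 _)) (And3 (z0 _) (z0 _) (z0 _)) _ _ t tT.
- move=> r rT; have d := dz r rT; split; [apply: is_derive_eq (d i0) _ |
    apply: is_derive_eq (d i1) _ | apply: is_derive_eq (d i2) _];
  rewrite /game_quad /game_force /six /= ?expr1n ?divr1; ring.
- move=> r rT; have d := dz r rT; split; [apply: is_derive_eq (d i3) _ |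
    apply: is_derive_eq (d i4) _ | apply: is_derive_eq (d i5) _];
  rewrite /game_quad /game_force /six /= ?expr1n ?divr1; ring.
move=> [/andP[x1 x2] y2 /andP[w1 w2]] [/andP[s1 s2] v2 /andP[u1 u2]].
pose P := qA * a0 ^+ 2 * T; pose Q := qB * T.
have P0 : 0 <= P by rewrite !mulr_ge0 ?sqr_ge0// ltW.
have Q0 : 0 <= Q by rewrite mulr_ge0 ?ltW.
have PQ : game_bound qA qB rA^-1 rB^-1 a0 T = (K + 1) * (1 + P + Q) by [].
have KM : K <= (K + 1) * (1 + P + Q).
  by have := mulr_ge0 (ltW (lt_le_trans ltr01 K1)) (addr_ge0 P0 Q0); lra.
have sq (c r : R) : 0 <= c -> r ^+ 2 <= c -> `|r| <= c + 1.
  move=> c0 rc; rewrite -(ler_pXn2r (ltn0Sn 1)) ?nnegrE ?addr_ge0//.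
  by rewrite real_normK ?num_real//; have := sqr_ge0 c; lra.
have KP : K * P + 1 <= (K + 1) * (1 + P + Q).
  by have := mulr_ge0 (ltW (lt_le_trans ltr01 K1)) Q0; lra.
have KQ : K * Q + 1 <= (K + 1) * (1 + P + Q).
  by have := mulr_ge0 (ltW (lt_le_trans ltr01 K1)) P0; lra.
have ge0K : 0 <= K by lra.
have zE (j : 'I_6) k : z j t = game_state e T tA tB j t * e ^+ k ->
    game_state e T tA tB j t = z j t / e ^+ k.
  by move=> ->; rewrite mulfK// gt_eqF// exprn_gt0.
have ek k : 0 < e ^+ k by rewrite exprn_gt0.
have ek' k : 0 <= e ^+ k by rewrite ltW.
have en0 : e != 0 by rewrite gt_eqF.
rewrite PQ; apply: ord6P.
- rewrite (zE i0 2%N); last by rewrite /z /game_state /six /= expr1n; field.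
  rewrite ger0_norm; last exact: divr_ge0.
  rewrite ler_pdivrMr//.
  by apply: (le_trans x2); rewrite ler_wpM2r.
- rewrite (zE i1 1%N); last by rewrite /z /game_state /six /= expr1; field.
  apply: (le_trans (sq (K * P) _ (mulr_ge0 ge0K P0) _)) => //.
  rewrite expr1 exprMn exprVn ler_pdivrMr//.
  apply: (le_trans y2); apply: (le_trans (ler_pM x1 w1 x2 w2)).
  by rewrite le_eqVlt /P /K; apply/orP; left; apply/eqP; ring.
- rewrite (zE i2 0%N); last by rewrite /z /game_state /six /= mulr1.
  rewrite divr1 ger0_norm//; apply: (le_trans w2); rewrite -/P.
  by have := mulr_ge0 ge0K P0; have := mulr_ge0 ge0K Q0; lra.
- rewrite (zE i3 4%N); last by rewrite /z /game_state /six /= expr1n; field.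
  rewrite ger0_norm; last exact: divr_ge0.
  rewrite ler_pdivrMr//.
  apply: (le_trans s2); rewrite (_ : _ * T = Q * e ^+ 4); last by rewrite /Q; ring.
  rewrite ler_wpM2r//.
  by have := mulr_ge0 ge0K P0; have := mulr_ge0 ge0K Q0; lra.
- rewrite (zE i4 3%N); last by rewrite /z /game_state /six /= expr1n; field.
  apply: (le_trans (sq (K * Q) _ (mulr_ge0 ge0K Q0) _)) => //.
  rewrite exprMn exprVn ler_pdivrMr; last by rewrite exprn_gt0.
  apply: (le_trans v2); apply: (le_trans (ler_pM s1 u1 s2 u2)).
  by rewrite le_eqVlt /Q /K; apply/orP; left; apply/eqP; ring.
- rewrite (zE i5 2%N); last by rewrite /z /game_state /six /= expr1n; field.
  rewrite ger0_norm; last exact: divr_ge0.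
  rewrite ler_pdivrMr//.
  by apply: (le_trans u2); rewrite ler_wpM2r.
Qed.

End GameBound.

(** * Derivatives of the game matrices in the parameters, with exponential bounds *)

Section GameFamily.
Context {R : realType}.
Variables (qA qB rA rB tau T : R).
Hypotheses (hqA : 0 < qA) (hqB : 0 < qB) (hrA : 0 < rA) (hrB : 0 < rB).
Hypotheses (T0 : 0 < T) (Ttau : T < tau).
Variables (thA thB : R -> R -> R -> 'M[R]_2).
Hypothesis game : forall a b, game_riccati_solution qA qB rA rB a b T `[0, tau]
  (fun t => thA t a b) (fun t => thB t a b).

Let M a0 := game_bound qA qB rA^-1 rB^-1 a0 T.

Definition entry_state e a b := game_state e T (fun t => thA t a b) (fun t => thB t a b).

(* The weight [e] is quantified inside: the same entry is read off the state rescaled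
   by any [e], which can then be chosen according to [b]. *)
Definition game_entry (f : R -> R -> R -> R) := exists i k, (k <= 4)%N /\
  forall e t a b, 0 < e -> 0 <= t <= T -> f t a b = e ^+ k * entry_state e a b i (T - t).

Lemma game_entryA i j : game_entry (fun t a b => thA t a b i j).
Proof.
have E t := @rev_clampK R T t.
have sym t a b : 0 <= t <= T -> thA t a b 1 0 = thA t a b 0 1.
  move=> /andP[t0 tT]; have tt : 0 <= t <= tau by rewrite t0 (le_trans tT) ?ltW.
  by have [] := game_symmetric (game a b) tt.
have n0 e : 0 < e -> e != 0 :> R by move=> ?; rewrite gt_eqF.
have [i0E|i1E] : i = 0 \/ i = 1.
  by case: i => [[|[|//]] ?]; [left|right]; apply: val_inj.
all: have [j0E|j1E] : j = 0 \/ j = 1 by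
  case: j => [[|[|//]] ?]; [left|right]; apply: val_inj.
- exists i0, 2%N; split=> // e t a b e0 tT; rewrite i0E j0E /entry_state /game_state /six /= E//.
  by field; exact: n0.
- exists i1, 1%N; split=> // e t a b e0 tT; rewrite i0E j1E /entry_state /game_state /six /= E//.
  by field; exact: n0.
- exists i1, 1%N; split=> // e t a b e0 tT; rewrite i1E j0E sym//.
  by rewrite /entry_state /game_state /six /= E//; field; exact: n0.
- exists i2, 0%N; split=> // e t a b e0 tT; rewrite i1E j1E /entry_state /game_state /six /= E//.
  by rewrite mul1r.
Qed.

Lemma game_entryB i j : game_entry (fun t a b => thB t a b i j).
Proof.
have E t := @rev_clampK R T t.
have sym t a b : 0 <= t <= T -> thB t a b 1 0 = thB t a b 0 1.
  move=> /andP[t0 tT]; have tt : 0 <= t <= tau by rewrite t0 (le_trans tT) ?ltW.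
  by have [] := game_symmetric (game a b) tt.
have n0 e : 0 < e -> e != 0 :> R by move=> ?; rewrite gt_eqF.
have [i0E|i1E] : i = 0 \/ i = 1.
  by case: i => [[|[|//]] ?]; [left|right]; apply: val_inj.
all: have [j0E|j1E] : j = 0 \/ j = 1 by
  case: j => [[|[|//]] ?]; [left|right]; apply: val_inj.
- exists i3, 4%N; split=> // e t a b e0 tT; rewrite i0E j0E /entry_state /game_state /six /= E//.
  by field; exact: n0.
- exists i4, 3%N; split=> // e t a b e0 tT; rewrite i0E j1E /entry_state /game_state /six /= E//.
  by field; exact: n0.
- exists i4, 3%N; split=> // e t a b e0 tT; rewrite i1E j0E sym//.
  by rewrite /entry_state /game_state /six /= E//; field; exact: n0.
- exists i5, 2%N; split=> // e t a b e0 tT; rewrite i1E j1E /entry_state /game_state /six /= E//.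
  by field; exact: n0.
Qed.

Lemma game_entry_bound f a a0 e : game_entry f -> `|a| <= a0 -> 1 <= e ->
  forall t b, 0 <= t <= T -> `|b| <= e ^+ 2 -> `|f t a b| <= e ^+ 4 * M a0.
Proof.
move=> [i [k [k4 fE]]] aa0 e1 t b tT be; have e0 : 0 < e by lra.
rewrite (fE e)// normrM ger0_norm ?exprn_ge0 ?(ltW e0)//.
apply: ler_pM; rewrite ?exprn_ge0 ?(ltW e0)//; first exact: ler_weXn2l.
apply: (game_state_bound hqA hqB hrA hrB T0 Ttau (game a b)) => //.
by move: tT => /andP[? ?]; apply/andP; split; lra.
Qed.

Lemma game_entry_continuous f a b : game_entry f ->
  continuous (fun t => f (clamp 0 T t) a b).
Proof.
move=> [i [k [k4 fE]]].
have -> : (fun t => f (clamp 0 T t) a b) =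
    (fun t => entry_state 1 a b i (T - clamp 0 T t)).
  by apply/funext => t; rewrite (fE 1) ?expr1n ?mul1r// clamp_itv// ltW.
have [cz _ _] := game_state_solution hrA hrB T0 Ttau ltr01 (game a b).
move=> t; apply: (@continuous_comp _ _ _ (fun t => T - clamp 0 T t)); last exact: cz.
by apply: cvgB; [exact: cvg_cst | exact: clamp_continuous].
Qed.

(** Bounds the parameter derivative of the rescaled force; the weights have removed the growth in
    [b]. *)
Definition deriv_const a0 : R := 2 * (qA + qB) * (1 + a0).
(** The exponent of [growth] for [n = 6] and [Lam = 2 * (rA^-1 + rB^-1) * e ^+ 2], with
    [e ^+ 2 >= 1] factored out. The final [2] undoes the rescaling, by
    [e ^+ k <= e ^+ 4 <= expR (2 * e ^+ 2)]. *)
Definition deriv_rate a0 : R := 6%:R * (4 * (rA^-1 + rB^-1) * M a0 + 1) * T + 2.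

(** The direction [(al, be)] covers both partial derivatives at once. The margins [1] in the
    assumptions on [a0] and [e] keep the perturbed parameters, for [|h| <= 1], within reach of the
    same weight and the same bound. *)
Lemma game_entry_derivative f a b al be a0 e : game_entry f ->
  `|al| <= 1 -> `|be| <= 1 -> `|a| + 1 <= a0 -> 1 <= e -> `|b| + 1 <= e ^+ 2 ->
  exists2 D : R -> R, continuous D & forall t, 0 <= t <= T ->
    is_derive (0 : R) 1 (fun h => f t (a + h * al) (b + h * be)) (D t) /\
    `|D t| <= deriv_const a0 * expR (deriv_rate a0 * e ^+ 2).
Proof.
move=> [i [k [k4 fE]]] al1 be1 aa0 e1 be2; have e0 : 0 < e by lra.
have iA0 : 0 < rA^-1 by rewrite invr_gt0.
have iB0 : 0 < rB^-1 by rewrite invr_gt0.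
have T0' := ltW T0; have A0 := ltW hqA; have B0 := ltW hqB.
have a00 : 0 <= a0 by have := normr_ge0 a; lra.
have M0 : 0 <= M a0.
  have K1 := trace_const_ge1 hqA hqB iA0 iB0 a00 T0'.
  have P0 : 0 <= qA * a0 ^+ 2 * T by rewrite !mulr_ge0// sqr_ge0.
  have Q0 : 0 <= qB * T by rewrite mulr_ge0.
  by rewrite /M /game_bound; apply: mulr_ge0; lra.
have E2 : 1 <= e ^+ 2 by rewrite exprn_ege1.
have Ek m : 1 <= e ^+ m by rewrite exprn_ege1.
have Ek0 m : 0 < e ^+ m by rewrite exprn_gt0.
have le1V (m : nat) c : 0 <= c -> c / e ^+ m <= c.
  by move=> c0; rewrite ler_pdivrMr// ler_peMr.
pose b6 := game_quad rA^-1 rB^-1 (e ^+ 2).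
have bb : bounded_bilinear b6 (2 * (rA^-1 + rB^-1) * e ^+ 2).
  by apply: game_quad_bilinear; rewrite ltW.
pose c h := game_force qA qB (a + h * al) (b + h * be) e.
pose z h := entry_state e (a + h * al) (b + h * be).
pose c1 := six 0 (- qA * al / e) (2 * qA * a * al) (2 * qB * b * be / e ^+ 4)
  (- qB * be / e ^+ 3) 0.
have C10 : 0 <= deriv_const a0 by rewrite !mulr_ge0// addr_ge0.
have hal h x : `|x| <= 1 -> `|h| <= 1 -> `|h * x| <= 1 :> R.
  by move=> ? ?; rewrite normrM mulr_ile1.
have sz h : `|h| <= 1 -> quad_solution b6 T (c h) (z h).
  by move=> _; exact: (game_state_solution hrA hrB T0 Ttau e0 (game _ _)).
have zM h j t : `|h| <= 1 -> 0 <= t <= T -> `|z h j t| <= M a0.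
  move=> h1 tT; apply: (game_state_bound hqA hqB hrA hrB T0 Ttau (game _ _)) => //.
    by rewrite (le_trans (ler_normD _ _))//; have := hal h al al1 h1; lra.
  by rewrite (le_trans (ler_normD _ _))//; have := hal h be be1 h1; lra.
have nle1 (x y : R) : `|x| <= 1 -> 0 <= y -> y * `|x| <= y.
  by move=> x1 y0; rewrite ler_piMr.
have QQ : 0 <= (qA + qB) * a0 by rewrite mulr_ge0// addr_ge0.
have c1C j : `|c1 j| <= deriv_const a0.
  move: j; apply: ord6P; rewrite /c1 /six /=.
  - by rewrite normr0.
  - rewrite normrM normfV (gtr0_norm e0) normrM normrN (ger0_norm A0).
    have := le1V 1%N _ (mulr_ge0 A0 (normr_ge0 al)).
    by rewrite expr1 /deriv_const; have := nle1 _ _ al1 A0; lra.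
  - rewrite !normrM (ger0_norm A0) (ger0_norm (ler0n _ 2)) /deriv_const.
    have h1 := nle1 _ _ al1 (mulr_ge0 A0 (normr_ge0 a)).
    have h2 : qA * `|a| <= qA * a0 by rewrite ler_wpM2l//; lra.
    have h3 : 0 <= qB * a0 by rewrite mulr_ge0.
    by lra.
  - rewrite normrM normfV (gtr0_norm (Ek0 4%N)) !normrM (ger0_norm B0).
    rewrite (ger0_norm (ler0n _ 2)) ler_pdivrMr//.
    have h1 := nle1 _ _ be1 (mulr_ge0 B0 (normr_ge0 b)).
    have h2 : `|b| <= e ^+ 4.
      have -> : e ^+ 4 = e ^+ 2 * e ^+ 2 by rewrite -exprD.
      by have := ler_pM ler01 ler01 E2 E2; have := ler_peMr (ltW (Ek0 2%N)) E2; lra.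
    have h3 : qB * `|b| <= qB * e ^+ 4 by rewrite ler_wpM2l.
    have h4 : 2 * qB * e ^+ 4 <= deriv_const a0 * e ^+ 4.
      by apply: ler_wpM2r; [exact: ltW | rewrite /deriv_const; lra].
    by lra.
  - rewrite normrM normfV (gtr0_norm (Ek0 3%N)) normrM normrN (ger0_norm B0).
    have := le1V 3%N _ (mulr_ge0 B0 (normr_ge0 be)).
    by rewrite /deriv_const; have := nle1 _ _ be1 B0; lra.
  - by rewrite normr0.
have sq1 (x : R) : `|x| <= 1 -> x ^+ 2 <= 1.
  by move=> x1; rewrite -real_normK ?num_real// exprn_ile1.
(* The force is a polynomial of degree two in the parameters, so its expansion stops at an explicit
   [h ^+ 2] term. *)
have cC h j : `|h| <= 1 -> `|c h j - c 0 j - h * c1 j| <= (qA + qB) * h ^+ 2.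
  move=> h1; have en0 : e != 0 by rewrite gt_eqF.
  have p0 : 0 <= (qA + qB) * h ^+ 2 by rewrite mulr_ge0 ?sqr_ge0 ?addr_ge0.
  have h20 := sqr_ge0 h.
  move: j; apply: ord6P; rewrite /c /c1 /game_force /six /=.
  - by rewrite subrr mulr0 subrr normr0.
  - by rewrite (_ : _ - _ = 0) ?normr0//; field.
  - rewrite (_ : _ - _ = (qA * al ^+ 2) * h ^+ 2); last by ring.
    have q0 : 0 <= qA * al ^+ 2 by rewrite mulr_ge0// sqr_ge0.
    rewrite ger0_norm; last exact: mulr_ge0.
    apply: ler_wpM2r => //.
    by have := ler_wpM2l A0 (sq1 al al1); lra.
  - rewrite (_ : _ - _ = (qB * be ^+ 2) / e ^+ 4 * h ^+ 2); last by field.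
    have q0 : 0 <= qB * be ^+ 2 by rewrite mulr_ge0// sqr_ge0.
    rewrite ger0_norm; last by apply: mulr_ge0 => //; apply: divr_ge0 => //; exact: ltW.
    apply: ler_wpM2r => //; apply: (le_trans (le1V _ _ q0)).
    by have := ler_wpM2l B0 (sq1 be be1); lra.
  - by rewrite (_ : _ - _ = 0) ?normr0//; field.
  - by rewrite subrr mulr0 subrr normr0.
have [d [cd dC [K dK]]] := quad_param_derivative bb T0' M0 (addr_ge0 A0 B0) C10 sz zM c1C cC.
exists (fun t => e ^+ k * d i (T - t)).
  move=> t; apply: cvgM; first exact: cvg_cst.
  apply: (@continuous_comp _ _ _ (fun t => T - t)); last exact: cd.
  by apply: cvgB; [exact: cvg_cst | exact: cvg_id].
move=> t tT; have rT : 0 <= T - t <= T by move: tT => /andP[? ?]; apply/andP; split; lra.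
split.
  apply/dv_quotient/cvgrPdist_le => eps eps0; rewrite !near_withinE.
  have zf h : f t (a + h * al) (b + h * be) = e ^+ k * z h i (T - t) by exact: fE.
  have K'0 : 0 < e ^+ k * `|K| + 1 by rewrite ltr_wpDl// mulr_ge0// ltW.
  apply/nbhs_ballP; exists (Num.min 1 (eps / (e ^+ k * `|K| + 1))) => /=.
    by rewrite lt_min ltr01 divr_gt0.
  move=> h; rewrite /ball/= sub0r normrN lt_min => /andP[h1 heps] hn0.
  have H := dK h (T - t) i (ltW h1) hn0 rT.
  rewrite !zf subr0.
  rewrite (_ : _ - _ = - (e ^+ k * ((z h i (T - t) - z 0 i (T - t)) / h - d i (T - t)))).
    rewrite normrN normrM gtr0_norm//.
    have H2 : e ^+ k * `|(z h i (T - t) - z 0 i (T - t)) / h - d i (T - t)|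
        <= (e ^+ k * `|K| + 1) * `|h|.
      have := ler_wpM2l (ltW (Ek0 k)) H.
      have := ler_wpM2r (normr_ge0 h) (ler_wpM2l (ltW (Ek0 k)) (ler_norm K)).
      by have := normr_ge0 h; lra.
    by apply: (le_trans H2); rewrite mulrC -ler_pdivlMr// ltW.
  by field.
rewrite normrM gtr0_norm//.
have -> : deriv_const a0 * expR (deriv_rate a0 * e ^+ 2) =
    expR (2 * e ^+ 2) * (deriv_const a0 * expR ((deriv_rate a0 - 2) * e ^+ 2)).
  by rewrite [RHS]mulrCA -expRD; congr (_ * expR _); ring.
apply: ler_pM; rewrite ?(ltW (Ek0 _))//.
  apply: (@le_trans _ _ (e ^+ 4)); first exact: ler_weXn2l.
  rewrite expRM_natl (exprM e 2 2) ler_pXn2r ?nnegrE ?expR_ge0//.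
    by have := expR_ge1Dx (e ^+ 2); lra.
  by rewrite ltW.
apply: (le_trans (dC _ rT i)); rewrite ler_wpM2l// /growth ler_expR /deriv_rate addrK.
rewrite -subr_ge0 [X in 0 <= X](_ : _ = 6%:R * T * (e ^+ 2 - 1)); last by ring.
by rewrite !mulr_ge0// subr_ge0.
Qed.

End GameFamily.

(** * Integrability against a Gaussian, and the support of the truncated law *)

Section NormalIntegrals.
Context {R : realType}.
Local Notation mu := (@lebesgue_measure R).

(** The Radon-Nikodym derivative of [normal_prob] equals the density almost everywhere, since both
    have the same integral over every measurable set. *)
Lemma ge0_integral_normal_prob (m s : R) (f : R -> \bar R) :
  (forall x, 0 <= f x)%E -> measurable_fun setT f ->
  (\int[normal_prob m s]_x f x = \int[mu]_x (f x * (normal_pdf m s x)%:E))%E.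
Proof.
move=> f0 mf; have dom := @normal_prob_dominates R m s.
rewrite -(Radon_Nikodym_SigmaFinite.change_of_variables dom f0)//.
have iRN := Radon_Nikodym_SigmaFinite.f_integrable dom.
have mpdf : measurable_fun setT (fun x => (normal_pdf m s x)%:E).
  by apply/measurable_EFinP; exact: measurable_normal_pdf.
apply: ae_eq_integral => //.
- by apply: emeasurable_funM => //; exact: measurable_int iRN.
- exact: emeasurable_funM.
apply: ae_eqe_mul2l; apply: integral_ae_eq => //.
move=> E _ mE; rewrite -Radon_Nikodym_SigmaFinite.f_integral//.
Qed.

(** Multiplying the standard normal density by [expR (x ^+ 2 / 4)] gives a constant multiple of the
    density of variance [2], whose integral is known. *)
Lemma normal_integrable_gauss (c : R) :
  (normal_prob (0 : R) 1).-integrable setT (fun x => (expR (c + x ^+ 2 / 4))%:E).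
Proof.
have mG : measurable_fun setT (fun x : R => expR (c + x ^+ 2 / 4)).
  apply: measurableT_comp => //; apply: measurable_funD => //.
  by apply: measurable_funM => //; exact: measurable_funX.
apply/integrableP; split; first exact/measurable_EFinP.
under eq_integral do rewrite gee0_abs ?lee_fin ?expR_ge0//.
rewrite ge0_integral_normal_prob; last first.
- exact/measurable_EFinP.
- by move=> x; rewrite lee_fin expR_ge0.
pose s : R := Num.sqrt 2.
have s2 : s ^+ 2 = 2 by rewrite sqr_sqrtr.
have s0 : s != 0 by rewrite gt_eqF// sqrtr_gt0.
have ps0 : normal_peak s != 0 by rewrite gt_eqF// normal_peak_gt0.
pose k := expR c * normal_peak 1 / normal_peak s.
have E x : ((expR (c + x ^+ 2 / 4))%:E * (normal_pdf 0 1 x)%:E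
    = k%:E * (normal_pdf 0 s x)%:E)%E.
  rewrite !normal_pdfE// -!EFinM; congr EFin.
  rewrite /normal_fun subr0 s2 expr1n /k expRD.
  rewrite (_ : - x ^+ 2 / (2 *+ 2) = - (x ^+ 2 / 4)); last first.
    by rewrite (_ : 2 *+ 2 = 4 :> R) ?mulNr// -mulrnA.
  rewrite (_ : - x ^+ 2 / (1 *+ 2) = - (x ^+ 2 / 4) - (x ^+ 2 / 4)); last first.
    by rewrite (_ : 1 *+ 2 = 2 :> R)//; field.
  rewrite expRD.
  have h : expR (x ^+ 2 / 4) * expR (- (x ^+ 2 / 4)) = 1 by rewrite -expRD subrr expR0.
  set u := expR (x ^+ 2 / 4) in h *; set v := expR (- (x ^+ 2 / 4)) in h *.
  rewrite (_ : expR c * u * (normal_peak 1 * (v * v)) =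
    expR c * normal_peak 1 * v * (u * v)); last by ring.
  by rewrite h mulr1; field.
under eq_integral do rewrite E.
rewrite integralZl//=; last exact: integrable_normal_pdf.
by rewrite integral_normal_pdf mule1 ltry.
Qed.

Lemma normal_integrable_expR (c k : R) :
  (normal_prob (0 : R) 1).-integrable setT (fun x => (expR (c + k * `|x|))%:E).
Proof.
apply: (le_integrable measurableT _ _ (normal_integrable_gauss (c + k ^+ 2))).
  apply/measurable_EFinP; apply: measurableT_comp => //; apply: measurable_funD => //.
  by apply: measurable_funM => //; exact: measurableT_comp.
move=> x _; rewrite !gee0_abs ?lee_fin ?expR_ge0// ler_expR -addrA lerD2l.
(* Completing the square: [k * |x| <= k ^+ 2 + x ^+ 2 / 4]. *)
have := sqr_ge0 (k - `|x| / 2); have := real_normK (num_real x).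
by move=> <-; lra.
Qed.

Lemma normal_prob_itv_gt0 (m s l u : R) : 0 < s -> l < u ->
  (0 < normal_prob m s `[l, u])%E.
Proof.
move=> s0 lu; have sn0 : s != 0 by rewrite gt_eqF.
have [] := @EVT_min R (normal_pdf m s) l u (ltW lu).
  by apply: continuous_subspaceT => x; exact: continuous_normal_pdf.
move=> c _ cmin.
have c0 : 0 < normal_pdf m s c.
  by rewrite normal_pdfE// mulr_gt0 ?normal_peak_gt0// expR_gt0.
rewrite /normal_prob.
apply: (@lt_le_trans _ _ (\int[mu]_(x in `[l, u]) (cst (normal_pdf m s c)%:E x))%E).
  rewrite integral_cst//= lebesgue_measure_itv/= lte_fin lu -EFinD -EFinM lte_fin.
  by rewrite mulr_gt0// subr_gt0.
apply: ge0_le_integral => //=.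
- by move=> x _; rewrite lee_fin ltW.
- apply/measurable_funTS/measurable_EFinP; exact: measurable_normal_pdf.
Qed.

(** The mass of [[l, u]] is positive and at most [1], which excludes the default branch of
    [mnormalize], where the law would be the untruncated one. *)
Lemma truncated_normal_setC (m s l u : R) : 0 < s -> l < u ->
  truncated_normal m s l u (~` `[l, u]) = 0%E.
Proof.
move=> s0 lu; rewrite /truncated_normal /mnormalize /= /mrestr setTI.
have P0 := normal_prob_itv_gt0 m s0 lu.
case: ifPn => [/orP[/eqP H|/eqP H]|_]; [exfalso|exfalso|].
- by move: P0; rewrite H ltxx.
- have : (normal_prob m s `[l, u] <= 1)%E by apply: probability_le1.
  by rewrite H leye_eq.
by rewrite setICl measure0 mul0e.
Qed.

End NormalIntegrals.

(** * Continuity of expectations by dominated convergence *)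

Section ExpectationContinuity.
Context {R : realType}.

Lemma expectation_continuous d (Om : measurableType d) (P : probability Om R)
    (f : R -> Om -> R) (G : Om -> R) :
  (forall t, measurable_fun setT (f t)) -> P.-integrable setT (EFin \o G) ->
  (forall t x, `|f t x| <= G x) -> (forall x, continuous (f ^~ x)) ->
  continuous (fun t => fine ('E_P[f t])%E).
Proof.
move=> mf iG fG cf t.
have intf r : P.-integrable setT (EFin \o f r).
  apply: (le_integrable measurableT _ _ iG) => [|x _].
    by apply/measurable_EFinP; exact: mf.
  by rewrite /= !lee_fin (le_trans (fG r x))// ler_norm.
rewrite unlock.
apply: (@continuity_under_integral R _ _ P f setT measurableT (t - 1) (t + 1)
  (fun x _ => intf x) _ G iG) => //.
- by apply: aeW => x _ y _; exact: cf.
- by move=> x _; apply: aeW => y _; exact: fG.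
by rewrite inE/= in_itv/=; apply/andP; split; lra.
Qed.

Variables (P : probability (measurableTypeR R) R) (l u : R).
Hypotheses (lu : l <= u) (Plu : P (~` `[l, u]) = 0%E).

Lemma measurable_comp_clamp (f : measurableTypeR R -> R) : measurable_fun setT f ->
  measurable_fun setT ((fun x => f (clamp l u x)) : measurableTypeR R -> R).
Proof.
move=> mf; apply: measurableT_comp => //.
by apply: continuous_measurable_fun; exact: clamp_continuous.
Qed.

Lemma expectation_clamp (f : measurableTypeR R -> R) : measurable_fun setT f ->
  ('E_P[f] = 'E_P[fun x => f (clamp l u x)])%E.
Proof.
move=> mf; rewrite unlock; apply: ae_eq_integral => //.
- exact/measurable_EFinP.
- by apply/measurable_EFinP; exact: measurable_comp_clamp.
exists (~` `[l, u]); split => //; first exact: measurableC.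
move=> x /= H; rewrite in_itv/= => xlu; apply: H => _.
by rewrite clampK.
Qed.

(** Bounds hold on the support only, while domination is asked at every point. Clamping the variable
    changes the integrand on a null set and makes the constant [C] a majorant everywhere. *)
Lemma concentrated_mean_continuous (f : R -> measurableTypeR R -> R) (C : R) :
  (forall t, measurable_fun setT (f t)) -> (forall x, continuous (f ^~ x)) ->
  (forall t x, l <= x <= u -> `|f t x| <= C) ->
  continuous (fun t => fine ('E_P[f t])%E).
Proof.
move=> mf cf fC.
have -> : (fun t => fine ('E_P[f t])%E) =
    (fun t => fine ('E_P[fun x => f t (clamp l u x)])%E).
  by apply/funext => t; congr fine; exact: expectation_clamp.
apply: (@expectation_continuous _ _ P (fun t x => f t (clamp l u x)) (cst C)).
- by move=> t; exact: measurable_comp_clamp.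
- exact: finite_measure_integrable_cst.
- by move=> t x; apply: fC; exact: clamp_itv.
- by move=> x; exact: cf.
Qed.

End ExpectationContinuity.

(** * Passing between [is_derive], [derive1] and sequences of quotients *)

Section Derive1.
Context {R : realType}.

Lemma derive1_is_derive (f : R -> R) (a d : R) : is_derive a 1 f d -> derive1 f a = d.
Proof. by move=> fd; rewrite derive1E derive_val. Qed.

Lemma derive1_mx m n (M : R -> 'M[R]_(m, n)) (a : R) (D : 'M[R]_(m, n)) :
  (forall i j, is_derive a 1 (fun x => M x i j) (D i j)) -> derive1 M a = D.
Proof.
move=> MD; rewrite /derive1; apply: cvg_lim => //.
apply/cvg_mx_coord => i j; have [dM MDij] := MD i j.
have : h^-1 *: (((fun x => M x i j) \o shift a) (h *: 1) - M a i j) @[h --> 0^']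
    --> D i j by rewrite -MDij; exact: dM.
by apply: cvg_trans; apply: near_eq_cvg; near=> h; rewrite !mxE /= [_%:A]mulr1.
Unshelve. all: by end_near. Qed.

Lemma is_derive_shift (f : R -> R) (a d : R) :
  is_derive (0 : R) 1 (fun h => f (a + h)) d -> is_derive a 1 f d.
Proof.
move=> fd; have h : is_derive a 1 (fun x => x - a) 1.
  by rewrite -[X in is_derive _ _ _ X]subr0; exact: dvB (is_derive_id _ _) (is_derive_cst _ _ _).
have fd' : is_derive (a - a) 1 (fun h => f (a + h)) d by rewrite subrr.
have := @is_derive1_comp _ (fun h => f (a + h)) (fun x => x - a) a d 1 fd' h.
by rewrite mulr1; congr (is_derive _ _ _ _); apply/funext => x /=; rewrite addrC subrK.
Qed.

(** A derivative in one parameter becomes a limit of a sequence of functions of [b], each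
    continuous, hence measurable; so measurability of the derivative in [b] follows without
    estimating second derivatives. *)
Lemma quotient_sequence (f : R -> R) (a d : R) : is_derive a 1 f d ->
  n.+1%:R * (f (a + n.+1%:R^-1) - f a) @[n --> \oo] --> d.
Proof.
move/dv_quotient => /cvgrPdist_le H; apply/cvgrPdist_le => e e0.
have := H e e0; rewrite near_withinE => /nbhs_ballP[d' /= d0 dP].
near=> n; have n0 : 0 < n.+1%:R^-1 :> R by rewrite invr_gt0 ltr0n.
have := dP (a + n.+1%:R^-1); rewrite /ball/= opprD addrA subrr sub0r normrN gtr0_norm//.
rewrite addrAC subrr add0r invrK; apply; last first.
  by rewrite -subr_eq0 addrAC subrr add0r gt_eqF.
by near: n; apply: (near_infty_natSinv_lt (PosNum d0)).
Unshelve. all: by end_near. Qed.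

End Derive1.

(** * Partial derivatives of the entries: continuity in time, bounds, measurability *)

Section ParameterDerivatives.
Context {R : realType}.
Variables (qA qB rA rB tau T : R).
Hypotheses (hqA : 0 < qA) (hqB : 0 < qB) (hrA : 0 < rA) (hrB : 0 < rB).
Hypotheses (T0 : 0 < T) (Ttau : T < tau).
Variables (thA thB : R -> R -> R -> 'M[R]_2).
Hypothesis game : forall a b, game_riccati_solution qA qB rA rB a b T `[0, tau]
  (fun t => thA t a b) (fun t => thB t a b).

Implicit Types (f : R -> R -> R -> R) (t a b e : R).

Local Notation entry := (@game_entry R T thA thB).
Local Notation dconst := (deriv_const qA qB).
Local Notation drate := (deriv_rate qA qB rA rB T).
Let derivative := game_entry_derivative hqA hqB hrA hrB T0 Ttau game.

Lemma weight_exists b : exists2 e : R, 1 <= e & e ^+ 2 = `|b| + 1.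
Proof.
have b1 : 1 <= `|b| + 1 by rewrite lerDr.
exists (Num.sqrt (`|b| + 1)); last by rewrite sqr_sqrtr// (le_trans ler01).
by rewrite -[leLHS](@sqrtr1 R) ler_wsqrtr.
Qed.

Lemma entry_derivative_a f a b : entry f -> exists2 D : R -> R, continuous D &
  forall t : R, 0 <= t <= T -> is_derive a 1 (fun x => f t x b) (D t) /\
    `|D t| <= dconst (`|a| + 1) * expR (drate (`|a| + 1) * (`|b| + 1)).
Proof.
move=> ef; have [e e1 e2] := weight_exists b.
have n1 : `|1 : R| <= 1 by rewrite normr1.
have n0 : `|0 : R| <= 1 by rewrite normr0.
have be : `|b| + 1 <= e ^+ 2 by rewrite e2.
have [D cD DP] := @derivative f a b 1 0 (`|a| + 1) e ef n1 n0 (lexx _) e1 be.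
exists D => // t tT; have [dD bD] := DP t tT; rewrite -e2; split=> //.
apply: (is_derive_shift (f := fun x => f t x b)).
by move: dD; congr (is_derive _ _ _ _); apply/funext => h; rewrite mulr1 mulr0 addr0.
Qed.

Lemma entry_derivative_b f a b a0 e : entry f -> `|a| + 1 <= a0 -> 1 <= e -> `|b| + 1 <= e ^+ 2 ->
  exists2 D : R -> R, continuous D &
  forall t : R, 0 <= t <= T -> is_derive b 1 (fun x => f t a x) (D t) /\
    `|D t| <= dconst a0 * expR (drate a0 * e ^+ 2).
Proof.
move=> ef aa0 e1 be.
have n1 : `|1 : R| <= 1 by rewrite normr1.
have n0 : `|0 : R| <= 1 by rewrite normr0.
have [D cD DP] := @derivative f a b 0 1 a0 e ef n0 n1 aa0 e1 be.
exists D => // t tT; have [dD bD] := DP t tT; split=> //.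
apply: (is_derive_shift (f := fun x => f t a x)).
by move: dD; congr (is_derive _ _ _ _); apply/funext => h; rewrite mulr1 mulr0 addr0.
Qed.

Definition partial_a f t b a := derive1 (fun x : R => f t x b : R) a.
Definition partial_b f t a b := derive1 (fun x : R => f t a x : R) b.

Lemma clamp0T t : 0 <= clamp 0 T t <= T.
Proof. by apply: clamp_itv; exact: ltW. Qed.

Lemma entry_continuous_b f t a : entry f -> 0 <= t <= T -> continuous (f t a).
Proof.
move=> ef tT b; have [e e1 e2] := weight_exists b.
have be : `|b| + 1 <= e ^+ 2 by rewrite e2.
have [D _ DP] := entry_derivative_b ef (lexx (`|a| + 1)) e1 be.
have [dD _] := DP t tT; exact: (dv_continuous dD).
Qed.

Lemma entry_measurable f t a : entry f -> 0 <= t <= T ->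
  measurable_fun [set: measurableTypeR R] (f t a : measurableTypeR R -> R).
Proof.
move=> ef tT; apply: continuous_measurable_fun; exact: entry_continuous_b.
Qed.

Lemma partial_a_continuous f a b : entry f -> continuous (fun t => partial_a f (clamp 0 T t) b a).
Proof.
move=> ef; have [D cD DP] := entry_derivative_a a b ef.
have -> : (fun t => partial_a f (clamp 0 T t) b a) = D \o clamp 0 T.
  apply/funext => t; apply: derive1_is_derive; exact: (proj1 (DP _ (clamp0T t))).
by move=> t; apply: continuous_comp; [exact: clamp_continuous | exact: cD].
Qed.

Lemma partial_a_bound f a b t : entry f -> 0 <= t <= T ->
  `|partial_a f t b a| <= dconst (`|a| + 1) * expR (drate (`|a| + 1) * (`|b| + 1)).
Proof.
move=> ef tT; have [D cD DP] := entry_derivative_a a b ef; have [dD bD] := DP t tT.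
by rewrite /partial_a (derive1_is_derive dD).
Qed.

Lemma partial_a_measurable f t a : entry f -> 0 <= t <= T ->
  measurable_fun [set: measurableTypeR R] ((fun b => partial_a f t b a) : measurableTypeR R -> R).
Proof.
move=> ef tT; apply: (@measurable_fun_cvg _ _ _ _
  (fun n b => n.+1%:R * (f t (a + n.+1%:R^-1) b - f t a b))).
  move=> n; apply: measurable_funM => //.
  by apply: measurable_funB; exact: entry_measurable.
move=> b _; have [D _ DP] := entry_derivative_a a b ef; have [dD _] := DP t tT.
by rewrite /partial_a (derive1_is_derive dD); exact: (quotient_sequence dD).
Qed.

Lemma partial_b_continuous f a b : entry f -> continuous (fun t => partial_b f (clamp 0 T t) a b).
Proof.
move=> ef; have [e e1 e2] := weight_exists b.
have be : `|b| + 1 <= e ^+ 2 by rewrite e2.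
have [D cD DP] := entry_derivative_b ef (lexx (`|a| + 1)) e1 be.
have -> : (fun t => partial_b f (clamp 0 T t) a b) = D \o clamp 0 T.
  apply/funext => t; apply: derive1_is_derive; exact: (proj1 (DP _ (clamp0T t))).
by move=> t; apply: continuous_comp; [exact: clamp_continuous | exact: cD].
Qed.

Lemma partial_b_bound f a b t e : entry f -> 0 <= t <= T -> 1 <= e -> `|b| + 1 <= e ^+ 2 ->
  `|partial_b f t a b| <= dconst (`|a| + 1) * expR (drate (`|a| + 1) * e ^+ 2).
Proof.
move=> ef tT e1 be; have [D cD DP] := entry_derivative_b ef (lexx (`|a| + 1)) e1 be.
by have [dD bD] := DP t tT; rewrite /partial_b (derive1_is_derive dD).
Qed.

Lemma entry_derivable_b f t a b : entry f -> 0 <= t <= T ->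
  is_derive b 1 (fun x => f t a x) (partial_b f t a b).
Proof.
move=> ef tT; have [e e1 e2] := weight_exists b.
have be : `|b| + 1 <= e ^+ 2 by rewrite e2.
have [D _ DP] := entry_derivative_b ef (lexx (`|a| + 1)) e1 be.
by have [dD _] := DP t tT; rewrite /partial_b (derive1_is_derive dD).
Qed.

Lemma entry_derivable_a f t a b : entry f -> 0 <= t <= T ->
  is_derive a 1 (fun x => f t x b) (partial_a f t b a).
Proof.
move=> ef tT; have [D cD DP] := entry_derivative_a a b ef; have [dD _] := DP t tT.
by rewrite /partial_a (derive1_is_derive dD).
Qed.

Lemma partial_b_measurable f t a : entry f -> 0 <= t <= T ->
  measurable_fun [set: measurableTypeR R] (partial_b f t a : measurableTypeR R -> R).
Proof.
move=> ef tT; apply: (@measurable_fun_cvg _ _ _ _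
  (fun n b => n.+1%:R * (f t a (b + n.+1%:R^-1) - f t a b))).
  move=> n; apply: measurable_funM => //; apply: measurable_funB; last exact: entry_measurable.
  apply: continuous_measurable_fun => b.
  apply: (@continuous_comp _ _ _ (fun b => b + n.+1%:R^-1) (f t a)).
    by apply: cvgD; [exact: cvg_id | exact: cvg_cst].
  exact: entry_continuous_b.
by move=> b _; exact: quotient_sequence (entry_derivable_b a b ef tT).
Qed.
End ParameterDerivatives.

(** * Continuity in time of the averaged coefficients *)

Section GameAverages.
Context {R : realType}.
Variables (qA qB rA rB tau T : R).
Hypotheses (hqA : 0 < qA) (hqB : 0 < qB) (hrA : 0 < rA) (hrB : 0 < rB).
Hypotheses (T0 : 0 < T) (Ttau : T < tau).
Variables (thA thB : R -> R -> R -> 'M[R]_2).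
Hypothesis game : forall a b, game_riccati_solution qA qB rA rB a b T `[0, tau]
  (fun t => thA t a b) (fun t => thB t a b).
Variables (muB rhoB mBl mBu mA : R).
Hypotheses (hrhoB : 0 < rhoB) (hmB : mBl < mBu).

Implicit Types (f : R -> R -> R -> R) (t a b e : R).

Local Notation entry := (@game_entry R T thA thB).

Let truncated_mean_continuous (f : R -> measurableTypeR R -> R) (C : R) :=
  @concentrated_mean_continuous R
   (mnormalize (mrestr (normal_prob muB rhoB) (@measurable_itv R `[mBl, mBu]))
     (normal_prob muB rhoB)) mBl mBu (ltW hmB) (truncated_normal_setC muB hrhoB hmB) f C.

(** A single weight that serves every [b] in [[mBl, mBu]]. *)
Let eW := Num.sqrt (Num.max `|mBl| `|mBu| + 1).

Lemma eW_ge1 : 1 <= eW.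
Proof.
rewrite -[leLHS](@sqrtr1 R) ler_wsqrtr// lerDr.
by rewrite le_max normr_ge0.
Qed.

Lemma eW_sqr b : mBl <= b <= mBu -> `|b| + 1 <= eW ^+ 2.
Proof.
move=> /andP[lb bu]; rewrite sqr_sqrtr; last by rewrite addr_ge0// le_max normr_ge0.
rewrite lerD2r le_max; have [b0|b0] := leP 0 b.
  by rewrite (ger0_norm b0) (le_trans bu (ler_norm _)) orbT.
by rewrite (ltr0_norm b0) -(normrN mBl) (le_trans _ (ler_norm _))// lerN2.
Qed.

Lemma entry_mean_continuous f : entry f ->
  continuous (fun t => fine ('E_(truncated_normal muB rhoB mBl mBu)
    [f (clamp 0 T t) mA : measurableTypeR R -> R])%E).
Proof.
move=> ef; apply: (truncated_mean_continuous
  (f := fun t => f (clamp 0 T t) mA) (C := eW ^+ 4 * game_bound qA qB rA^-1 rB^-1 `|mA| T)).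
- by move=> t; apply: (entry_measurable hqA hqB hrA hrB T0 Ttau game) => //; exact: clamp0T.
- by move=> x; exact: (game_entry_continuous hrA hrB T0 Ttau game).
move=> t x xlu; apply: (game_entry_bound hqA hqB hrA hrB T0 Ttau game ef) => //.
- exact: eW_ge1.
- exact: clamp0T.
by apply: le_trans (eW_sqr xlu); rewrite lerDl.
Qed.

Lemma partial_b_mean_continuous f : entry f ->
  continuous (fun t => fine ('E_(truncated_normal muB rhoB mBl mBu)
    [partial_b f (clamp 0 T t) mA : measurableTypeR R -> R])%E).
Proof.
move=> ef; apply: (truncated_mean_continuous (f := fun t => partial_b f (clamp 0 T t) mA)
  (C := deriv_const qA qB (`|mA| + 1) *
        expR (deriv_rate qA qB rA rB T (`|mA| + 1) * eW ^+ 2))).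
- by move=> t; apply: (partial_b_measurable hqA hqB hrA hrB T0 Ttau game) => //; exact: clamp0T.
- by move=> x; exact: (partial_b_continuous hqA hqB hrA hrB T0 Ttau game).
move=> t x xlu; apply: (partial_b_bound hqA hqB hrA hrB T0 Ttau game mA ef) => //.
- exact: clamp0T.
- exact: eW_ge1.
- exact: eW_sqr.
Qed.

(** The factor [p] is [1] for [S_mu] and the identity for [S_rho]; its exponential bound joins that
    of the derivative in one majorant [expR (c + k * |x|)]. *)
Lemma partial_a_mean_continuous f (p : R -> R) : entry f ->
  measurable_fun [set: measurableTypeR R] (p : measurableTypeR R -> R) ->
  (forall x, `|p x| <= expR `|x|) ->
  continuous (fun t => fine ('E_(normal_prob (0 : R) 1)
    [fun x : measurableTypeR R =>
       (p x * partial_a f (clamp 0 T t) (muB + rhoB * x) mA)%R])%E).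
Proof.
move=> ef mp pe.
pose k := deriv_rate qA qB rA rB T (`|mA| + 1).
have C0 : 0 <= deriv_const qA qB (`|mA| + 1).
  by rewrite /deriv_const !mulr_ge0// !addr_ge0// ltW.
have k0 : 0 <= k.
  have iA0 : 0 < rA^-1 by rewrite invr_gt0.
  have iB0 : 0 < rB^-1 by rewrite invr_gt0.
  have M0 : 0 <= game_bound qA qB rA^-1 rB^-1 (`|mA| + 1) T.
    apply: (le_trans (normr_ge0 _)).
    apply: (game_state_bound hqA hqB hrA hrB T0 Ttau (game 0 0) (e := 1) _ _ _ i0 (t := 0)) => //.
    - by rewrite normr0 addr_ge0.
    - by rewrite normr0 expr1n.
    - by rewrite lexx ltW.
  rewrite /k /deriv_rate; apply: addr_ge0 => //; apply: mulr_ge0; last exact: ltW.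
  apply: mulr_ge0 => //; apply: addr_ge0 => //; apply: mulr_ge0 => //.
  by apply: mulr_ge0 => //; apply: addr_ge0; exact: ltW.
apply: (@expectation_continuous R _ _ (normal_prob (0 : R) 1)
  (fun t (x : measurableTypeR R) => p x * partial_a f (clamp 0 T t) (muB + rhoB * x) mA)
  (fun x : measurableTypeR R => deriv_const qA qB (`|mA| + 1) *
     expR (k * (`|muB| + 1) + (k * rhoB + 1) * `|x|))).
- move=> t; apply: measurable_funM => //.
  apply: (measurableT_comp (f := fun b : measurableTypeR R => partial_a f (clamp 0 T t) b mA)).
    by apply: (partial_a_measurable hqA hqB hrA hrB T0 Ttau game) => //; exact: clamp0T.
  by apply: measurable_funD => //; exact: measurable_funM.
- exact: (integrableZl measurableT (deriv_const qA qB (`|mA| + 1))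
    (normal_integrable_expR (k * (`|muB| + 1)) (k * rhoB + 1))).
- move=> t x; rewrite normrM.
  have h := partial_a_bound hqA hqB hrA hrB T0 Ttau game mA (muB + rhoB * x) ef (clamp0T T0 t).
  apply: (le_trans (ler_pM _ _ (pe x) h)) => //.
  rewrite mulrCA ler_wpM2l// -expRD ler_expR -/k.
  have : `|muB + rhoB * x| <= `|muB| + rhoB * `|x|.
    by rewrite (le_trans (ler_normD _ _))// normrM (gtr0_norm hrhoB).
  by move=> H; have := ler_wpM2l k0 H; lra.
move=> x t; apply: cvgM; first exact: cvg_cst.
exact: (partial_a_continuous hqA hqB hrA hrB T0 Ttau game).
Qed.

Lemma theta_bar_continuous (th : R -> R -> R -> 'M[R]_2) i j :
  entry (fun t a b => th t a b i j) ->
  continuous (fun t => theta_bar muB rhoB mBl mBu mA th (clamp 0 T t) i j).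
Proof.
move=> ef; apply: continuous_ext (entry_mean_continuous ef) => t.
by rewrite [RHS]mxE.
Qed.

Lemma gvec_continuous z j :
  continuous (fun t => gvec rB muB rhoB mBl mBu mA thB (clamp 0 T t) z j 0).
Proof.
have ef i k : entry (fun t a b => thB t a b i k) by exact: (game_entryB Ttau game).
have dAE t b : derive1 (fun a => thB (clamp 0 T t) a b) mA =
    \matrix_(i, k) partial_a (fun t a b => thB t a b i k) (clamp 0 T t) b mA.
  apply: derive1_mx => i k; rewrite mxE.
  by apply: (entry_derivable_a hqA hqB hrA hrB T0 Ttau game) => //; exact: clamp0T.
have dBE t b : derive1 (fun b' => thB (clamp 0 T t) mA b') b =
    \matrix_(i, k) partial_b (fun t a b => thB t a b i k) (clamp 0 T t) mA b.
  apply: derive1_mx => i k; rewrite mxE.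
  by apply: (entry_derivable_b hqA hqB hrA hrB T0 Ttau game) => //; exact: clamp0T.
have cmu : continuous (fun t => S_mu muB rhoB mA thB (clamp 0 T t) j 1).
  have h0 : measurable_fun [set: measurableTypeR R] ((fun=> 1) : measurableTypeR R -> R) by [].
  have h1 (x : R) : `|1 : R| <= expR `|x| by rewrite normr1 -expR0 ler_expR.
  apply: continuous_ext (partial_a_mean_continuous (ef j 1) h0 h1) => t.
  rewrite [RHS]mxE; congr (fine (expectation _ _)); apply/funext => x.
  by rewrite dAE [RHS]mxE mul1r.
have crho : continuous (fun t => S_rho muB rhoB mA thB (clamp 0 T t) j 1).
  have h0 : measurable_fun [set: measurableTypeR R] (id : measurableTypeR R -> R) by [].
  have h1 (x : R) : `|x| <= expR `|x| by have := expR_ge1Dx `|x|; lra.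
  apply: continuous_ext (partial_a_mean_continuous (ef j 1) h0 h1) => t.
  rewrite [RHS]mxE; congr (fine (expectation _ _)); apply/funext => x.
  by rewrite dAE [RHS]mxE [X in _ = _ * X]mxE.
have cm : continuous (fun t => S_m muB rhoB mBl mBu mA thB (clamp 0 T t) j 1).
  apply: continuous_ext (partial_b_mean_continuous (ef j 1)) => t.
  rewrite [RHS]mxE; congr (fine (expectation _ _)); apply/funext => x.
  by rewrite dBE [RHS]mxE.
have cZ c (h : R -> R) : continuous h -> continuous (fun t => c * h t).
  by move=> ch t; apply: cvgM; [exact: cvg_cst | exact: ch].
have cD (h1 h2 : R -> R) : continuous h1 -> continuous h2 -> continuous (fun t => h1 t + h2 t).
  by move=> ch1 ch2 t; apply: cvgD; [exact: ch1 | exact: ch2].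
apply: continuous_ext
  (cZ rB^-1 _ (cD _ _ (cD _ _ (cZ (z 0 0) _ cmu) (cZ (z 1 0) _ crho)) cm)) => t.
by rewrite [RHS]mxE.
Qed.

End GameAverages.

(** * The Frobenius norm *)

Section Frobenius.
Context {R : realType}.

(** Lagrange's identity: the squares of [a i * b j - a j * b i] add up to twice the difference of
    the two sides. *)
Lemma sum_cauchy_schwarz (I : finType) (a b : I -> R) :
  (\sum_i a i * b i) ^+ 2 <= (\sum_i a i ^+ 2) * (\sum_i b i ^+ 2).
Proof.
have : 0 <= \sum_i \sum_j (a i * b j - a j * b i) ^+ 2.
  by apply: sumr_ge0 => i _; apply: sumr_ge0 => j _; exact: sqr_ge0.
have E : \sum_i \sum_j (a i * b j - a j * b i) ^+ 2 =
   \sum_i \sum_j (a i ^+ 2 * b j ^+ 2 + b i ^+ 2 * a j ^+ 2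
     - 2 * ((a i * b i) * (a j * b j))).
  by apply: eq_bigr => i _; apply: eq_bigr => j _; ring.
rewrite E; under eq_bigr do rewrite !big_split/= sumrN.
rewrite !big_split/= sumrN -!big_distrlr/=.
under [X in _ - X]eq_bigr do rewrite -mulr_sumr.
rewrite -mulr_sumr -big_distrlr/= -expr2; lra.
Qed.

Lemma frob_sqr m n (M : 'M[R]_(m, n)) : frob M ^+ 2 = \sum_i \sum_j M i j ^+ 2.
Proof.
rewrite sqr_sqrtr//; apply: sumr_ge0 => i _; apply: sumr_ge0 => j _.
exact: sqr_ge0.
Qed.

Lemma frob_ge0 m n (M : 'M[R]_(m, n)) : 0 <= frob M.
Proof. exact: sqrtr_ge0. Qed.

Lemma ler_sqr_nneg (x y : R) : 0 <= y -> x ^+ 2 <= y ^+ 2 -> x <= y.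
Proof.
move=> y0; have [x0 _|x0] := ltP x 0; first exact: le_trans (ltW x0) y0.
by rewrite ler_pXn2r ?nnegrE.
Qed.

Lemma frob_entry m n (M : 'M[R]_(m, n)) i j : `|M i j| <= frob M.
Proof.
apply: ler_sqr_nneg; first exact: frob_ge0.
rewrite frob_sqr real_normK ?num_real// (bigD1 i)//= (bigD1 j)//= -addrA lerDl.
apply: addr_ge0; first by apply: sumr_ge0 => k _; exact: sqr_ge0.
by apply: sumr_ge0 => k _; apply: sumr_ge0 => l _; exact: sqr_ge0.
Qed.

Lemma frob_inner m n (M N : 'M[R]_(m, n)) :
  \sum_i \sum_j M i j * N i j <= frob M * frob N.
Proof.
apply: ler_sqr_nneg; first by rewrite mulr_ge0 ?frob_ge0.
rewrite exprMn !frob_sqr !pair_big/=.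
exact: sum_cauchy_schwarz.
Qed.

Lemma frobD m n (M N : 'M[R]_(m, n)) : frob (M + N) <= frob M + frob N.
Proof.
apply: ler_sqr_nneg; first by rewrite addr_ge0 ?frob_ge0.
have E : frob (M + N) ^+ 2 =
    frob M ^+ 2 + frob N ^+ 2 + 2 * \sum_i \sum_j M i j * N i j.
  rewrite !frob_sqr mulr_sumr -!big_split/=; apply: eq_bigr => i _.
  rewrite mulr_sumr -!big_split/=; apply: eq_bigr => j _; rewrite mxE; ring.
by rewrite E; have := frob_inner M N; lra.
Qed.

Lemma frobZ m n c (M : 'M[R]_(m, n)) : frob (c *: M) = `|c| * frob M.
Proof.
apply/eqP; rewrite -(eqrXn2 (ltn0Sn 1)) ?mulr_ge0 ?frob_ge0//.
rewrite exprMn !frob_sqr real_normK ?num_real// mulr_sumr; apply/eqP.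
apply: eq_bigr => i _; rewrite mulr_sumr; apply: eq_bigr => j _.
by rewrite mxE exprMn.
Qed.

Lemma frobN m n (M : 'M[R]_(m, n)) : frob (- M) = frob M.
Proof. by rewrite -scaleN1r frobZ normrN1 mul1r. Qed.

Lemma frob_tr m n (M : 'M[R]_(m, n)) : frob M^T = frob M.
Proof.
congr Num.sqrt; rewrite exchange_big/=.
by apply: eq_bigr => i _; apply: eq_bigr => j _; rewrite mxE.
Qed.

Lemma frobM m n p (M : 'M[R]_(m, n)) (N : 'M[R]_(n, p)) :
  frob (M *m N) <= frob M * frob N.
Proof.
apply: ler_sqr_nneg; first by rewrite mulr_ge0 ?frob_ge0.
rewrite exprMn !frob_sqr [X in _ <= _ * X]exchange_big/= big_distrlr/=.
apply: ler_sum => i _; apply: ler_sum => j _; rewrite mxE.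
exact: sum_cauchy_schwarz.
Qed.

Lemma frob_RA rA : 0 < rA -> frob (RA rA) = rA^-1 :> R.
Proof.
move=> rA0; rewrite /frob !big_ord_recl !big_ord0 !mxE /=.
by rewrite expr0n/= !addr0 sqrtr_sqr gtr0_norm// invr_gt0.
Qed.

Lemma frob_RB rB : 0 < rB -> frob (RB rB) = rB^-1 :> R.
Proof.
move=> rB0; rewrite /frob !big_ord_recl !big_ord0 !mxE /=.
by rewrite expr0n/= !add0r !addr0 sqrtr_sqr gtr0_norm// invr_gt0.
Qed.

End Frobenius.

(** * Lipschitz and growth estimates for the right-hand side of the last equation *)

Section AFRiccati.
Context {R : realType}.
Variables (qAF rAF lAF rA rB sB T : R).
Hypotheses (hT : 0 < T) (hrA : 0 < rA) (hrB : 0 < rB) (hsB : 0 < sB)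
  (hqAF : 0 < qAF) (hrAF : 0 < rAF) (hlAF : 0 < lAF).

Local Notation rhs := (AF_riccati_rhs qAF rAF lAF rA rB sB).

Lemma ord2P (P : 'I_2 -> Prop) : P 0 -> P 1 -> forall i, P i.
Proof.
move=> P0 P1; case=> [[|[|//]] ?]; first by congr P : P0; apply: val_inj.
by congr P : P1; apply: val_inj.
Qed.

Lemma AF_rhsE (tA tB : 'M[R]_2) (g : 'cV[R]_2) (M : 'M[R]_2) i j :
  rhs tA tB g M i j = (qAF + rAF)^-1 * (M i 0 * rA^-1 * M 0 j)
  + (qAF / ((qAF + rAF) * rA)) * (M i 0 * rA^-1 * tA 0 j + tA i 0 * rA^-1 * M 0 j)
  + M i 1 * rB^-1 * tB 1 j + tB i 1 * rB^-1 * M 1 j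
  - (qAF * rAF / ((qAF + rAF) * rA ^+ 2)) * (tA i 0 * rA^-1 * tA 0 j)
  - (lAF / sB ^+ 2) * (g i 0 * g j 0).
Proof.
have mxD (A B : 'M[R]_2) k l : (A + B) k l = A k l + B k l by rewrite mxE.
have mxN (A : 'M[R]_2) k l : (- A) k l = - A k l by rewrite mxE.
have mxZ x (A : 'M[R]_2) k l : (x *: A) k l = x * A k l by rewrite mxE.
have gg k l : (g *m g^T) k l = g k 0 * g l 0.
  by rewrite mxE big_ord_recl big_ord0 addr0 mxE.
by rewrite /AF_riccati_rhs !(mxD, mxN, mxZ) !mulmx_RA !mulmx_RB gg.
Qed.

Lemma AF_rhs_sym (tA tB : 'M[R]_2) (g : 'cV[R]_2) (M : 'M[R]_2) :
  tA 1 0 = tA 0 1 -> tB 1 0 = tB 0 1 -> M 1 0 = M 0 1 ->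
  rhs tA tB g M 1 0 = rhs tA tB g M 0 1.
Proof. by move=> hA hB hM; rewrite !AF_rhsE hA hB hM; ring. Qed.

Definition AF_lip (c K : R) : R := (qAF + rAF)^-1 * (rA^-1 * (2 * K))
  + qAF / ((qAF + rAF) * rA) * (rA^-1 * (2 * c)) + 2 * rB^-1 * c.

Lemma AF_lip_ge0 c K : 0 <= c -> 0 <= K -> 0 <= AF_lip c K.
Proof.
move=> c0 K0; have s0 : 0 < qAF + rAF by rewrite addr_gt0.
have h1 : 0 <= (qAF + rAF)^-1 by rewrite invr_ge0 ltW.
have h2 : 0 <= rA^-1 by rewrite invr_ge0 ltW.
have h3 : 0 <= rB^-1 by rewrite invr_ge0 ltW.
have h4 : 0 <= qAF / ((qAF + rAF) * rA).
  by apply: divr_ge0; [exact: ltW | apply: mulr_ge0; exact: ltW].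
rewrite /AF_lip; apply: addr_ge0; [apply: addr_ge0|]; apply: mulr_ge0 => //;
  by do ?apply: mulr_ge0.
Qed.

Lemma AF_rhs_lip (tA tB : 'M[R]_2) (g : 'cV[R]_2) (M N : 'M[R]_2) c K d :
  (forall i j, `|tA i j| <= c) -> (forall i j, `|tB i j| <= c) ->
  (forall i j, `|M i j| <= K) -> (forall i j, `|N i j| <= K) ->
  (forall i j, `|M i j - N i j| <= d) ->
  forall i j, `|rhs tA tB g M i j - rhs tA tB g N i j| <= AF_lip c K * d.
Proof.
move=> hA hB hM hN hd i j; rewrite !AF_rhsE.
have s0 : 0 < qAF + rAF by rewrite addr_gt0.
have h1 : 0 <= (qAF + rAF)^-1 by rewrite invr_ge0 ltW.
have h2 : 0 <= rA^-1 by rewrite invr_ge0 ltW.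
have h3 : 0 <= rB^-1 by rewrite invr_ge0 ltW.
set k1 := qAF / _.
have h4 : 0 <= k1.
  by apply: divr_ge0; [exact: ltW | apply: mulr_ge0; exact: ltW].
pose e i j := M i j - N i j.
rewrite (_ : _ - _ = (qAF + rAF)^-1 * (rA^-1 * (e i 0 * M 0 j + N i 0 * e 0 j))
  + k1 * (rA^-1 * (e i 0 * tA 0 j + tA i 0 * e 0 j))
  + rB^-1 * (e i 1 * tB 1 j + tB i 1 * e 1 j)); last by rewrite /e; ring.
have P (a b x y : R) : `|a| <= x -> `|b| <= y -> `|a * b| <= x * y.
  by move=> ? ?; rewrite normrM ler_pM.
have S (a b x : R) : `|a| <= x -> `|b| <= x -> `|a + b| <= 2 * x.
  by move=> ? ?; rewrite (le_trans (ler_normD _ _))//; lra.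
have Z (k a x : R) : 0 <= k -> `|a| <= x -> `|k * a| <= k * x.
  by move=> k0 ?; rewrite normrM ger0_norm// ler_wpM2l.
have c1 : `|e i 0 * M 0 j + N i 0 * e 0 j| <= 2 * (K * d).
  by apply: S; [rewrite mulrC; exact: P (hM _ _) (hd _ _) | exact: P (hN _ _) (hd _ _)].
have c2 : `|e i 0 * tA 0 j + tA i 0 * e 0 j| <= 2 * (c * d).
  by apply: S; [rewrite mulrC; exact: P (hA _ _) (hd _ _) | exact: P (hA _ _) (hd _ _)].
have c3 : `|e i 1 * tB 1 j + tB i 1 * e 1 j| <= 2 * (c * d).
  by apply: S; [rewrite mulrC; exact: P (hB _ _) (hd _ _) | exact: P (hB _ _) (hd _ _)].
apply: (le_trans (ler_normD _ _)); apply: (le_trans (lerD (ler_normD _ _) (lexx _))).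
apply: (le_trans (lerD (lerD (Z _ _ _ h1 (Z _ _ _ h2 c1)) (Z _ _ _ h4 (Z _ _ _ h2 c2)))
  (Z _ _ _ h3 c3))).
by rewrite /AF_lip -/k1 le_eqVlt; apply/orP; left; apply/eqP; ring.
Qed.

(** [RA] and [RB] have norms [rA^-1] and [rB^-1], so each [RA] adds a power of [rA] to the
    denominator of the coefficient before it; this is how [d1], [d2] and [d3] arise. *)
Lemma AF_rhs_frob (tA tB : 'M[R]_2) (g : 'cV[R]_2) (M : 'M[R]_2) c cg :
  frob tA <= c -> frob tB <= c -> frob g <= cg ->
  frob (rhs tA tB g M) <= ((qAF + rAF) * rA)^-1 * frob M ^+ 2
    + (2 * qAF * c / ((qAF + rAF) * rA ^+ 2) + 2 * c / rB) * frob M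
    + (qAF * rAF * c ^+ 2 / ((qAF + rAF) * rA ^+ 3) + lAF * cg ^+ 2 / sB ^+ 2).
Proof.
move=> hA hB hg.
have s0 : 0 < qAF + rAF by rewrite addr_gt0.
have h1 : 0 <= (qAF + rAF)^-1 by rewrite invr_ge0 ltW.
have h2 : 0 <= rA^-1 by rewrite invr_ge0 ltW.
have h3 : 0 <= rB^-1 by rewrite invr_ge0 ltW.
have h4 : 0 <= qAF / ((qAF + rAF) * rA).
  by apply: divr_ge0; [exact: ltW | apply: mulr_ge0; exact: ltW].
have h5 : 0 <= qAF * rAF / ((qAF + rAF) * rA ^+ 2).
  by apply: divr_ge0; apply: mulr_ge0; rewrite ?exprn_ge0 ?ltW.
have h6 : 0 <= lAF / sB ^+ 2 by apply: divr_ge0; rewrite ?exprn_ge0 ?ltW.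
have M3A (X Y : 'M[R]_2) x y : frob X <= x -> frob Y <= y ->
    frob (X *m RA rA *m Y) <= x * rA^-1 * y.
  move=> Xx Yy; apply: (le_trans (frobM _ _)).
  apply: ler_pM; rewrite ?frob_ge0//; apply: (le_trans (frobM _ _)).
  by rewrite frob_RA// ler_wpM2r.
have M3B (X Y : 'M[R]_2) x y : frob X <= x -> frob Y <= y ->
    frob (X *m RB rB *m Y) <= x * rB^-1 * y.
  move=> Xx Yy; apply: (le_trans (frobM _ _)).
  apply: ler_pM; rewrite ?frob_ge0//; apply: (le_trans (frobM _ _)).
  by rewrite frob_RB// ler_wpM2r.
have D (X Y : 'M[R]_2) x y : frob X <= x -> frob Y <= y -> frob (X + Y) <= x + y.
  by move=> ? ?; apply: (le_trans (frobD _ _)); exact: lerD.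
have Z k (X : 'M[R]_2) x : 0 <= k -> frob X <= x -> frob (k *: X) <= k * x.
  by move=> k0 ?; rewrite frobZ ger0_norm// ler_wpM2l.
have B (X Y : 'M[R]_2) x y : frob X <= x -> frob Y <= y -> frob (X - Y) <= x + y.
  by move=> ? ?; apply: D => //; rewrite frobN.
have gg : frob (g *m g^T) <= cg * cg.
  by apply: (le_trans (frobM _ _)); rewrite frob_tr ler_pM ?frob_ge0.
have MM := lexx (frob M).
apply: (le_trans (B _ _ _ _ (B _ _ _ _ (D _ _ _ _ (D _ _ _ _ (D _ _ _ _
  (Z _ _ _ h1 (M3A _ _ _ _ MM MM)) (Z _ _ _ h4 (D _ _ _ _ (M3A _ _ _ _ MM hA) (M3A _ _ _ _ hA MM))))
  (M3B _ _ _ _ MM hB)) (M3B _ _ _ _ hB MM)) (Z _ _ _ h5 (M3A _ _ _ _ hA hA)))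
  (Z _ _ _ h6 gg))).
rewrite le_eqVlt; apply/orP; left; apply/eqP; field.
by rewrite !gt_eqF.
Qed.

End AFRiccati.

(** * Comparison with a tangent *)

Section TangentBound.
Context {R : realType}.

(* With [rho ^ 2 = m / n], [N' <= m N ^ 2 + n] reads [(atan (rho N))' <= sqrt (m n)];
   [E] is shifted by [eps ^ 2] because its square root is not differentiable at [0]. *)
Lemma tan_bound (T m n : R) : 0 < m -> 0 < n -> T < pi / (2 * Num.sqrt (m * n)) ->
  exists2 K : R, 0 <= K & forall E dE : R -> R, continuous E -> (forall s, 0 <= E s) ->
    E 0 = 0 -> (forall s, 0 < s < T -> is_derive s 1 E (dE s)) ->
    (forall s, 0 < s < T -> dE s <= 2 * Num.sqrt (E s) * (m * E s + n)) ->
    forall s, 0 <= s <= T -> E s <= K ^+ 2.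
Proof.
move=> m0 n0; set w := Num.sqrt (m * n).
have mn0 : 0 < m * n by rewrite mulr_gt0.
have w0 : 0 < w by rewrite sqrtr_gt0.
have w2 : w ^+ 2 = m * n by rewrite sqr_sqrtr// ltW.
rewrite ltr_pdivlMr ?mulr_gt0// => wT.
have [T0|T0] := ltP T 0.
  by exists 0 => // E dE _ _ _ _ _ s /andP[s0 sT]; lra.
(* Half of the slack [pi / 2 - w * T] goes to the initial angle [dl]; the angle then gains at most
   [w * T] and does not exceed [be < pi / 2]. *)
pose dl := (pi / 2 - w * T) / 2; pose be := dl + w * T.
have dl0 : 0 < dl by rewrite /dl; lra.
have wT0 : 0 <= w * T by rewrite mulr_ge0// ltW.
have pi0 := pi_gt0 R.
have tan_pos (x : R) : 0 < x -> x < pi / 2 -> atan (tan x) = x /\ 0 < tan x.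
  move=> x0 xpi; have xK : atan (tan x) = x.
    by apply: tanK; rewrite in_itv/=; apply/andP; split; lra.
  split=> //; rewrite ltNge; apply/negP => /le_atan; rewrite xK atan0.
  by rewrite leNgt x0.
have [dlK tdl0] : atan (tan dl) = dl /\ 0 < tan dl.
  by apply: tan_pos => //; rewrite /dl; lra.
have [beK tbe0] : atan (tan be) = be /\ 0 < tan be.
  by apply: tan_pos; rewrite /be /dl; lra.
pose rho := w / n; have rho0 : 0 < rho by rewrite divr_gt0.
have rho2 : rho ^+ 2 * n = m by rewrite /rho exprMn w2; field; rewrite gt_eqF.
have rhon : rho * n = w by rewrite /rho divfK// gt_eqF.
pose eps := tan dl / rho; have eps0 : 0 < eps by rewrite divr_gt0.
(* [K] is fixed before [E] is given, because the clipped equation that will produce [E] is itself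
   defined with [K]. *)
exists (tan be / rho); first by rewrite ltW// divr_gt0.
move=> E dE cE E0 E00 dvE dEle s sT.
pose N r := Num.sqrt (E r + eps ^+ 2).
have Ee0 r : 0 < E r + eps ^+ 2 by rewrite ltr_wpDl// exprn_gt0.
have N0 r : 0 < N r by rewrite sqrtr_gt0.
have N2 r : N r ^+ 2 = E r + eps ^+ 2 by rewrite sqr_sqrtr// ltW.
have cN : continuous (fun r => atan (rho * N r)).
  move=> r; apply: (@continuous_comp _ _ _ (fun r => rho * N r) atan); last exact: continuous_atan.
  apply: cvgM; first exact: cvg_cst.
  apply: (@continuous_comp _ _ _ (fun r => E r + eps ^+ 2) Num.sqrt); last exact: sqrt_continuous.
  by apply: cvgD; [exact: cE | exact: cvg_cst].
have dvN r : 0 < r < T -> is_derive r 1 (fun r => atan (rho * N r))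
    ((1 + (rho * N r) ^+ 2)^-1 * (rho * ((2 * N r)^-1 * (dE r + 0)))).
  move=> rT; have d1 := dvD (dvE r rT) (is_derive_cst (eps ^+ 2) r 1).
  have d2 := @is_derive1_comp _ Num.sqrt (fun r => E r + eps ^+ 2) r _ _
    (is_derive1_sqrt (Ee0 r)) d1.
  exact: (@is_derive1_comp _ atan (fun r => rho * N r) r _ _ (is_derive1_atan _) (dvZ rho d2)).
have : atan (rho * N s) - w * s <= atan (rho * N 0) - w * 0.
  case/andP: sT => s0 sT.
  have cg : continuous (fun r => atan (rho * N r) - w * r).
    by move=> r; apply: cvgB; [exact: cN | apply: cvgM; [exact: cvg_cst | exact: cvg_id]].
  apply: (dv_le0_le cg (fun r rT => dvB (dvN r rT) (dvZ w (is_derive_id r 1))) _ (lexx 0) s0 sT).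
  move=> r rT; rewrite addr0 mulr1 subr_le0.
  have q0 : 0 < 1 + (rho * N r) ^+ 2 by rewrite ltr_pwDl// sqr_ge0.
  (* The left side is the derivative of [N]. Since [Num.sqrt (E r) <= N r], it is at most
     [m * E r + n], hence at most the right side by the choice of [rho]; the angle therefore moves
     with speed at most [rho * n = w]. *)
  suff H : (2 * N r)^-1 * dE r <= n * (1 + (rho * N r) ^+ 2).
    rewrite mulrC ler_pdivrMr// [leRHS](_ : _ = rho * (n * (1 + (rho * N r) ^+ 2))).
      by apply: ler_wpM2l => //; exact: ltW.
    by rewrite mulrA rhon.
  rewrite mulrC ler_pdivrMr ?mulr_gt0//.
  apply: (le_trans (dEle r rT)).
  have sE : Num.sqrt (E r) <= N r by rewrite ler_wsqrtr// lerDl sqr_ge0.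
  have mE : m * E r + n <= n * (1 + (rho * N r) ^+ 2).
    rewrite exprMn mulrDr mulr1 mulrCA mulrA rho2 addrC lerD2l ler_pM2l// N2.
    by rewrite lerDl sqr_ge0.
  rewrite [leRHS]mulrC; apply: ler_pM (mE).
  - by apply: mulr_ge0 => //; exact: sqrtr_ge0.
  - by apply: addr_ge0; [apply: mulr_ge0 => //; exact: ltW | exact: ltW].
  - by rewrite ler_pM2l.
have -> : N 0 = eps by rewrite /N E00 add0r sqrtr_sqr gtr0_norm.
have -> : rho * eps = tan dl by rewrite /eps mulrC divfK// gt_eqF.
rewrite dlK mulr0 subr0 => H.
have : rho * N s <= tan be.
  rewrite leNgt; apply/negP => /lt_atan; rewrite beK /be => H2.
  have : w * s <= w * T by rewrite ler_pM2l//; case/andP: sT.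
  by move: H H2; lra.
rewrite mulrC -ler_pdivlMr// => NK.
apply: (@le_trans _ _ (N s ^+ 2)); first by rewrite N2 lerDl sqr_ge0.
by rewrite ler_pXn2r// nnegrE ltW// divr_gt0.
Qed.

End TangentBound.

(** * Three coordinates for symmetric matrices *)

Section SymmetricCoordinates.
Context {R : realType}.

(** Running the iteration on these coordinates builds symmetry into the solution; nothing has to be
    propagated along the flow. *)
Definition coord3 (M : 'M[R]_2) (k : 'I_3) : R := nth 0 [:: M 0 0; M 0 1; M 1 1] k.

Definition symm3 (u : 'I_3 -> R) : 'M[R]_2 :=
  mx22 (u 0) (u 1) (u 1) (u ord_max).

Lemma ord3P (P : 'I_3 -> Prop) : P 0 -> P 1 -> P ord_max -> forall k, P k.
Proof.
move=> P0 P1 P2; case=> [[|[|[|//]]] ?].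
- by congr P : P0; apply: val_inj.
- by congr P : P1; apply: val_inj.
- by congr P : P2; apply: val_inj.
Qed.

Lemma coord3K (M : 'M[R]_2) : M 1 0 = M 0 1 -> symm3 (coord3 M) = M.
Proof.
move=> sM; apply/matrixP; apply: ord2P; apply: ord2P;
  by rewrite mxE /coord3 /= ?sM.
Qed.

Lemma symm3_sym u : symm3 u 1 0 = symm3 u 0 1.
Proof. by rewrite !mxE. Qed.

Lemma frob_symm3 u : frob (symm3 u) ^+ 2 = u 0 ^+ 2 + 2 * u 1 ^+ 2 + u ord_max ^+ 2.
Proof.
rewrite frob_sqr !big_ord_recl !big_ord0 !mxE /=; ring.
Qed.

Lemma symm3_entry (P : R -> Prop) u : (forall k, P (u k)) -> forall i j, P (symm3 u i j).
Proof. by move=> Pu; apply: ord2P; apply: ord2P; rewrite mxE /=; exact: Pu. Qed.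

Lemma symm3_entry2 (P : R -> R -> Prop) u v : (forall k, P (u k) (v k)) ->
  forall i j, P (symm3 u i j) (symm3 v i j).
Proof. by move=> Pu; apply: ord2P; apply: ord2P; rewrite !mxE /=; exact: Pu. Qed.

Lemma coord3_entry2 (P : R -> R -> Prop) (M N : 'M[R]_2) : (forall i j, P (M i j) (N i j)) ->
  forall k, P (coord3 M k) (coord3 N k).
Proof. by move=> PM; apply: ord3P; apply: PM. Qed.

End SymmetricCoordinates.

(** * Existence and uniqueness for the last equation *)

Section AFSolution.
Context {R : realType}.
Variables (qAF rAF lAF rA rB sB T : R).
Hypotheses (hT : 0 < T) (hrA : 0 < rA) (hrB : 0 < rB) (hsB : 0 < sB)
  (hqAF : 0 < qAF) (hrAF : 0 < rAF) (hlAF : 0 < lAF).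
Variables (tA tB : R -> 'M[R]_2) (g : R -> 'cV[R]_2) (c cg : R).
Hypotheses (bA : forall t, 0 <= t <= T -> frob (tA t) <= c)
  (bB : forall t, 0 <= t <= T -> frob (tB t) <= c)
  (bg : forall t, 0 <= t <= T -> frob (g t) <= cg).

Local Notation rhs := (AF_riccati_rhs qAF rAF lAF rA rB sB).
Local Notation solution := (AF_riccati_solution qAF rAF lAF rA rB sB T tA tB g).

Lemma mean_bound_ge0 : 0 <= c.
Proof.
have T00 : (0 : R) <= 0 <= T by apply/andP; split; [exact: lexx | exact: ltW].
exact: le_trans (frob_ge0 _) (bA T00).
Qed.

Lemma rev_clamp_itv t : 0 <= T - clamp 0 T t <= T.
Proof. by have /andP[? ?] := clamp_itv t (ltW hT); apply/andP; split; lra. Qed.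

(** Two solutions are continuous, hence bounded by a common [K] on [[0, T]], and there the
    right-hand side is Lipschitz. Gronwall with defect [0] makes them equal. *)
Lemma AF_unique th th' : solution th -> solution th' ->
  forall t, t \in `[0, T] -> th' t = th t.
Proof.
move=> [sth dth th0] [sth' dth' th'0] t; rewrite in_itv/= => tT.
have sym (h : R -> 'M[R]_2) r : symmetric_on `[0, T] h -> 0 <= r <= T -> h r 1 0 = h r 0 1.
  move=> sh rT; have D : `[0, T]%classic r by rewrite /= in_itv.
  by have /matrixP/(_ 0 1) := sh r D; rewrite mxE.
have T0 : 0 <= T <= T by apply/andP; split; [exact: ltW | exact: lexx].
have ch (h dh : R -> 'M[R]_2) : has_derivative_on `[0, T] h dh ->
    forall k, continuous (fun s => coord3 (h (T - clamp 0 T s)) k).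
  move/dv_within_coord => hd; apply: ord3P; rewrite /coord3 /=;
  exact: (dv_within_rev_continuous T0 (hd _ _)).
have dh (h dh : R -> 'M[R]_2) : has_derivative_on `[0, T] h dh ->
    forall s, 0 < s < T -> forall k,
    is_derive s 1 (fun s => coord3 (h (T - clamp 0 T s)) k)
                  (- coord3 (dh (T - clamp 0 T s)) k).
  move/dv_within_coord => hd s sT; apply: ord3P; rewrite /coord3 /=;
  exact: (dv_within_rev (lexx T) (hd _ _) sT).
have T0' := ltW hT.
have [K1 K10 K1P] := continuous_bounded T0' (ch _ _ dth).
have [K2 K20 K2P] := continuous_bounded T0' (ch _ _ dth').
pose K := Num.max K1 K2.
have entries (h : R -> 'M[R]_2) C s : symmetric_on `[0, T] h ->
    (forall k r, 0 <= r <= T -> `|coord3 (h (T - clamp 0 T r)) k| <= C) ->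
    0 <= s <= T -> forall i j, `|h (T - clamp 0 T s) i j| <= C.
  move=> sh hC sT; rewrite -(coord3K (sym _ _ sh (rev_clamp_itv s))).
  by apply: (symm3_entry (P := fun x => `|x| <= C)) => k; exact: hC.
have key : forall s, 0 <= s <= T -> forall k,
    `|coord3 (th (T - clamp 0 T s)) k - coord3 (th' (T - clamp 0 T s)) k|
      <= 0 * expR (3%:R * (AF_lip qAF rAF rA rB c K + 1) * T).
  apply: (@gronwall R 3 T (AF_lip qAF rAF rA rB c K) 0 _ _ _ (lexx 0) _
    (fun s sT k => dvB (dh _ _ dth s sT k) (dh _ _ dth' s sT k))).
  - by apply: AF_lip_ge0 => //; [exact: mean_bound_ge0 | rewrite le_max K10].
  - by move=> k s; apply: cvgB; [exact: (ch _ _ dth) | exact: (ch _ _ dth')].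
  - move=> k; rewrite clampK ?lexx ?ltW// subr0 th0 th'0 /coord3.
    exact: subrr.
  move=> s sT m mP; have sT' : 0 <= s <= T by case/andP: sT => ? ?; rewrite !ltW.
  set r := T - clamp 0 T s; have rT : 0 <= r <= T by exact: rev_clamp_itv.
  have hM i j : `|th r i j| <= K.
    by apply: (entries th) => // k q qT; rewrite le_max K1P.
  have hN i j : `|th' r i j| <= K.
    by apply: (entries th') => // k q qT; rewrite le_max K2P// orbT.
  have hd i j : `|th r i j - th' r i j| <= m.
    rewrite -(coord3K (sym _ _ sth rT)) -(coord3K (sym _ _ sth' rT)).
    by move: i j; apply: (symm3_entry2 (P := fun x y => `|x - y| <= m)) => k; exact: mP.
  have hA i j : `|tA r i j| <= c by exact: le_trans (frob_entry _ _ _) (bA rT).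
  have hB i j : `|tB r i j| <= c by exact: le_trans (frob_entry _ _ _) (bB rT).
  have L := AF_rhs_lip lAF sB hrA hrB hqAF hrAF (g r) hA hB hM hN hd.
  move=> k; rewrite addr0 -opprD normrN.
  exact: (coord3_entry2 (P := fun x y => `|x - y| <= AF_lip qAF rAF rA rB c K * m) L k).
have sT : 0 <= T - t <= T by case/andP: tT => ? ?; apply/andP; split; lra.
have E := rev_clampK tT.
have := key _ sT; rewrite E mul0r => {}key.
rewrite -(coord3K (sym _ _ sth tT)) -(coord3K (sym _ _ sth' tT)); congr symm3.
by apply/funext => k; apply/eqP; rewrite eq_sym -subr_eq0 -normr_le0.
Qed.

Hypotheses (sA : forall t, 0 <= t <= T -> tA t 1 0 = tA t 0 1)
  (sB' : forall t, 0 <= t <= T -> tB t 1 0 = tB t 0 1).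
Hypotheses (cA : forall i j, continuous (fun t => tA (clamp 0 T t) i j))
  (cB : forall i j, continuous (fun t => tB (clamp 0 T t) i j))
  (cg' : forall j, continuous (fun t => g (clamp 0 T t) j 0)).

(** Clipping acts on the coordinates rather than on the norm: it is then [1]-Lipschitz in the
    maximum norm used by [picard], keeps the matrix symmetric, and still cannot increase the
    Frobenius norm. *)
Lemma clipped_AF_solution K : 0 <= K -> exists y : 'I_3 -> R -> R,
  (forall k, y k 0 = 0) /\
  forall s, 0 <= s <= T -> forall k, is_derive s 1 (y k)
    (- coord3 (rhs (tA (T - s)) (tB (T - s)) (g (T - s))
                 (symm3 (fun k => clamp (- K) K (y k s)))) k).
Proof.
move=> K0; have T0 := ltW hT.
have E s : T - clamp 0 T s = clamp 0 T (T - clamp 0 T s).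
  by rewrite [RHS]clampK// rev_clamp_itv.
have crev (h : R -> R) : continuous (fun t => h (clamp 0 T t)) ->
    continuous (fun s => h (T - clamp 0 T s)).
  move=> ch s; rewrite (_ : (fun s => h (T - clamp 0 T s)) =
    (fun s => h (clamp 0 T (T - clamp 0 T s)))); last by apply/funext => r; rewrite -E.
  apply: (@continuous_comp _ _ _ (fun s => T - clamp 0 T s) (fun t => h (clamp 0 T t))).
    by apply: cvgB; [exact: cvg_cst | exact: clamp_continuous].
  exact: ch.
have cZ k (h : R -> R) : continuous h -> continuous (fun t => k * h t).
  by move=> ch t; apply: cvgM; [exact: cvg_cst | exact: ch].
have cM (h1 h2 : R -> R) : continuous h1 -> continuous h2 -> continuous (fun t => h1 t * h2 t).
  by move=> ch1 ch2 t; apply: cvgM; [exact: ch1 | exact: ch2].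
have cD (h1 h2 : R -> R) : continuous h1 -> continuous h2 -> continuous (fun t => h1 t + h2 t).
  by move=> ch1 ch2 t; apply: cvgD; [exact: ch1 | exact: ch2].
have cN (h1 : R -> R) : continuous h1 -> continuous (fun t => - h1 t).
  by move=> ch1 t; apply: cvgN; exact: ch1.
have cC (k : R) : continuous (fun _ : R => k) by move=> t; exact: cvg_cst.
pose F s (u : 'I_3 -> R) k := - coord3 (rhs (tA (T - clamp 0 T s)) (tB (T - clamp 0 T s))
   (g (T - clamp 0 T s)) (symm3 (fun k => clamp (- K) K (u k)))) k.
have [] := @picard R 3 T (AF_lip qAF rAF rA rB c K + 1) F (fun=> 0) T0.
- by rewrite ltr_wpDl//; apply: AF_lip_ge0 => //; exact: mean_bound_ge0.
- move=> y cy.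
  have cS i j : continuous (fun t => symm3 (fun k => clamp (- K) K (y k t)) i j).
    have ck k : continuous (fun t => clamp (- K) K (y k t)).
      move=> t; apply: (@continuous_comp _ _ _ (y k) (clamp (- K) K)); first exact: cy.
      exact: clamp_continuous.
    move: i j; apply: ord2P; apply: ord2P; under eq_fun do rewrite mxE /=; exact: ck.
  have cR i j : continuous (fun s => rhs (tA (T - clamp 0 T s)) (tB (T - clamp 0 T s))
     (g (T - clamp 0 T s)) (symm3 (fun k => clamp (- K) K (y k s))) i j).
    under eq_fun do rewrite AF_rhsE.
    have cA' k l := crev (fun t => tA t k l) (@cA k l).
    have cB' k l := crev (fun t => tB t k l) (@cB k l).
    have cg'' k := crev (fun t => g t k 0) (@cg' k).
    apply: (cD); [apply: (cD); [apply: (cD); [apply: (cD); [apply: (cD)|]|]|]|].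
    + by apply: (cZ); apply: (cM); [apply: (cM); [exact: cS | exact: cC] | exact: cS].
    + apply: (cZ); apply: (cD); apply: (cM).
      * by apply: (cM); [exact: cS | exact: cC].
      * exact: cA'.
      * by apply: (cM); [exact: cA' | exact: cC].
      * exact: cS.
    + by apply: (cM); [apply: (cM); [exact: cS | exact: cC] | exact: cB'].
    + by apply: (cM); [apply: (cM); [exact: cB' | exact: cC] | exact: cS].
    + by apply: (cN); apply: (cZ); apply: (cM);
        [apply: (cM); [exact: cA' | exact: cC] | exact: cA'].
    + by apply: (cN); apply: (cZ); apply: (cM); exact: cg''.
  move=> k; apply: (cN); move: k; apply: ord3P; exact: cR.
- move=> s u v d uvd k; set r := T - clamp 0 T s; have rT : 0 <= r <= T by exact: rev_clamp_itv.
  have hA i j : `|tA r i j| <= c by exact: le_trans (frob_entry _ _ _) (bA rT).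
  have hB i j : `|tB r i j| <= c by exact: le_trans (frob_entry _ _ _) (bB rT).
  have clK x : `|clamp (- K) K x| <= K.
    by rewrite ler_norml clamp_itv//; lra.
  have hM w i j : `|symm3 (fun k => clamp (- K) K (w k)) i j| <= K.
    by apply: (symm3_entry (P := fun x => `|x| <= K)) => l; exact: clK.
  have hd i j : `|symm3 (fun k => clamp (- K) K (u k)) i j
      - symm3 (fun k => clamp (- K) K (v k)) i j| <= d.
    apply: (symm3_entry2 (P := fun x y => `|x - y| <= d)) => l.
    exact: le_trans (clamp_lip _ _ _ _) (uvd l).
  have L := AF_rhs_lip lAF sB hrA hrB hqAF hrAF (g r) hA hB (hM u) (hM v) hd.
  have d0 : 0 <= d by exact: le_trans (uvd 0).
  rewrite /F -/r -opprD normrN.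
  apply: (le_trans (coord3_entry2 (P := fun x y => `|x - y| <= _) L k)).
  by rewrite ler_wpM2r// lerDl.
move=> y [y0 dy]; exists y; split=> // s sT k.
by have := dy s sT k; rewrite /F (clampK sT).
Qed.

Lemma AF_exists :
  let d1 := ((qAF + rAF) * rA)^-1 in
  let d2 := 2 * qAF * c / ((qAF + rAF) * rA ^+ 2) + 2 * c / rB in
  let d3 := qAF * rAF * c ^+ 2 / ((qAF + rAF) * rA ^+ 3) + lAF * cg ^+ 2 / sB ^+ 2 in
  T < pi / (2 * Num.sqrt ((d1 + 2^-1) * (d2 ^+ 2 / 2 + d3))) ->
  exists th, solution th.
Proof.
move=> d1 d2 d3 hTpi; have T0 := ltW hT; have c0 := mean_bound_ge0.
have s0 : 0 < qAF + rAF by rewrite addr_gt0.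
have d10 : 0 < d1 by rewrite invr_gt0 mulr_gt0.
have d30 : 0 <= d3.
  have ge0X (x : R) k : 0 < x -> 0 <= x ^+ k by move=> x0; rewrite exprn_ge0// ltW.
  apply: addr_ge0; apply: divr_ge0; [| |apply: mulr_ge0|exact: ge0X].
  - by apply: mulr_ge0; [apply: mulr_ge0; exact: ltW | exact: sqr_ge0].
  - by apply: mulr_ge0; [exact: ltW | exact: ge0X].
  - exact: ltW.
  - exact: sqr_ge0.
(* Division by zero returns [0], so a vanishing sum would turn the assumption on [T] into
   [T < 0]. *)
have n0 : 0 < d2 ^+ 2 / 2 + d3.
  rewrite lt_neqAle addr_ge0 ?divr_ge0 ?sqr_ge0// andbT.
  apply: contraTneq hTpi => <-.
  by rewrite mulr0 sqrtr0 mulr0 invr0 mulr0 -leNgt.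
have m0 : 0 < d1 + 2^-1 by rewrite addr_gt0// invr_gt0.
have [K K0 KP] := tan_bound m0 n0 hTpi.
have [y [y0 dy]] := clipped_AF_solution K0.
pose cl s k := clamp (- K) K (y k s).
pose rh s := rhs (tA (T - s)) (tB (T - s)) (g (T - s)) (symm3 (cl s)).
have rT s : 0 <= s <= T -> 0 <= T - s <= T.
  by case/andP => ? ?; apply/andP; split; lra.
have symr s : 0 <= s <= T -> rh s 1 0 = rh s 0 1.
  by move=> sT; apply: AF_rhs_sym; rewrite ?sA ?sB' ?symm3_sym ?rT.
pose yc k s := y k (clamp 0 T s).
pose E s := yc 0 s * yc 0 s + 2 * (yc 1 s * yc 1 s) + yc ord_max s * yc ord_max s.
have EF s : E s = frob (symm3 (yc ^~ s)) ^+ 2 by rewrite frob_symm3 /E !expr2.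
have cyc k : continuous (yc k).
  by apply: continuous_clamp => // s sT; exact: dv_continuous (dy s sT k).
have cE : continuous E.
  have cM h1 h2 : continuous (h1 : R -> R) -> continuous (h2 : R -> R) ->
    continuous (fun t => h1 t * h2 t).
    by move=> ch1 ch2 t; apply: cvgM; [exact: ch1 | exact: ch2].
  move=> s; apply: cvgD; [apply: cvgD | apply: cM; exact: cyc].
    by apply: cM; exact: cyc.
  by apply: cvgM; [exact: cvg_cst | apply: cM; exact: cyc].
have EK : forall s, 0 <= s <= T -> E s <= K ^+ 2.
  apply: (KP E (fun s => - 2 * \sum_i \sum_j symm3 (yc ^~ s) i j * rh s i j) cE).
  - by move=> s; rewrite EF sqr_ge0.
  - by rewrite /E /yc clampK ?lexx ?T0// !y0; ring.
  - move=> s sT; have sT' : 0 <= s <= T by case/andP: sT => ? ?; rewrite !ltW.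
    have dyc k : is_derive s 1 (yc k) (- coord3 (rh s) k).
      exact: (dv_clamp sT (dy s sT' k)).
    have D := dvD (dvD (dvM (dyc 0) (dyc 0)) (dvZ 2 (dvM (dyc 1) (dyc 1))))
      (dvM (dyc ord_max) (dyc ord_max)).
    apply: is_derive_eq D _.
    rewrite !big_ord_recl !big_ord0 /coord3 /=.
    have -> : lift ord0 ord0 = 1 :> 'I_2 by apply: val_inj.
    rewrite (symr s sT') !mxE /=; ring.
  move=> s sT; have sT' : 0 <= s <= T by case/andP: sT => ? ?; rewrite !ltW.
  set Th := symm3 (yc ^~ s).
  have -> : - 2 * \sum_i \sum_j Th i j * rh s i j =
      2 * \sum_i \sum_j Th i j * (- rh s) i j.
    rewrite mulNr -mulrN; congr (2 * _); rewrite -sumrN; apply: eq_bigr => i _.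
    by rewrite -sumrN; apply: eq_bigr => j _; rewrite [(- rh s) i j]mxE mulrN.
  rewrite -mulrA ler_pM2l//; apply: (le_trans (frob_inner _ _)); rewrite frobN.
  rewrite EF -/Th sqrtr_sqr ger0_norm ?frob_ge0//.
  apply: ler_wpM2l; first exact: frob_ge0.
  have TT := rT s sT'.
  apply: (le_trans (AF_rhs_frob hrA hrB hsB hqAF hrAF hlAF _ (bA TT) (bB TT) (bg TT))).
  rewrite -/d1 -/d2 -/d3; set p := frob (symm3 (cl s)).
  have p0 : 0 <= p by exact: frob_ge0.
  have pT : p ^+ 2 <= frob Th ^+ 2.
    have h k : cl s k ^+ 2 <= yc k s ^+ 2.
      rewrite -(real_normK (num_real (cl s k))) -(real_normK (num_real (yc k s))).
      by rewrite ler_pXn2r ?nnegrE// /yc clampK// normr_clamp_le.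
    by rewrite !frob_symm3; have := h 0; have := h 1; have := h ord_max; lra.
  have h1 : (d1 + 2^-1) * p ^+ 2 <= (d1 + 2^-1) * frob Th ^+ 2 by rewrite ler_pM2l.
  have := sqr_ge0 (p - d2); move: h1; lra.
have yK k s : 0 <= s <= T -> - K <= y k s <= K.
  move=> sT; rewrite -ler_norml -(ler_pXn2r (ltn0Sn 1)) ?nnegrE//.
  rewrite real_normK ?num_real//; apply: (le_trans _ (EK s sT)); rewrite /E /yc clampK//.
  by move: k; apply: ord3P; have := sqr_ge0 (y 0 s); have := sqr_ge0 (y 1 s);
    have := sqr_ge0 (y ord_max s); lra.
have dy' s : 0 <= s <= T -> forall k, is_derive s 1 (y k)
    (- coord3 (rhs (tA (T - s)) (tB (T - s)) (g (T - s)) (symm3 (y ^~ s))) k).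
  move=> sT k; have := dy s sT k.
  rewrite (_ : (fun k => clamp (- K) K (y k s)) = y ^~ s)//.
  by apply/funext => l; rewrite clampK// yK.
(* The derivatives of [y] are two-sided even at the ends of [[0, T]], so those relative to the
   segment follow without case distinction. *)
pose th t := symm3 (fun k => y k (T - t)); exists th; split.
- by move=> t _; apply/matrixP; apply: ord2P; apply: ord2P; rewrite !mxE.
- apply/dv_within_coord => i j; apply: dv_dv_within => t; rewrite /= in_itv/= => tT.
  have tT' := rT t tT; have TtE : T - (T - t) = t by ring.
  have dth k : is_derive t 1 (fun t => y k (T - t))
      (coord3 (rhs (tA t) (tB t) (g t) (th t)) k).
    have := dv_rev (dy' _ tT' k).
    by rewrite opprK TtE.
  have sy : rhs (tA t) (tB t) (g t) (th t) 1 0 = rhs (tA t) (tB t) (g t) (th t) 0 1.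
    by apply: AF_rhs_sym; rewrite ?sA ?sB' ?symm3_sym.
  move: i j; apply: ord2P; apply: ord2P; rewrite ?sy.
  + by apply: (is_derive_ext (dth 0)) => r; rewrite mxE.
  + by apply: (is_derive_ext (dth 1)) => r; rewrite mxE.
  + by apply: (is_derive_ext (dth 1)) => r; rewrite mxE.
  + by apply: (is_derive_ext (dth ord_max)) => r; rewrite mxE.
rewrite /th subrr; apply/matrixP; apply: ord2P; apply: ord2P; by rewrite !mxE /= y0.
Qed.

End AFSolution.

(** * Verification of the assumptions on the averaged coefficients, and conclusion *)

Theorem proposition3 (R : realType)
  (T qA qB rA rB sB qAF rAF lAF mAl mAu mA muB rhoB mBl mBu : R)
  (hT : 0 < T) (hqA : 0 < qA) (hqB : 0 < qB) (hrA : 0 < rA) (hrB : 0 < rB)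
  (hsB : 0 < sB) (hqAF : 0 < qAF) (hrAF : 0 < rAF) (hlAF : 0 < lAF)
  (hmA : mAl <= mA <= mAu) (hrhoB : 0 < rhoB) (hmB : mBl < mBu)
  (r : R) (hr : 0 < r) (z : 'cV[R]_2) (hz : frob z <= r)
  (thA thB : R -> R -> R -> 'M[R]_2) (ctheta cg : R) :
  let cA := Num.max `|mAl| `|mAu| in
  let cB := Num.max `|mBl| `|mBu| in
  let tau := horizon qA qB rA rB cA cB in
  let tbA := theta_bar muB rhoB mBl mBu mA thA in
  let tbB := theta_bar muB rhoB mBl mBu mA thB in
  let g := gvec rB muB rhoB mBl mBu mA thB in
  let d1 := ((qAF + rAF) * rA)^-1 in
  let d2 := 2 * qAF * ctheta / ((qAF + rAF) * rA ^+ 2) + 2 * ctheta / rB in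
  let d3 := qAF * rAF * ctheta ^+ 2 / ((qAF + rAF) * rA ^+ 3)
            + lAF * cg ^+ 2 / sB ^+ 2 in
  (forall a b : R,
     game_riccati_solution qA qB rA rB a b T `[0, tau]
       (fun t => thA t a b) (fun t => thB t a b)) ->
  ctheta%:E = maxe (ereal_sup [set (frob (tbA t))%:E | t in `[0, tau]])
                   (ereal_sup [set (frob (tbB t))%:E | t in `[0, tau]]) ->
  cg%:E = ereal_sup [set (frob (g t w))%:E
                    | t in `[0, tau] & w in [set w | frob w <= r]] ->
  T < Num.min tau
        (pi / (2 * Num.sqrt ((d1 + 2^-1) * (d2 ^+ 2 / 2 + d3)))) ->
  exists2 th : R -> 'M[R]_2,
    AF_riccati_solution qAF rAF lAF rA rB sB T tbA tbB (fun t => g t z) th &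
    forall th' : R -> 'M[R]_2,
      AF_riccati_solution qAF rAF lAF rA rB sB T tbA tbB (fun t => g t z) th' ->
      forall t, t \in `[0, T] -> th' t = th t.
Proof.
move=> cA cB tau tbA tbB g d1 d2 d3 game hct hcg.
rewrite lt_min => /andP[Ttau Tpi].
have inD t : 0 <= t <= T -> `[0, tau]%classic t.
  by case/andP => t0 tT; rewrite /= in_itv/= t0 (le_trans tT (ltW Ttau)).
(* [ctheta] is a real number, so its defining equation in the extended reals already says that both
   suprema are finite. *)
have bA t : 0 <= t <= T -> frob (tbA t) <= ctheta.
  move=> /inD tD; rewrite -lee_fin hct le_max; apply/orP; left.
  by apply: ereal_sup_ubound; exists t.
have bB t : 0 <= t <= T -> frob (tbB t) <= ctheta.
  move=> /inD tD; rewrite -lee_fin hct le_max; apply/orP; right.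
  by apply: ereal_sup_ubound; exists t.
have bg t : 0 <= t <= T -> frob (g t z) <= cg.
  move=> /inD tD; rewrite -lee_fin hcg.
  by apply: ereal_sup_ubound; exists t => //; exists z.
have sA t : 0 <= t <= T -> tbA t 1 0 = tbA t 0 1.
  move=> /inD; rewrite /= in_itv/= => tD; rewrite [LHS]mxE [RHS]mxE.
  by congr (fine (expectation _ _)); apply/funext => b; have [] := game_symmetric (game mA b) tD.
have sB' t : 0 <= t <= T -> tbB t 1 0 = tbB t 0 1.
  move=> /inD; rewrite /= in_itv/= => tD; rewrite [LHS]mxE [RHS]mxE.
  by congr (fine (expectation _ _)); apply/funext => b; have [] := game_symmetric (game mA b) tD.
have cA' i j : continuous (fun t => tbA (clamp 0 T t) i j).
  apply: (theta_bar_continuous hqA hqB hrA hrB hT Ttau game) => //.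
  exact: (game_entryA Ttau game).
have cB' i j : continuous (fun t => tbB (clamp 0 T t) i j).
  apply: (theta_bar_continuous hqA hqB hrA hrB hT Ttau game) => //.
  exact: (game_entryB Ttau game).
have cg' j : continuous (fun t => g (clamp 0 T t) z j 0).
  exact: (gvec_continuous hqA hqB hrA hrB hT Ttau game).
have [th sth] := AF_exists hT hrA hrB hsB hqAF hrAF hlAF bA bB bg sA sB' cA' cB' cg' Tpi.
exists th => // th' sth'.
exact: (AF_unique hT hrA hrB hqAF hrAF bA bB sth sth').
Qed.
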